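(* Let $\mathbb K$ be algebraically closed of characteristic $0$, let $\mathbb V$ be a $2n$-dimensional space with $2n\ge4$ carrying a nondegenerate skew-symmetric form, and let $\mathfrak g=\mathfrak{sp}(\mathbb V)\cong\mathfrak{sp}_{2n}\subset\widetilde{\mathfrak g}=\mathfrak{gl}(\mathbb V)$, with $G=Sp(\mathbb V)$. For $1\le i\le n$ let $\bar F_{2i}\in\mathcal S(\mathfrak g)^{\mathfrak g}$ be the preimage of $\Delta_{2i}|_{\mathfrak g}$ under $\kappa_{\mathfrak g}$, and for $1\le j\le 2n$ let $F_j=\kappa_{\widetilde{\mathfrak g}}^{-1}(\Delta_j)\in\mathcal S(\widetilde{\mathfrak g})$. Then for every nilpotent $e\in\mathfrak g$: $\{\bar F_{2i}:1\le i\le n\}$ is a very good generating system for $e$; $\mathcal S(\mathfrak g_e)^{\mathfrak g_e}=\mathcal S(\mathfrak g_e)^{G_e}=\mathbb K[{}^{e}\!\bar F_2,\dots,{}^{e}\!\bar F_{2n}]$; and $\deg{}^{e}\!\bar F_{2i}=\deg{}^{e}\!F_{2i}$ for all $1\le i\le n$, where ${}^{e}\!F_{2i}$ is computed in $\widetilde{\mathfrak g}$.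
   Context: $\Delta_j\in\mathbb K[\widetilde{\mathfrak g}]$ is the sum of principal $j\times j$ minors of the generic matrix. On $\widetilde{\mathfrak g}$ use a nonzero multiple of the trace form, and on $\mathfrak g$ its restriction (nondegenerate); $\kappa_{\widetilde{\mathfrak g}}$, $\kappa_{\mathfrak g}$ are the algebra isomorphisms $\mathcal S(\cdot)\to\mathbb K[\cdot]$ extending $x\mapsto(x,\cdot)$. For $e\ne0$ choose an $\mathfrak{sl}_2$-triple $(e,h,f)$ in $\mathfrak g$ and normalise $(e,f)=1$ (for $e=0$ put $f=0$). For $\mathfrak s\in\{\mathfrak g,\widetilde{\mathfrak g}\}$, $\mathfrak s_e,\mathfrak s_f$ are centralisers and $\kappa_e:\mathcal S(\mathfrak s_e)\to\mathbb K[\mathfrak s_f]$ extends $x\mapsto(x,\cdot)|_{\mathfrak s_f}$; for homogeneous $F\in\mathcal S(\mathfrak s)$, ${}^{e}\!F:=\kappa_e^{-1}(\mathrm{in}(\psi_F))$ with $\psi_F(x)=\kappa_{\mathfrak s}(F)(e+x)$ on $\mathfrak s_f$ and $\mathrm{in}$ the lowest-degree nonzero homogeneous component. $G_e$ is the centraliser of $e$ in $G$. A homogeneous generating system $\{H_1,\dots,H_n\}$ of $\mathcal S(\mathfrak g)^{\mathfrak g}$ is very good for $e$ if the set of $\gamma\in\mathfrak g_e^*$ at which $d_\gamma({}^{e}\!H_1),\dots,d_\gamma({}^{e}\!H_n)$ are linearly dependent has codimension $\ge2$ in $\mathfrak g_e^*$. *)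

(* Defs.v *)
From HB Require Import structures.
From mathcomp Require Import all_boot all_order all_algebra.
From mathcomp Require Import mpoly.
From Stdlib Require Import ClassicalEpsilon.
Set Implicit Arguments. Unset Strict Implicit. Unset Printing Implicit Defensive.
Import GRing.Theory.
Local Open Scope ring_scope.

Section Defs.
Variables (K : fieldType) (N : nat).
Local Notation M := 'M[K]_N.

Definition trform (c : K) (x y : M) : K := c * \tr (x *m y).

Definition sp (Om : M) : {vspace M} :=
  lker (linfun (fun X : M => X^T *m Om + Om *m X)).

Definition cent (s : {vspace M}) (x : M) : {vspace M} :=
  (s :&: lker (linfun (fun y : M => x *m y - y *m x)))%VS.

Definition Ge (Om e : M) (g : M) : Prop := g^T *m Om *m g = Om /\ g *m e = e *m g.

Definition Delta (j : nat) (A : M) : K :=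
  \sum_(p : {ffun 'I_j -> 'I_N} |
         [forall a : 'I_j, forall b : 'I_j, (a < b)%N ==> (p a < p b)%N])
    \det (\matrix_(a < j, b < j) A (p a) (p b)).

(* S(A) for a subspace A of M is modelled as polynomials in the coordinates
   of the basis  vbasis A , i.e. 'X_i <-> (vbasis A)_i. *)
Definition bas (A : {vspace M}) (i : 'I_(\dim A)) : M := tnth (vbasis A) i.

Definition lin (A : {vspace M}) (v : M) : {mpoly K[\dim A]} :=
  \sum_(i < \dim A) coord (vbasis A) i v *: 'X_i.

(* kappa_{A,B} : S(A) -> K[B], x |-> (x, .)|_B, extended multiplicatively *)
Definition kappa (c : K) (A : {vspace M}) (P : {mpoly K[\dim A]}) : M -> K :=
  fun y => P.@[fun i => trform c (bas i) y].

Definition kinv (c : K) (A B : {vspace M}) (phi : M -> K) : {mpoly K[\dim A]} :=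
  epsilon (inhabits 0)
    (fun P : {mpoly K[\dim A]} => forall y, (y \in B)%VS -> kappa c P y = phi y).

Definition hcomp (m : nat) (d : nat) (p : {mpoly K[m]}) : {mpoly K[m]} :=
  \sum_(mu <- msupp p | mdeg mu == d) p@_mu *: 'X_[mu].
Definition lowdeg (m : nat) (p : {mpoly K[m]}) : nat :=
  \big[minn/msize p]_(mu <- msupp p) mdeg mu.
Definition inlow (m : nat) (p : {mpoly K[m]}) : {mpoly K[m]} :=
  hcomp (lowdeg p) p.

(* psi_F(x) = kappa_s(F)(e + x) on s_f, written in the coordinates of the
   basis of s_f:  t |-> kappa_s(F)(e + sum_l t_l (vbasis s_f)_l). *)
Definition psi_poly (c : K) (s : {vspace M}) (e f : M) (F : {mpoly K[\dim s]})
  : {mpoly K[\dim (cent s f)]} :=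
  comp_mpoly
    [tuple (trform c (bas i) e)%:MP +
           \sum_(l < \dim (cent s f)) trform c (bas i) (bas l) *: 'X_l
    | i < \dim s] F.

Definition inpsi (c : K) (s : {vspace M}) (e f : M) (F : {mpoly K[\dim s]})
  : M -> K :=
  fun y => (inlow (psi_poly c e f F)).@[fun l => coord (vbasis (cent s f)) l y].

Definition eF (c : K) (s : {vspace M}) (e f : M) (F : {mpoly K[\dim s]})
  : {mpoly K[\dim (cent s e)]} :=
  kinv c (cent s e) (cent s f) (inpsi c e f F).

Definition lie_inv (A : {vspace M}) (P : {mpoly K[\dim A]}) : Prop :=
  forall xi, (xi \in A)%VS ->
    \sum_(i < \dim A) mderiv i P * lin A (xi *m bas i - bas i *m xi) = 0.

Definition grp_inv (A : {vspace M}) (Gp : M -> Prop) (P : {mpoly K[\dim A]}) : Prop :=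
  forall g, Gp g ->
    comp_mpoly [tuple lin A (g *m bas i *m invmx g) | i < \dim A] P = P.

Definition in_subalg (m k : nat) (H : 'I_k -> {mpoly K[m]}) (P : {mpoly K[m]}) : Prop :=
  exists R : {mpoly K[k]}, P = comp_mpoly [tuple H i | i < k] R.

Definition homogeneous (m : nat) (P : {mpoly K[m]}) : Prop :=
  exists d, P \is d.-homog.

Definition deg (m : nat) (P : {mpoly K[m]}) : nat := (msize P).-1.

Definition zclosed (m : nat) (Z : ('I_m -> K) -> Prop) : Prop :=
  exists S : {mpoly K[m]} -> Prop, forall t, Z t <-> (forall p, S p -> p.@[t] = 0).

Definition irred_closed (m : nat) (Z : ('I_m -> K) -> Prop) : Prop :=
  [/\ zclosed Z, exists t, Z t &
      forall Z1 Z2, zclosed Z1 -> zclosed Z2 -> (forall t, Z t <-> Z1 t \/ Z2 t) ->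
        (forall t, Z t <-> Z1 t) \/ (forall t, Z t <-> Z2 t)].

(* every chain C_0 < C_1 < ... < C_l of irreducible closed subsets of Z has
   l <= m - 2, i.e. dim Z <= dim K^m - 2 *)
Definition codim_ge2 (m : nat) (Z : ('I_m -> K) -> Prop) : Prop :=
  forall (l : nat) (C : nat -> ('I_m -> K) -> Prop),
    (forall i, (i <= l)%N -> irred_closed (C i) /\ (forall t, C i t -> Z t)) ->
    (forall i, (i < l)%N ->
        (forall t, C i t -> C i.+1 t) /\ (exists t, C i.+1 t /\ ~ C i t)) ->
    (l + 2 <= m)%N.

(* points of g_e^* (coordinates gamma(b_j)) where the differentials of
   P_1..P_k are linearly dependent *)
Definition dep_locus (m k : nat) (P : 'I_k -> {mpoly K[m]}) (t : 'I_m -> K) : Prop :=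
  (\rank (\matrix_(i < k, j < m) (mderiv j (P i)).@[t]) < k)%N.

Definition gen_system (s : {vspace M}) (k : nat) (H : 'I_k -> {mpoly K[\dim s]}) : Prop :=
  (forall i, homogeneous (H i)) /\ (forall P, lie_inv P <-> in_subalg H P).

Definition very_good (c : K) (s : {vspace M}) (e f : M) (k : nat)
  (H : 'I_k -> {mpoly K[\dim s]}) : Prop :=
  gen_system H /\ codim_ge2 (dep_locus (fun i => eF c e f (H i))).

End Defs.

Arguments bas {K N} A i.
Arguments kappa {K N} c A P y.
Arguments psi_poly {K N} c s e f F.
Arguments inpsi {K N} c s e f F y.
Arguments eF {K N} c s e f F.
Arguments lie_inv {K N} A P.
Arguments grp_inv {K N} A Gp P.
Arguments gen_system {K N} s k H.
Arguments very_good {K N} c s e f k H.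

(* Main.v *)
(* In a Jordan basis of e adapted to the form, with chains l_i of lengths lam_i, the slice
   x = U L (L the matrix of the rows l_i) turns det (z - e - tau x) into the small determinant
   det (diag (z ^ lam_i) - tau Y).  It shows that the lowest component F_j of x |-> Delta_j (e + x)
   has degree m, where lam_0 + .. + lam_(m-2) < j <= lam_0 + .. + lam_(m-1).  This component is
   invariant under translation by [e, gl]; since s = s_f + [e, s], it is eF_j seen as a function
   on the dual of s_e.

   Two points of sp, alpha with Y diagonal with distinct entries and beta with Y Hessenberg, give
   Jacobian minors D1, D2 of the F_2i with D1 (s alpha + t beta) = c t ^ a and D2 (alpha) <> 0.
   Such minors are coprime, so the differentials are dependent in codimension two only.  The
   stabiliser of alpha in g_e has an isotropic image in the standard module, hence dimension at
   most n, so the gradient of an invariant P is a combination of those of the F_2i over the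
   fraction field.  Coprimality of D1 and D2 makes the coefficients polynomial, and Euler's
   formula puts P into K[F_2, .., F_2n] by induction on the degree. *)

(* Codimension is defined by chains of irreducible closed sets, so it is bounded without dimension
   theory: a chain of length l gives l polynomials independent modulo the ideal of its largest
   member, D2 and D1 raise this to l + 2, and a count of monomials bounds it by the number of
   variables. Coprimality is tested on one plane: in the direction beta the minor D1 is monic up to
   a constant, over alpha it reduces to a pure power of the parameter, and D2 does not vanish there.

   Nothing is exponentiated. Translation by [e, gl] comes from conjugation by 1 + t y with y of
   square zero, the invariance of derivatives from 1 + t y for generic t, and the passage from group
   to Lie algebra from Cayley transforms.

   Minors on sp are computed along arbitrary directions of gl: for even j, at a point of sp, a
   direction and its projection to sp give the same derivative. The arguments about g_e are carried
   out for an abstract subspace A with the same elements, so that e = 0 yields the generating system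
   of S(g)^g. *)
Require Import Defs.
From HB Require Import structures.
From mathcomp Require Import all_boot all_order all_algebra.
From mathcomp Require Import mpoly zify ring.
From Stdlib Require Import Classical ClassicalEpsilon.
Set Implicit Arguments. Unset Strict Implicit. Unset Printing Implicit Defensive.
Import GRing.Theory.
Local Open Scope ring_scope.

(** * Polynomials along lines and curves *)

Section Infinite.
Variable K : fieldType.
Hypothesis K0 : [pchar K] =i pred0.

Lemma natr_neq0 (n : nat) : (n.+1%:R : K) != 0.
Proof. by rewrite ((pcharf0P K).1 K0). Qed.

Lemma natr_inj : injective (fun n : nat => n%:R : K).
Proof.
have wl (a b : nat) : (a <= b)%N -> a%:R = b%:R :> K -> a = b.
  move=> ab /eqP; rewrite eq_sym -subr_eq0 -natrB // ((pcharf0P K).1 K0) subn_eq0 => ba.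
  by apply/eqP; rewrite eqn_leq ab.
by move=> a b /= e; case: (leqP a b) => [/wl ->//|/ltnW /wl -> //].
Qed.

Lemma poly_fun_eq0 (p : {poly K}) : (forall t, t != 0 -> p.[t] = 0) -> p = 0.
Proof.
move=> h; apply/eqP; apply/contraT => p0.
pose rs := [seq (n.+1)%:R : K | n <- iota 0 (size p)].
have /(max_poly_roots p0) : all (root p) rs.
  by apply/allP => x /mapP[n _ ->]; rewrite rootE h ?natr_neq0.
rewrite map_inj_uniq; last by move=> a b /natr_inj [].
by move=> /(_ (iota_uniq _ _)); rewrite size_map size_iota ltnn.
Qed.

Lemma poly_fun_inj (p q : {poly K}) : (forall t, t != 0 -> p.[t] = q.[t]) -> p = q.
Proof.
move=> h; apply/eqP; rewrite -subr_eq0; apply/eqP/poly_fun_eq0 => t t0.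
by rewrite hornerD hornerN h // subrr.
Qed.

End Infinite.

Section Line.
Variables (K : fieldType) (m : nat).
Implicit Types (a w : 'I_m -> K) (p q : {mpoly K[m]}).

Definition der p a w : K := \sum_(j < m) (mderiv j p).@[a] * w j.

Lemma mpoly_gen (P : {mpoly K[m]} -> Prop) :
  P 1 -> (forall p q, P p -> P q -> P (p + q)) ->
  (forall c p, P p -> P (c *: p)) -> (forall p q, P p -> P q -> P (p * q)) ->
  (forall i, P 'X_i) -> forall p, P p.
Proof.
move=> P1 PD PZ PM PX p; rewrite (mpolyE p).
elim/big_rec: _ => [|mu q _ Pq]; first by rewrite -(scale0r 1); exact: PZ.
apply: PD => //; apply: PZ; rewrite mpolyXE_id.
elim/big_rec: _ => // i r _ Pr; apply: (PM) => //.
by elim: (mu i) => [|k IH]; rewrite ?expr0 // exprS; apply: (PM).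
Qed.

Definition curve (q : 'I_m -> {poly K}) (p : {mpoly K[m]}) : {poly K} := mmap (@polyC K) q p.
HB.instance Definition _ (q : 'I_m -> {poly K}) := GRing.RMorphism.copy (curve q) (mmap (@polyC K) q).

Lemma curve_horner (q : 'I_m -> {poly K}) p t : (curve q p).[t] = p.@[fun i => (q i).[t]].
Proof.
rewrite /curve /mmap mevalE horner_sum; apply: eq_bigr => mu _.
rewrite hornerM hornerC /mmap1 horner_prod; congr (_ * _).
by apply: eq_bigr => i _; rewrite horner_exp.
Qed.

Lemma curveX (q : 'I_m -> {poly K}) i : curve q 'X_i = q i.
Proof. by rewrite /curve mmapX mmap1U. Qed.

Lemma curveZ (q : 'I_m -> {poly K}) c p : curve q (c *: p) = c *: curve q p.
Proof. by rewrite /curve mmapZ mul_polyC. Qed.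

Lemma deriv_curve (q : 'I_m -> {poly K}) p : (curve q p)^`() = \sum_(j < m) (q j)^`() * curve q (mderiv j p).
Proof.
move: p; apply: mpoly_gen.
- rewrite rmorph1 derivC big1 // => j _.
  by rewrite -mpolyC1 mderivC rmorph0 mulr0.
- move=> p r hp hr; rewrite rmorphD derivD hp hr -big_split; apply: eq_bigr => j _.
  by rewrite mderivD rmorphD mulrDr.
- move=> c p hp; rewrite curveZ derivZ hp scaler_sumr; apply: eq_bigr => j _.
  by rewrite mderivZ curveZ scalerAr.
- move=> p r hp hr; rewrite rmorphM derivM hp hr mulr_suml mulr_sumr -big_split.
  apply: eq_bigr => j _.
  by rewrite mderivM rmorphD !rmorphM mulrDr !mulrA [curve q p * _]mulrC.
move=> i; rewrite curveX.
rewrite (bigD1 i) //= big1 ?addr0 => [|j ji].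
  rewrite mderivX mnmE eqxx scale1r.
  have -> : (U_(i) - U_(i) = 0 :> 'X_{1..m})%MM by apply/mnmP => l; rewrite !mnmE subnn.
  by rewrite mpolyX0 rmorph1 mulr1.
by rewrite mderivX mnmE eq_sym (negbTE ji) scale0r rmorph0 mulr0.
Qed.

Lemma curve1 (q : 'I_m -> {poly K}) p : (curve q p)`_1 = der p (fun i => (q i).[0]) (fun i => (q i)`_1).
Proof.
have: (curve q p)^`()`_0 = der p (fun i => (q i).[0]) (fun i => (q i)`_1).
  rewrite deriv_curve coef_sum; apply: eq_bigr => j _.
  by rewrite coef0M coef_deriv mulr1n mulrC -[(curve _ _)`_0]horner_coef0 curve_horner.
by rewrite coef_deriv mulr1n.
Qed.

Definition line a w : {mpoly K[m]} -> {poly K} := curve (fun i => (a i)%:P + (w i) *: 'X).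
HB.instance Definition _ a w := GRing.RMorphism.copy (line a w)
  (curve (fun i => (a i)%:P + (w i) *: 'X)).

Lemma line_horner a w p t : (line a w p).[t] = p.@[fun i => a i + t * w i].
Proof. by rewrite /line curve_horner; apply: meval_eq => i; rewrite !hornerE mulrC. Qed.

Lemma line0 a w p : (line a w p)`_0 = p.@[a].
Proof.
rewrite -horner_coef0 line_horner; apply: meval_eq => i.
by rewrite mul0r addr0.
Qed.

Lemma line1 a w p : (line a w p)`_1 = der p a w.
Proof.
rewrite /line curve1; apply: eq_bigr => j _; rewrite coefD coefC coefZ coefX mulr1 add0r.
by congr (_ * _); apply: meval_eq => i; rewrite !hornerE.
Qed.

Lemma der_lin p a (I : finType) (c : I -> K) (w : I -> 'I_m -> K) :
  der p a (fun j => \sum_i c i * w i j) = \sum_i c i * der p a (w i).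
Proof.
rewrite /der (eq_bigr (fun j => \sum_i c i * ((mderiv j p).@[a] * w i j))); last first.
  by move=> j _; rewrite mulr_sumr; apply: eq_bigr => i _; rewrite mulrCA.
by rewrite exchange_big; apply: eq_bigr => i _; rewrite mulr_sumr.
Qed.

Lemma der_eq p a a' w w' : a =1 a' -> w =1 w' -> der p a w = der p a' w'.
Proof.
by move=> h1 h2; apply: eq_bigr => j _; rewrite h2 (meval_eq _ h1).
Qed.

Hypothesis K0 : [pchar K] =i pred0.

Lemma der_uniq p a w c0 c1 :
  (forall t, t != 0 -> p.@[fun i => a i + t * w i] = c0 + t * c1) -> der p a w = c1.
Proof.
move=> h; rewrite -line1.
suff -> : line a w p = c0%:P + c1 *: 'X by rewrite coefD coefC coefZ coefX add0r mulr1.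
by apply: (poly_fun_inj K0) => t t0; rewrite line_horner h // !hornerE mulrC.
Qed.

Lemma mderiv_eq0 p : (forall i, mderiv i p = 0) -> p = (p@_0)%:MP.
Proof.
move=> h; apply/mpolyP => mu; rewrite mcoeffC.
case: (eqVneq mu 0%MM) => [->|mu0]; first by rewrite mulr1.
rewrite mulr0.
have [i mi] : exists i, mu i != 0%N.
  apply/existsP; apply: contraNT mu0; rewrite negb_exists => /forallP h0.
  by apply/eqP/mnmP => i; rewrite mnm0E; apply/eqP; move: (h0 i); rewrite negbK.
have e : mu = (mu - U_(i) + U_(i))%MM.
  by rewrite submK //; apply/mnm_lepP => j; rewrite mnmE; case: eqP => // <-; rewrite lt0n.
move: (h i) => /(congr1 (mcoeff (mu - U_(i)))) /eqP.
rewrite mcoeff_deriv mcoeff0 -e -mulr_natr mulf_eq0.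
by rewrite (negbTE (natr_neq0 K0 _)) orbF => /eqP.
Qed.

(** The partial derivatives of a polynomial that vanishes as a function vanish too and have smaller
    size; induction makes them zero, and in characteristic 0 only a constant is left. *)
Lemma meval_eq0 p : (forall t, p.@[t] = 0) -> p = 0.
Proof.
have [k] := ubnP (msize p); elim: k p => // k IH p; rewrite ltnS => sp h.
have d0 i : mderiv i p = 0.
  case: (eqVneq p 0) => [->|p0]; first by rewrite mderiv0.
  apply: IH.
    rewrite (leq_trans _ sp) //; rewrite msizeE (mpolySpred mdeg p0) ltnS.
    apply/bigmax_leqP_seq => mu; rewrite mcoeff_msupp mcoeff_deriv => h1 _.
    have: (mu + U_(i))%MM \in msupp p.
      by rewrite mcoeff_msupp; apply: contraNneq h1 => ->; rewrite mul0rn.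
    move/msize_mdeg_lt; rewrite mdegD mdeg1 addn1 (mpolySpred mdeg p0).
    by rewrite ltnS.
  move=> a; pose w := fun j : 'I_m => (j == i)%:R : K.
  have: der p a w = 0 by apply: (@der_uniq _ _ _ 0) => t _; rewrite h mulr0 addr0.
  rewrite /der (bigD1 i) //= big1 ?addr0 /w ?eqxx ?mulr1 // => j ji.
  by rewrite (negbTE ji) mulr0.
have e := mderiv_eq0 d0; move: (h (fun=> 0)); rewrite e mevalC => ->.
by rewrite mpolyC0.
Qed.

Lemma meval_inj p q : (forall t, p.@[t] = q.@[t]) -> p = q.
Proof.
move=> h; apply/eqP; rewrite -subr_eq0; apply/eqP/meval_eq0 => t.
by rewrite mevalB h subrr.
Qed.

Lemma hcompE d p : hcomp d p = pihomog mdeg d p.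
Proof. by rewrite pihomogE. Qed.

Lemma homog_scale d p t a : p \is d.-homog -> p.@[fun i => t * a i] = t ^+ d * p.@[a].
Proof.
move=> /dhomogP hp; rewrite !mevalE mulr_sumr big_seq [RHS]big_seq.
apply: eq_bigr => mu /hp e; rewrite mulrCA; congr (_ * _).
under eq_bigr do rewrite exprMn; rewrite big_split /=; congr (_ * _).
rewrite prodrXr; congr (_ ^+ _); rewrite -[d]e; exact: esym (mdegE mu).
Qed.

Lemma meval_pihomog p k t a : (msize p <= k)%N ->
  p.@[fun i => t * a i] = \sum_(d < k) (pihomog mdeg d p).@[a] * t ^+ d.
Proof.
move=> sp; rewrite {1}(pihomog_partitionE sp) raddf_sum /=; apply: eq_bigr => d _.
by rewrite (homog_scale _ _ (pihomogP _ _ _)) mulrC.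
Qed.

Lemma line_pihomog p a d : (line (fun=> 0) a p)`_d = (pihomog mdeg d p).@[a].
Proof.
pose k := maxn (msize p) d.+1.
have -> : line (fun=> 0) a p = \poly_(d < k) (pihomog mdeg d p).@[a].
  apply: (poly_fun_inj K0) => t _; rewrite line_horner.
  rewrite (meval_eq (v2 := fun i => t * a i)); last by move=> i; rewrite add0r.
  by rewrite (@meval_pihomog p k) ?leq_maxl // horner_poly.
by rewrite coef_poly leq_max ltnS leqnn orbT.
Qed.

Lemma homog_of_scale d p : (forall t a, p.@[fun i => t * a i] = t ^+ d * p.@[a]) ->
  p \is d.-homog.
Proof.
move=> h; rewrite homog_piE; apply/eqP/meval_inj => a.
rewrite -line_pihomog.
suff -> : line (fun=> 0) a p = (p.@[a]) *: 'X^d by rewrite coefZ coefXn eqxx mulr1.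
apply: (poly_fun_inj K0) => t _; rewrite line_horner.
rewrite (meval_eq (v2 := fun i => t * a i)); last by move=> i; rewrite add0r.
by rewrite h !hornerE mulrC.
Qed.

Lemma euler d p : p \is d.-homog -> \sum_(i < m) mderiv i p * 'X_i = d%:R *: p.
Proof.
move=> hp; apply: meval_inj => a; rewrite mevalZ raddf_sum /=.
transitivity (der p a a).
  by apply: eq_bigr => i _; rewrite mevalM mevalXU.
(* The line through [a] in direction [a] consists of the multiples [(t + 1) * a], so homogeneity
   gives [p] on it explicitly. *)
have e : line a a p = (p.@[a]) *: ('X + 1) ^+ d.
  apply: (poly_fun_inj K0) => t _; rewrite line_horner.
  rewrite (meval_eq (v2 := fun i => (t + 1) * a i)); last first.
    by move=> i; rewrite mulrDl mul1r addrC.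
  by rewrite (homog_scale _ _ hp) !hornerE mulrC.
rewrite -line1 e coefZ mulrC; congr (_ * _).
have -> : (('X + 1 : {poly K}) ^+ d)`_1 = (('X + 1 : {poly K}) ^+ d)^`()`_0.
  by rewrite coef_deriv mulr1n.
rewrite deriv_exp derivD derivX derivC addr0 mul1r -horner_coef0.
by rewrite hornerMn !hornerE expr1n.
Qed.

End Line.

Lemma coefM_top (R : nzRingType) (p q : {poly R}) a b :
  (size p <= a.+1)%N -> (size q <= b.+1)%N ->
  (size (p * q)%R <= (a + b).+1)%N /\ (p * q)`_(a + b) = p`_a * q`_b.
Proof.
move=> sp sq; split.
  by apply: (leq_trans (size_polyMleq p q)); lia.
rewrite coefM (bigD1 (inord a)) //= inordK; last by rewrite ltnS leq_addr.
rewrite addKn big1 ?addr0 // => i /eqP ia.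
case: (ltngtP i a) => h.
- by rewrite [q`_ _]nth_default ?mulr0 // (leq_trans sq) //; lia.
- by rewrite [p`_ _]nth_default ?mul0r // (leq_trans sp).
- by case: ia; apply: val_inj; rewrite /= inordK // ltnS leq_addr.
Qed.

(** * Coprime Jacobian minors *)

Section MonicCoprime.
Variables (R : idomainType) (K : fieldType) (phi : {rmorphism R -> K}).

Import Pdiv.RingMonic Pdiv.Ring.

(** Multiplication by [N] on [R[X]/P] has a nonzero determinant: [phi] turns [P] into ['X^a], hence
    the matrix into a triangular one whose diagonal is the image of the constant term of [N]. So [N]
    is a nonzerodivisor modulo [P]. *)
Lemma monic_coprime (P N : {poly R}) (a : nat) :
  P \is monic -> size P = a.+1 -> map_poly phi P = 'X^a -> phi N`_0 != 0 ->
  forall q1 q2, N * q1 = P * q2 -> exists w, q1 = P * w.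
Proof.
move=> mP sP hP hN q1 q2 e.
have P0 : P != 0 by rewrite monic_neq0.
pose M := \matrix_(i < a, j < a) (rmodp (N * 'X^i) P)`_j.
have detM : \det M != 0.
  have: phi (\det M) != 0; last by apply: contraNneq => ->; rewrite rmorph0.
  rewrite -det_map_mx -det_tr det_trig; last first.
    apply/is_trig_mxP => i j ij; rewrite !mxE.
    have := rdivp_eq mP (N * 'X^j) => /(congr1 (fun p => (map_poly phi p)`_i)).
    rewrite rmorphD !rmorphM /= hP map_polyXn coefD !coefMXn ij ltn_ord add0r.
    by rewrite coef_map.
  apply/prodf_neq0 => i _; rewrite !mxE.
  have := rdivp_eq mP (N * 'X^i) => /(congr1 (fun p => (map_poly phi p)`_i)).
  rewrite rmorphD !rmorphM /= hP map_polyXn coefD !coefMXn ltnn subnn ltn_ord add0r.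
  by rewrite !coef_map => <-.
exists (rdivp q1 P).
pose rho := rmodp q1 P.
have sr : (size rho <= a)%N by rewrite -ltnS -sP ltn_rmodpN0.
have eN : N * rho = P * (q2 - N * rdivp q1 P).
  rewrite mulrBr -e [in N * q1](rdivp_eq mP q1) mulrDr.
  by rewrite [P * (N * _)]mulrCA [P * rdivp _ _]mulrC addrAC subrr add0r.
have vM : (\row_(i < a) rho`_i) *m M = 0.
  apply/rowP => j; rewrite !mxE.
  transitivity (rmodp (N * rho) P)`_j; last first.
    by rewrite eN mulrC rmodp_mull // coef0.
  have -> : N * rho = \sum_(i < a) rho`_i *: (N * 'X^i).
    rewrite -(coefK rho) poly_def.
    have -> : \sum_(i < size rho) rho`_i *: 'X^i = \sum_(i < a) rho`_i *: 'X^i :> {poly R}.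
      by rewrite -!poly_def; apply/polyP => k; rewrite !coef_poly; case: ltnP => h;
         [rewrite (leq_trans h sr)|rewrite nth_default ?if_same].
    rewrite mulr_sumr; apply: eq_bigr => i _.
    by rewrite -poly_def coef_poly ltn_ord -scalerAr.
  elim/big_ind2: _ => [|x u y v -> ->|i _].
  - by rewrite rmod0p coef0.
  - by rewrite rmodpD // coefD.
  - by rewrite !mxE rmodpZ // coefZ.
have v0 : \row_(i < a) rho`_i = 0.
  move: vM => /(congr1 (fun v => v *m \adj M)); rewrite -mulmxA mul_mx_adj mul0mx mul_mx_scalar.
  move/rowP => h; apply/rowP => i; move: (h i); rewrite !mxE => /eqP.
  by rewrite mulf_eq0 (negbTE detM) => /eqP.
have r0 : rho = 0.
  apply/polyP => k; rewrite coef0; case: (ltnP k a) => ka.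
    by move/rowP: v0 => /(_ (Ordinal ka)); rewrite !mxE.
  by rewrite nth_default // (leq_trans sr).
by rewrite {1}(rdivp_eq mP q1) -/rho r0 addr0 mulrC.
Qed.

End MonicCoprime.

Section Shift.
Variables (K : fieldType) (m : nat).
Hypothesis K0 : [pchar K] =i pred0.
Local Notation R := {mpoly K[m]}.
Implicit Types (a b : 'I_m -> K) (p : R).

(** Taylor expansion of [p] at the generic point in direction [b]. A form that is nonzero at [b]
    acquires a constant leading coefficient, which is the shape required by [monic_coprime]. *)
Definition shift b p : {poly R} :=
  mmap (polyC \o @mpolyC m K) (fun i => ('X_i)%:P + (b i)%:MP *: 'X) p.

HB.instance Definition _ b := GRing.RMorphism.copy (shift b)
  (mmap (polyC \o @mpolyC m K) (fun i => ('X_i)%:P + (b i)%:MP *: 'X)).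

Lemma shift_meval a b p : map_poly (meval a) (shift b p) = line a b p.
Proof.
rewrite /shift /line /curve /mmap rmorph_sum; apply: eq_bigr => mu _.
rewrite rmorphM /= map_polyC /= mevalC; congr (_ * _).
rewrite /mmap1 rmorph_prod; apply: eq_bigr => i _.
rewrite rmorphXn rmorphD /= map_polyC /= mevalXU; congr ((_ + _) ^+ _).
by rewrite -!mul_polyC rmorphM /= map_polyC /= mevalC map_polyX.
Qed.

Lemma shift0 b p : (shift b p)`_0 = p.
Proof.
apply: (meval_inj K0) => a.
by rewrite -[RHS](line0 a b) -shift_meval coef_map.
Qed.

Lemma shift_top b d p : p \is d.-homog ->
  (size (shift b p) <= d.+1)%N /\ (shift b p)`_d = (p.@[b])%:MP.
Proof.
move=> hp; rewrite mevalE /shift /mmap rmorph_sum /=.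
rewrite big_seq [X in _ /\ _ = X]big_seq.
elim/big_ind2: _ => [|x u y v [hx ex] [hy ey]|mu hmu].
- by rewrite size_poly0 coef0.
- rewrite coefD ex ey; split=> //.
  by rewrite (leq_trans (size_polyD _ _)) // geq_max hx.
have e : d = (\sum_i mu i)%N by rewrite -mdegE (dhomogP _ _ _ hp).
rewrite rmorphM /= rmorph_prod /=.
pose F (i : 'I_m) : {poly R} := ('X_i)%:P + (b i)%:MP *: 'X.
have h : (size (mmap1 F mu) <= d.+1)%N /\ (mmap1 F mu)`_d = \prod_(i < m) (b i ^+ mu i)%:MP.
  rewrite e /mmap1; elim/big_ind3: _ => [|s1 x u s2 y v [hx ex] [hy ey]|i _].
  - by rewrite size_poly1 coef1.
  - by rewrite -ex -ey; apply: coefM_top.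
  elim: (mu i) => [|k [IH1 IH2]]; first by rewrite !expr0 size_poly1 coef1.
  rewrite !exprS -(add1n k) rmorphM /= -IH2.
  have -> : (b i)%:MP = (F i)`_1.
    by rewrite coefD coefC coefZ coefX add0r mulr1.
  apply: coefM_top => //.
  rewrite (leq_trans (size_polyD _ _)) // geq_max (leq_trans (size_polyC_leq1 _)) //.
  by rewrite (leq_trans (size_scale_leq _ _)) // size_polyX.
case: h => h1 h2; split.
  by rewrite mul_polyC (leq_trans (size_scale_leq _ _)).
by rewrite mul_polyC coefZ h2.
Qed.

(** In direction [be] the shift of [D1] is [c] times a monic polynomial. Evaluation at [al] turns it
    into [c *: 'X^d], by the hypothesis on the plane, and the constant term of the shift of [D2]
    into [D2.@[al]], so [monic_coprime] applies. *)
Lemma mpoly_coprime (D1 D2 : R) (d : nat) (al be : 'I_m -> K) (c : K) :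
  D1 \is d.-homog -> c != 0 ->
  (forall s t, D1.@[fun i => s * al i + t * be i] = c * t ^+ d) -> D2.@[al] != 0 ->
  forall q1 q2, D2 * q1 = D1 * q2 -> exists w, q1 = D1 * w.
Proof.
move=> hD c0 h1 h2 q1 q2 e.
have [sD tD] := shift_top be hD.
have eb : D1.@[be] = c.
  have := h1 0 1; rewrite expr1n mulr1 => <-; apply: meval_eq => i.
  by rewrite mul0r add0r mul1r.
pose P : {poly R} := (c^-1)%:MP *: shift be D1.
have Pd : P`_d = 1 by rewrite coefZ tD eb -mpolyCM mulVf.
have sP : size P = d.+1.
  apply/eqP; rewrite eqn_leq (leq_trans (size_scale_leq _ _)) //=.
  by rewrite ltnNge; apply/negP => /leq_sizeP/(_ d (leqnn _))/eqP; rewrite Pd oner_eq0.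
have mP : P \is monic by rewrite monicE lead_coefE sP Pd.
have hl : line al be D1 = c *: 'X^d.
  apply: (poly_fun_inj K0) => t _; rewrite line_horner !hornerE.
  by rewrite -(h1 1 t); apply: meval_eq => i; rewrite mul1r.
have phiP : map_poly (meval al) P = 'X^d.
  by rewrite /P -[_ *: _]mul_polyC rmorphM /= shift_meval hl map_polyC /= mevalC mul_polyC scalerA mulVf ?scale1r.
have phiN : meval al (shift be D2)`_0 != 0 by rewrite shift0.
have eP : shift be D1 = c%:MP *: P.
  by rewrite scalerA -mpolyCM mulfV // scale1r.
have := monic_coprime mP sP phiP phiN (q1 := shift be q1) (q2 := c%:MP *: shift be q2).
case=> [|w hw].
  by rewrite -rmorphM e rmorphM /= eP -scalerAl -scalerAr.
(* Setting the shift parameter to 0 turns the factorisation of [shift be q1] into one of [q1]. *)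
exists ((c^-1)%:MP * w`_0).
rewrite -(shift0 be q1) hw -[RHS]mulrCA -!horner_coef0 hornerM hornerZ !horner_coef0 shift0.
by rewrite mulrA.
Qed.

End Shift.

(** * Algebraic independence modulo an ideal, and chains of closed sets *)

Section Indep.
Variables (K : fieldType) (m : nat).
Local Notation R := {mpoly K[m]}.

Lemma msizeM_leq (p q : R) : (msize (p * q) <= (msize p + msize q).-1)%N.
Proof.
case: (eqVneq p 0) => [->|p0]; first by rewrite mul0r msize0.
case: (eqVneq q 0) => [->|q0]; first by rewrite mulr0 msize0.
by rewrite msizeM.
Qed.

(** A polynomial in [f 0, .., f (k - 1)] with exponents at most [D]; the head of the list is the
    exponent of the last variable. The box of exponents makes the elimination of one variable
    recursive and the number of coefficients explicit. *)
Fixpoint boxev (k D : nat) (f : nat -> R) (c : seq nat -> K) : R :=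
  if k is k'.+1 then \sum_(i < D.+1) f k' ^+ i * boxev k' D f (fun s => c (val i :: s))
  else (c [::])%:MP.

(** Algebraic independence modulo [I]; for [k = 0] it says that [I] contains no nonzero constant. *)
Definition indep (I : R -> Prop) (f : nat -> R) (k : nat) : Prop :=
  forall D c, I (boxev k D f c) ->
    forall s, size s = k -> all (fun e => e <= D)%N s -> c s = 0.

Lemma boxev_ext k D f g c c' : (forall i, (i < k)%N -> f i = g i) -> c =1 c' ->
  boxev k D f c = boxev k D g c'.
Proof.
elim: k c c' => [|k IH] c c' hf hc /=; first by rewrite hc.
apply: eq_bigr => i _; rewrite hf // (IH _ (fun s => c' (val i :: s))) // => j jk.
by apply: hf; rewrite ltnS ltnW.
Qed.

Lemma boxev_lin k D f a c c' :
  boxev k D f (fun s => a * c s + c' s) = a *: boxev k D f c + boxev k D f c'.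
Proof.
elim: k c c' => [|k IH] c c' /=; first by rewrite mpolyCD mpolyCM mul_mpolyC.
rewrite scaler_sumr -big_split; apply: eq_bigr => i _ /=.
by rewrite IH mulrDr -scalerAr.
Qed.

Definition ideal_like (I : R -> Prop) :=
  (forall p q, I p -> I q -> I (p + q)) /\ (forall p q, I p -> I (p * q)).

Lemma ideal_sum (T : Type) (r : seq T) (P : pred T) I (F : T -> R) :
  ideal_like I -> I 0 -> (forall i, P i -> I (F i)) -> I (\sum_(i <- r | P i) F i).
Proof.
case=> hD _ h0 hF; elim/big_rec: _ => // i x Pi hx.
by apply: hD => //; apply: hF.
Qed.

(* Adjoining to an independent family modulo [I'] an element of [I'] that is a
   nonzerodivisor modulo the smaller ideal [I]. *)
Lemma indep_step (I I' : R -> Prop) f k :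
  ideal_like I -> ideal_like I' -> I' 0 -> (forall p, I p -> I' p) -> I' (f k) ->
  (forall h, I (f k * h) -> I h) -> indep I' f k -> indep I f k.+1.
Proof.
move=> [ID IM] idI' I0 II' Ifk nz hi D c hc; have [ID' IM'] := idI'.
suff main j : (j <= D.+1)%N -> forall e s, (e < j)%N -> size s = k ->
    all (fun e => e <= D)%N s -> c (e :: s) = 0.
  by case=> // e s /= [sk] /andP[eD sD]; apply: (main D.+1).
(* Induction on the exponent of [f k]: once the coefficients with smaller exponent vanish,
   [f k ^+ j] divides the relation and is cancelled modulo [I]; modulo [I'] only the term without
   [f k] then survives. *)
elim: j => // j IH jD e s; rewrite ltnS leq_eqVlt => /orP[/eqP ->|]; last first.
  by apply: IH; apply: ltnW.
have cz i (t : seq nat) : (i < j)%N -> size t = k -> all (fun e => e <= D)%N t -> c (i :: t) = 0.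
  by apply: IH; apply: ltnW.
have bz i : (i < j)%N -> boxev k D f (fun s => c (i :: s)) = 0.
  suff gen k' c' : (forall s, size s = k' -> all (fun e => e <= D)%N s -> c' s = 0) ->
      boxev k' D f c' = 0.
    by move=> ij; apply: gen => t; apply: cz.
  elim: k' c' => [|k' IHk] c' h /=; first by rewrite h.
  rewrite big1 // => l _; rewrite IHk ?mulr0 // => t st at'; apply: h => /=; rewrite ?st //.
  by rewrite at' -ltnS ltn_ord.
have: I (\sum_(i < D.+1 | (j <= i)%N) f k ^+ (i - j) * boxev k D f (fun s => c (val i :: s))).
  move: hc => /=.
  rewrite (bigID (fun i : 'I_D.+1 => (j <= i)%N)) /= addrC big1 ?add0r; last first.
    by move=> i; rewrite -ltnNge => ij; rewrite bz ?mulr0.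
  rewrite (eq_bigr (fun i : 'I_D.+1 => f k ^+ j *
      (f k ^+ (i - j) * boxev k D f (fun s => c (val i :: s))))); last first.
    by move=> i ji; rewrite mulrA -exprD subnKC.
  rewrite -mulr_sumr; elim: (j) (\sum_(i < _ | _) _) => [|l IHl] h; first by rewrite mul1r.
  by rewrite exprS -mulrA => /nz /IHl.
move/II'; rewrite (bigD1 (Ordinal jD)) //= subnn mul1r => hI.
have: I' (boxev k D f (fun s => c (j :: s))).
  rewrite -[boxev _ _ _ _](addrK (\sum_(i < D.+1 | (j <= i)%N && (i != Ordinal jD))
     f k ^+ (i - j) * boxev k D f (fun s => c (val i :: s)))).
  apply: (ID') => //; rewrite -mulN1r mulrC; apply: (IM'); apply: (@ideal_sum _ _ _ I' _ idI') => // i /andP[ji ij].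
  have -> : (i - j)%N = (i - j).-1.+1.
    rewrite prednK // subn_gt0 ltn_neqAle ji andbT; apply: contra ij => /eqP h.
    by apply/eqP/val_inj.
  by rewrite exprS -mulrA; apply: IM'.
by move/hi => h; apply: h.
Qed.

Lemma indep_ext I f g k : (forall i, (i < k)%N -> f i = g i) -> indep I f k -> indep I g k.
Proof.
by move=> e h D c; rewrite -(boxev_ext _ e (frefl c)); apply: h.
Qed.

Lemma msize_boxev k D E f c : (forall i, (i < k)%N -> (msize (f i) <= E.+1)%N) ->
  (msize (boxev k D f c) <= (k * (D * E)).+1)%N.
Proof.
elim: k c => [|k IH] c hf /=.
  by rewrite mul0n; have := msizeC m (c [::]) => /= ->; case: (_ != _).
apply: (leq_trans (msize_sum _ _ _)); apply/bigmax_leqP => i _.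
apply: (leq_trans (msizeM_leq _ _)).
have h1 : (msize (f k ^+ i) <= (D * E).+1)%N.
  have iD : (i <= D)%N by rewrite -ltnS.
  suff: (msize (f k ^+ i) <= (i * E).+1)%N.
    by move=> h; apply: leq_trans h _; rewrite ltnS leq_mul2r iD orbT.
  elim: (val i) => [|l IHl]; first by rewrite expr0 msize1.
  rewrite exprS; apply: (leq_trans (msizeM_leq _ _)).
  by have := hf k (ltnSn k); lia.
have h2 : (msize (boxev k D f (fun s => c (val i :: s))) <= (k * (D * E)).+1)%N.
  by apply: IH => j jk; apply: hf; rewrite ltnS ltnW.
have := leq_add h1 h2; rewrite addSn addnS mulSn.
by case: (mmeasure _ _ + _)%N => // e; rewrite !ltnS => /leqW.
Qed.

Lemma kernel_exists p q (M : 'M[K]_(p, q)) : (q < p)%N -> exists2 v : 'rV_p, v != 0 & v *m M = 0.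
Proof.
move=> qp; have: kermx M != 0.
  by rewrite kermx_eq0 /row_free neq_ltn (leq_ltn_trans (rank_leq_col M)).
case/rowV0Pn => v /sub_kermxP h v0; by exists v.
Qed.

(** There are [D.+1 ^ k] coefficients, while the values involve at most [B ^ m] monomials, with [B]
    linear in [D]. For [k > m] and large [D] the coefficients outnumber the monomials, and linear
    algebra yields a relation. *)
Lemma indep_bound f k : indep (fun p => p = 0) f k -> (k <= m)%N.
Proof.
move=> hi; rewrite leqNgt; apply/negP => mk.
pose E := (\max_(i < k) msize (f i))%N.
(* Large enough for [((k * E).+1 * D.+1) ^ m < D.+1 ^ m.+1], where [B <= (k * E).+1 * D.+1]. *)
pose D := ((k * E).+1 ^ m)%N.
pose B := (k * (D * E)).+1.
have hE i : (i < k)%N -> (msize (f i) <= E.+1)%N.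
  move=> ik; apply: leqW.
  exact: (@leq_bigmax _ (fun i : 'I_k => msize (f i)) (Ordinal ik)).
pose T := {ffun 'I_k -> 'I_D.+1}; pose U := {ffun 'I_m -> 'I_B}.
pose enc (s : seq nat) : T := [ffun i : 'I_k => inord (nth 0%N s i)].
pose cc (v : 'rV[K]_#|{: T}|) (s : seq nat) := v 0 (enum_rank (enc s)).
pose mon (u : U) : 'X_{1..m} := [multinom (val (u i)) | i < m].
pose g (v : 'rV[K]_#|{: T}|) : 'rV[K]_#|{: U}| :=
  \row_j (boxev k D f (cc v))@_(mon (enum_val j)).
have lg : linear g.
  move=> a u v; apply/rowP => j; rewrite !mxE -mcoeffZ -mcoeffD -boxev_lin.
  by congr (_@__); apply: boxev_ext => // s; rewrite /cc !mxE.
pose gL : {linear 'rV[K]_#|{: T}| -> 'rV[K]_#|{: U}|} :=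
  HB.pack g (GRing.isLinear.Build _ _ _ _ g lg).
have card : (#|{: U}| < #|{: T}|)%N.
  rewrite !card_ffun !card_ord.
  apply: (@leq_ltn_trans (((k * E).+1 * D.+1) ^ m)%N).
    by rewrite leq_exp2r_wpos || (case: (m) => // m'; rewrite leq_exp2r //); rewrite /B; nia.
  rewrite expnMn; apply: (@leq_trans (D.+1 * D.+1 ^ m)%N).
    by rewrite ltn_pmul2r ?expn_gt0 // /D ltnS.
  by rewrite -expnS leq_pexp2l.
have [v v0 hv] := kernel_exists (lin1_mx gL) card.
rewrite mul_rV_lin1 /= in hv.
have z : boxev k D f (cc v) = 0.
  apply/mpolyP => mu; rewrite mcoeff0.
  case: (ltnP (mdeg mu) B) => hmu.
    have mon_mu : mon [ffun i : 'I_m => inord (mu i)] = mu.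
      apply/mnmP => i; rewrite mnmE ffunE /= inordK //.
      by apply: leq_ltn_trans hmu; rewrite mdegE (bigD1 i) //= leq_addr.
    move/rowP: hv => /(_ (enum_rank ([ffun i : 'I_m => inord (mu i)] : U))).
    by rewrite !mxE enum_rankK mon_mu.
  apply: memN_msupp_eq0; apply: msize_mdeg_ge; apply: leq_trans hmu.
  exact: msize_boxev.
case/eqP: v0; apply/rowP => j; rewrite mxE.
pose s := [seq val (enum_val j i) | i <- enum 'I_k].
have ss : size s = k by rewrite size_map size_enum_ord.
have := hi D (cc v) z s ss.
have -> : cc v s = v 0 j.
  rewrite /cc; congr (v 0 _).
  have -> : enc s = enum_val j; last by rewrite enum_valK.
  apply/ffunP => i; rewrite ffunE (nth_map i) ?size_enum_ord // nth_ord_enum.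
  by apply: val_inj; rewrite /= inordK.
apply; apply/allP => _ /mapP[i _ ->].
exact: (ltn_ord (enum_val j i)).
Qed.

End Indep.

Section Chain.
Variables (K : fieldType) (m : nat).
Local Notation R := {mpoly K[m]}.

Definition vanish (C : ('I_m -> K) -> Prop) (p : R) := forall t, C t -> p.@[t] = 0.

Lemma vanish_ideal C : ideal_like (vanish C).
Proof.
split=> p q hp; first by move=> hq t Ct; rewrite mevalD hp // hq // addr0.
by move=> t Ct; rewrite mevalM hp // mul0r.
Qed.

Lemma zclosed_cut C (g : R) : zclosed C -> zclosed (fun t => C t /\ g.@[t] = 0).
Proof.
case=> S hS; exists (fun p => S p \/ p = g) => t; split.
  by case=> /hS h hg p [/h //|->].
move=> h; split; last by apply: h; right.
by apply/hS => p Sp; apply: h; left.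
Qed.

Lemma vanish_prime C (g h : R) : irred_closed C -> vanish C (g * h) -> ~ vanish C g -> vanish C h.
Proof.
case=> cC _ irr hgh ng.
case: (irr _ _ (zclosed_cut g cC) (zclosed_cut h cC)) => [t|hg|hh].
- split=> [Ct|[[]|[]] //]; have := hgh t Ct; rewrite mevalM => /eqP.
  by rewrite mulf_eq0 => /orP[/eqP e|/eqP e]; [left|right].
- by case: ng => t /hg[].
- by move=> t /hh[].
Qed.

(** Each strict inclusion of the chain supplies a polynomial that vanishes on the smaller set but
    not on the larger, whose ideal is prime; [indep_step] turns it into one more independent
    element. At the top [D2] is added modulo the multiples of [D1], where coprimality makes it a
    nonzerodivisor, and finally [D1] modulo 0. *)
Lemma chain_bound (Z : ('I_m -> K) -> Prop) (D1 D2 : R) :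
  D1 != 0 -> (forall t, Z t -> D1.@[t] = 0 /\ D2.@[t] = 0) ->
  (forall q1 q2, D2 * q1 = D1 * q2 -> exists w, q1 = D1 * w) ->
  codim_ge2 Z.
Proof.
move=> D10 hZ cop l C hC hlt.
have step j : (j <= l)%N -> exists f, indep (vanish (C j)) f j.
  elim: j => [|j IH] jl.
    exists (fun=> 0) => D c /= h s /size0nil -> _.
    by case: (hC 0%N jl) => -[_ [t Ct] _] _; have := h t Ct; rewrite mevalC.
  have [f hf] := IH (ltnW jl).
  have [sub [t [Ct nCt]]] := hlt j jl.
  have [ic sZ] := hC j (ltnW jl); have [ic' sZ'] := hC j.+1 jl.
  case: (ic) => -[S hS] ne _.
  have [g [Sg ng]] : exists g, S g /\ g.@[t] <> 0.
    apply: NNPP => h; apply: nCt; apply/hS => p Sp; apply: NNPP => pt.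
    by apply: h; exists p.
  exists (fun i => if i == j then g else f i).
  apply: (indep_step (vanish_ideal _) (vanish_ideal (C j))).
  - by move=> t' _; rewrite meval0.
  - by move=> p hp t' /sub; apply: hp.
  - by rewrite eqxx => t' /hS; apply.
  - rewrite eqxx => h hgh; apply: (vanish_prime ic' hgh) => hg.
    by apply: ng; apply: hg.
  by apply: indep_ext hf => i ij; rewrite ltn_eqF.
have [f hf] := step l (leqnn l).
have [ic sZ] := hC l (leqnn l).
pose f1 i := if i == l then D2 else f i.
pose f2 i := if i == l.+1 then D1 else f1 i.
have idD : ideal_like (fun p => exists w, p = D1 * w).
  by split=> p q [w ->]; [case=> w' ->; exists (w + w'); rewrite mulrDr|exists (w * q); rewrite mulrA].
have h1 : indep (fun p => exists w, p = D1 * w) f1 l.+1.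
  apply: (indep_step idD (vanish_ideal (C l))).
  - by move=> t _; rewrite meval0.
  - by move=> p [w ->] t /sZ/hZ[h _]; rewrite mevalM h mul0r.
  - by rewrite /f1 eqxx => t /sZ/hZ[].
  - by rewrite /f1 eqxx => h [w] /cop.
  by apply: indep_ext hf => i il; rewrite /f1 ltn_eqF.
rewrite addn2; apply: (@indep_bound _ _ f2 l.+2).
apply: (@indep_step _ _ _ (fun p => exists w, p = D1 * w)) => //.
- by split=> p q -> // ; rewrite ?mul0r // => ->; rewrite addr0.
- by exists 0; rewrite mulr0.
- by move=> p ->; exists 0; rewrite mulr0.
- by rewrite /f2 eqxx; exists 1; rewrite mulr1.
- by rewrite /f2 eqxx => h /eqP; rewrite mulf_eq0 (negbTE D10) => /eqP.
by apply: indep_ext h1 => i il; rewrite /f2 ltn_eqF.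
Qed.

End Chain.

(** * A Jacobian criterion for generators of an algebra of invariants *)

Section Subalg.
Variables (K : fieldType) (m k : nat) (H : 'I_k -> {mpoly K[m]}).

Lemma in_subalgD p q : in_subalg H p -> in_subalg H q -> in_subalg H (p + q).
Proof. by move=> [r ->] [s ->]; exists (r + s); rewrite rmorphD. Qed.

Lemma in_subalgM p q : in_subalg H p -> in_subalg H q -> in_subalg H (p * q).
Proof. by move=> [r ->] [s ->]; exists (r * s); rewrite rmorphM. Qed.

Lemma in_subalgC c : in_subalg H c%:MP.
Proof. by exists c%:MP; rewrite comp_mpolyC. Qed.

Lemma in_subalgZ c p : in_subalg H p -> in_subalg H (c *: p).
Proof. by move=> [r ->]; exists (c *: r); rewrite comp_mpolyZ. Qed.

Lemma in_subalg_gen i : in_subalg H (H i).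
Proof. by exists 'X_i; rewrite comp_mpolyXU -tnth_nth tnth_mktuple. Qed.

Lemma in_subalg_sum (I : Type) (r : seq I) (P : pred I) F :
  (forall i, P i -> in_subalg H (F i)) -> in_subalg H (\sum_(i <- r | P i) F i).
Proof.
move=> h; elim/big_rec: _ => [|i x Pi hx]; first by rewrite -mpolyC0; apply: in_subalgC.
by apply: in_subalgD => //; apply: h.
Qed.

End Subalg.

Section Invariants.
Variables (K : fieldType) (m n : nat) (H : 'I_n -> {mpoly K[m]}) (d : 'I_n -> nat).
Hypothesis K0 : [pchar K] =i pred0.
Hypothesis hH : forall i, H i \is (d i).-homog.
Hypothesis d0 : forall i, (0 < d i)%N.

Local Notation R := {mpoly K[m]}.
Local Notation MC := (map_mx (@mpolyC m K)).

Definition grad (p : R) : 'rV[R]_m := \row_j mderiv j p.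
Definition jac : 'M[R]_(n, m) := \matrix_(i, j) mderiv j (H i).
(** By Cauchy-Binet a constant combination of the maximal minors of the Jacobian matrix, taken along
    the columns of [V]; no choice of coordinates is involved. *)
Definition jdet (V : 'M[K]_(m, n)) : R := \det (jac *m MC V).

Lemma meval_deriv_homog e (p : R) t a j : p \is e.-homog ->
  (mderiv j p).@[fun i => t * a i] = t ^+ e.-1 * (mderiv j p).@[a].
Proof. 
move=> hp; apply: (homog_scale); apply/dhomogP => mu.
rewrite mcoeff_msupp mcoeff_deriv => h.
have : (mu + U_(j))%MM \in msupp p.
  by rewrite mcoeff_msupp; apply: contraNneq h => ->; rewrite mul0rn.
by move/(dhomogP _ _ _ hp) => /= <-; rewrite mdegD mdeg1 addn1.
Qed.

Lemma mderiv_homog e (p : R) j : p \is e.-homog -> mderiv j p \is (e.-1).-homog.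
Proof. by move=> hp; apply: (homog_of_scale K0) => t a; rewrite (meval_deriv_homog _ _ _ hp). Qed.

Lemma homog0_const (p : R) : p \is 0.-homog -> p = (p@_0)%:MP.
Proof.
move=> hp; apply: msize1_polyC.
case: (eqVneq p 0) => [->|p0]; first by rewrite msize0.
by rewrite -(mlead_deg p0) (dhomogP _ _ _ hp _ (mlead_supp p0)).
Qed.

Definition wt : nat := \sum_i (d i).-1.

Lemma jdet_homog V : jdet V \is wt.-homog.
Proof.
apply: (homog_of_scale K0) => t a; rewrite /jdet -!det_map_mx.
rewrite (_ : map_mx _ _ = diag_mx (\row_i t ^+ (d i).-1) *m map_mx (meval a) (jac *m MC V)).
  by rewrite det_mulmx det_diag; congr (_ * _); under eq_bigr do rewrite mxE;
     rewrite prodrXr.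
apply/matrixP => i j; rewrite mul_diag_mx !mxE !raddf_sum mulr_sumr; apply: eq_bigr => l _.
rewrite !mxE /= !mevalM !mevalC.
by rewrite (meval_deriv_homog _ _ _ (hH i)) mulrA.
Qed.

Lemma jdet_dep V t : dep_locus H t -> (jdet V).@[t] = 0.
Proof.
move=> hd; apply/eqP/negPn/negP => h.
move: hd; rewrite /dep_locus; suff -> : (\rank (\matrix_(i < n, j < m) (mderiv j (H i)).@[t]) = n)%N.
  by rewrite ltnn.
move: h; rewrite /jdet -det_map_mx => h; apply/eqP; rewrite eqn_leq rank_leq_row /=.
have: map_mx (meval t) (jac *m MC V) \in unitmx by rewrite unitmxE unitfE.
rewrite -row_free_unit /row_free => /eqP {1}<-; rewrite map_mxM.
apply: leq_trans (mxrankM_maxl _ _) _; rewrite (_ : map_mx _ _ = \matrix_(i, j) (mderiv j (H i)).@[t]) //.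
by apply/matrixP => i j; rewrite !mxE.
Qed.

Variables (V1 V2 : 'M[K]_(m, n)) (al be : 'I_m -> K) (c : K).
Hypothesis c0 : c != 0.
Hypothesis hD1 : forall s t, (jdet V1).@[fun i => s * al i + t * be i] = c * t ^+ wt.
Hypothesis hD2 : (jdet V2).@[al] != 0.

Lemma jdet1_neq0 : jdet V1 != 0.
Proof.
apply: contraNneq c0 => e; have := hD1 0 1; rewrite e meval0 expr1n mulr1.
by move=> ->.
Qed.

Lemma jdet2_neq0 : jdet V2 != 0.
Proof. by apply: contraNneq hD2 => ->; rewrite meval0. Qed.

Lemma jdet_coprime q1 q2 : jdet V2 * q1 = jdet V1 * q2 -> exists w, q1 = jdet V1 * w.
Proof. exact: (mpoly_coprime K0 (jdet_homog V1) c0 hD1 hD2). Qed.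

Lemma dep_locus_codim2 : codim_ge2 (dep_locus H).
Proof.
apply: (@chain_bound _ _ _ (jdet V1) (jdet V2)); first exact: jdet1_neq0.
  by move=> t h; split; apply: jdet_dep.
exact: jdet_coprime.
Qed.

Definition cob (V : 'M[K]_(m, n)) : 'M[R]_(m, n) := MC V *m \adj (jac *m MC V).

Lemma jac_cob V : jac *m cob V = (jdet V)%:M.
Proof. by rewrite /cob mulmxA mul_mx_adj. Qed.

(** Denominator-free form of the condition that [grad p] lies in the span of the gradients of the
    [H i] over the field of fractions. *)
Definition jclass (p : R) := exists D, D != 0 /\ exists q : 'rV_n, D *: grad p = q *m jac.

Lemma scalemxI (p q : nat) (D : R) (A B : 'M[R]_(p, q)) : D != 0 -> D *: A = D *: B -> A = B.
Proof.
move=> D0 /matrixP h; apply/matrixP => i j; move: (h i j); rewrite !mxE.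
exact: mulfI.
Qed.

Lemma cancel_jac (J : 'M[R]_(n, m)) (C : 'M[R]_(m, n)) (D D' : R) (q1 q2 : 'rV[R]_n) :
  D != 0 -> J *m C = D%:M -> D' *: (q1 *m J) = D *: (q2 *m J) -> D' *: q1 = D *: q2.
Proof.
move=> D0 hJ /(congr1 (fun x => x *m C)).
rewrite -!scalemxAl -!mulmxA hJ !mul_mx_scalar => h.
by apply: (scalemxI D0); rewrite scalerA mulrC -scalerA h.
Qed.

Lemma jclass_cramer p V : jclass p -> jdet V *: grad p = (grad p *m cob V) *m jac.
Proof.
case=> D [D0 [q e]]; apply: (scalemxI D0).
rewrite [RHS]scalemxAl [D *: (_ *m _)]scalemxAl e -(mulmxA q) jac_cob mul_mx_scalar.
by rewrite -scalemxAl -e scalerA mulrC -scalerA.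
Qed.

(** Two Cramer formulas express [D1 *: g] and [D2 *: g] through the rows of [J]. Independence of
    these rows gives [D2 *: q1 = D1 *: q2] for the coefficients, and coprimality lets [D1] be
    divided out of [q1]. *)
Lemma cramer_poly (J : 'M[R]_(n, m)) (C1 C2 : 'M[R]_(m, n)) (D1 D2 : R) (g : 'rV[R]_m) :
  D1 != 0 -> J *m C1 = D1%:M ->
  D1 *: g = g *m C1 *m J -> D2 *: g = g *m C2 *m J ->
  (forall q1 q2, D2 * q1 = D1 * q2 -> exists w, q1 = D1 * w) ->
  exists a : 'rV_n, g = a *m J.
Proof.
move=> D10 hJ; move: (g *m C1) (g *m C2) => q1 q2 e1 e2 cop.
have e : D2 *: q1 = D1 *: q2.
  by apply: (cancel_jac D10 hJ); rewrite -e1 -e2 !scalerA mulrC.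
have w i : exists w, q1 0 i = D1 * w.
  apply: (@cop _ (q2 0 i)).
  by have := congr1 (fun q : 'rV_n => q 0 i) e; rewrite [LHS]mxE [RHS]mxE.
have [f hf] := fin_all_exists w.
exists (\row_i f i); apply: (scalemxI D10); rewrite e1 scalemxAl; congr (_ *m _).
by apply/rowP => i; rewrite [RHS]mxE [X in _ * X]mxE hf.
Qed.

Lemma jclass_poly p : jclass p -> exists a : 'rV_n, grad p = a *m jac.
Proof.
move=> h; exact: (cramer_poly jdet1_neq0 (jac_cob V1) (jclass_cramer V1 h)
  (jclass_cramer V2 h) jdet_coprime).
Qed.

(** Equality of the mixed second derivatives of [p] makes the matrix
    [\sum_i mderiv j (a 0 i) * mderiv k (H i)] symmetric. Multiplication by [cob V1] then isolates
    the gradient of a single coefficient as a combination of the gradients of the [H i], which lets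
    the induction on the degree continue with the coefficients. *)
Lemma jclass_coef p (a : 'rV_n) : grad p = a *m jac -> forall l, jclass (a 0 l).
Proof.
move=> e l.
pose A := \matrix_(j < m, i < n) mderiv j (a 0 i).
have sym : (A *m jac)^T = A *m jac.
  have gp k : mderiv k p = \sum_i a 0 i * mderiv k (H i).
    move/rowP: e => /(_ k); rewrite !mxE => ->.
    by apply: eq_bigr => i _; rewrite mxE.
  apply/matrixP => k j; rewrite !mxE.
  pose S j k := \sum_i mderiv j (a 0 i) * mderiv k (H i).
  have hs j' k' : mderiv j' (mderiv k' p) = S j' k' + \sum_i a 0 i * mderiv j' (mderiv k' (H i)).
    by rewrite gp raddf_sum -big_split; apply: eq_bigr => i _; rewrite /= mderivM.
  have := mderiv_comm j k p; rewrite !hs.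
  rewrite [in RHS](eq_bigr (fun i => a 0 i * mderiv j (mderiv k (H i)))); last first.
    by move=> i _; rewrite mderiv_comm.
  rewrite [in LHS](eq_bigr (fun i => a 0 i * mderiv k (mderiv j (H i)))); last first.
    by move=> i _; rewrite mderiv_comm.
  rewrite [in RHS](eq_bigr (fun i => a 0 i * mderiv k (mderiv j (H i)))); last first.
    by move=> i _; rewrite mderiv_comm.
  move/addIr; rewrite /S => h.
  rewrite (eq_bigr (fun i => mderiv j (a 0 i) * mderiv k (H i))); last by move=> i _; rewrite !mxE.
  rewrite [RHS](eq_bigr (fun i => mderiv k (a 0 i) * mderiv j (H i))); last by move=> i _; rewrite !mxE.
  by rewrite h || rewrite -h.
exists (jdet V1); split; first exact: jdet1_neq0.
exists (row l ((cob V1)^T *m A)); rewrite -row_mul -mulmxA -{1}sym -trmx_mul -mulmxA jac_cob.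
by rewrite mul_mx_scalar; apply/rowP => j; rewrite !mxE.
Qed.

Lemma pihomogM_homog b e (p q : R) : q \is e.-homog ->
  pihomog mdeg b (p * q) = if (e <= b)%N then pihomog mdeg (b - e) p * q else 0.
Proof.
move=> hq; apply: (meval_inj K0) => t; rewrite -(line_pihomog K0) rmorphM /=.
have -> : line (fun=> 0) t q = q.@[t] *: 'X^e.
  apply: (poly_fun_inj K0) => s _; rewrite line_horner.
  rewrite (meval_eq (v2 := fun i => s * t i)); last by move=> i; rewrite add0r.
  by rewrite (homog_scale _ _ hq) !hornerE mulrC.
rewrite -scalerAr coefZ coefMXn ltnNge; case: leqP => _ /=; last by rewrite mulr0 meval0.
by rewrite mevalM (line_pihomog K0) mulrC.
Qed.

Lemma jclass_homog e p : p \is e.-homog -> jclass p -> in_subalg H p.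
Proof.
have [k] := ubnP e; elim: k e p => // k IH e p; rewrite ltnS => ek hp cp.
case: (posnP e) => [e0|e0].
  by rewrite e0 in hp; rewrite (homog0_const hp); apply: in_subalgC.
have [a ea] := jclass_poly cp.
(* Both sides have degree [e - 1] and the derivatives of [H i] have degree [d i - 1], so only the
   component of degree [e - d i] of the coefficient counts. *)
pose a' := \row_i (if (d i <= e)%N then pihomog mdeg (e - d i) (a 0 i) else 0).
have ea' : grad p = a' *m jac.
  apply/rowP => j; move/rowP: ea => /(_ j); rewrite !mxE => ej.
  rewrite -(pihomog_dE (mderiv_homog j hp)) ej raddf_sum; apply: eq_bigr => i _ /=.
  rewrite !mxE (pihomogM_homog _ _ (mderiv_homog j (hH i))).
  have := d0 i; case: (d i) => // di _ /=; case: (e) e0 => // e' _ /=.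
  by rewrite ltnS; case: leqP; rewrite ?mul0r ?subSS.
have ha i : in_subalg H (a' 0 i).
  rewrite mxE; case: leqP => die; last by rewrite -mpolyC0; apply: in_subalgC.
  apply: (IH (e - d i)%N); first by have := d0 i; lia.
    exact: pihomogP.
  by have := jclass_coef ea' i; rewrite mxE die.
have : e%:R *: p = \sum_i a' 0 i * ((d i)%:R *: H i).
  rewrite -(euler K0 hp).
  rewrite (eq_bigr (fun j => \sum_i a' 0 i * mderiv j (H i) * 'X_j)); last first.
    move=> j _; move/rowP: ea' => /(_ j); rewrite !mxE => ->; rewrite mulr_suml.
    by apply: eq_bigr => i _; rewrite !mxE.
  rewrite exchange_big; apply: eq_bigr => i _ /=.
  rewrite -(euler K0 (hH i)) mulr_sumr; apply: eq_bigr => j _.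
  by rewrite mulrA.
move/(congr1 (fun q => e%:R^-1 *: q)); rewrite scalerA mulVf ?scale1r; last first.
  by case: (e) e0 => // e' _; apply: natr_neq0.
move=> ->; apply: in_subalgZ; apply: in_subalg_sum => i _.
by apply: in_subalgM => //; apply: in_subalgZ; apply: in_subalg_gen.
Qed.

Variable M : 'M[R]_m.
Hypothesis hM : forall i j, M i j \is 1.-homog.
Hypothesis hMH : jac *m M = 0.
Hypothesis hidx : forall w : 'rV[K]_m,
  w *m map_mx (meval al) M = 0 -> w *m V2 = 0 -> w = 0.

(** At [al] the columns of [M] and [V2] together span the whole space, hence they do so generically.
    The difference [w] of [jdet V2 *: grad p] and its Cramer combination is annihilated by both [M]
    and [V2], so it is zero. *)
Lemma inv_jclass p : grad p *m M = 0 -> jclass p.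
Proof.
move=> hp; exists (jdet V2); split; first exact: jdet2_neq0.
exists (grad p *m cob V2).
pose E0 := row_mx (map_mx (meval al) M) V2.
have fr : row_free E0.
  rewrite -kermx_eq0; apply/eqP/row_matrixP => i; rewrite row0.
  have: row i (kermx E0) *m E0 = 0 by rewrite -row_mul mulmx_ker row0.
  rewrite mul_mx_row -row_mx0 => /eq_row_mx[h1 h2].
  exact: hidx.
have [L hL] := row_freeP fr.
(* Composition with the right inverse found at [al] gives a square matrix over the polynomial ring
   whose determinant is 1 at [al]. *)
pose E := row_mx M (MC V2) *m MC L.
have detE : \det E != 0.
  have: (\det E).@[al] != 0; last by apply: contraNneq => ->; rewrite meval0.
  rewrite -det_map_mx map_mxM map_row_mx.
  have h p' q (X : 'M[K]_(p', q)) : map_mx (meval al) (MC X) = X.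
    by apply/matrixP => i j; rewrite !mxE mevalC.
  by rewrite !h hL det1 oner_eq0.
pose w := jdet V2 *: grad p - (grad p *m cob V2) *m jac.
have wM : w *m M = 0.
  by rewrite mulmxBl -scalemxAl hp scaler0 -(mulmxA _ jac) hMH mulmx0 subr0.
have wV : w *m MC V2 = 0.
  rewrite mulmxBl -(mulmxA (grad p)) /cob -!(mulmxA _ _ jac) -!mulmxA.
  by rewrite mul_adj_mx mul_mx_scalar -scalemxAr -scalemxAl subrr.
have wE : w *m E = 0.
  by rewrite /E mulmxA mul_mx_row wM wV row_mx0 mul0mx.
have: \det E *: w = 0.
  by rewrite -mul_mx_scalar -mul_mx_adj mulmxA wE mul0mx.
rewrite -(scaler0 _ (\det E)) => /(scalemxI detE) /eqP; rewrite subr_eq0.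
by move/eqP.
Qed.

(** The entries of [M] are linear forms, so the equation [grad p *m M = 0] separates into one
    equation per degree. *)
Lemma inv_homog p e : grad p *m M = 0 -> grad (pihomog mdeg e p) *m M = 0.
Proof.
move=> hp; apply/rowP => j; rewrite !mxE.
have hd i : mderiv i (pihomog mdeg e p) = if e is e'.+1 then pihomog mdeg e' (mderiv i p) else 0.
  apply: (meval_inj K0) => t.
  have : line (fun=> 0) t (mderiv i p) = \poly_(b < (msize p).+1) ((mderiv i (pihomog mdeg b.+1 p)).@[t]).
    apply: (poly_fun_inj K0) => s s0; rewrite line_horner horner_poly.
    rewrite {1}(pihomog_partitionE (k := (msize p).+2) (leqW (leqnSn (msize p)))) big_ord_recl mderivD.
    rewrite (homog0_const (pihomogP _ 0 p)) mderivC add0r.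
    rewrite (big_morph _ (@mderivD _ _ i) (mderiv0 _ i)) (big_morph _ (mevalD _) (meval0 _)).
    apply: eq_bigr => b _.
    rewrite (meval_eq (v2 := fun i => s * t i)); last by move=> l; rewrite add0r.
    by rewrite (meval_deriv_homog _ _ _ (pihomogP _ _ _)) mulrC.
  case: e => [|e] hl.
    by rewrite (homog0_const (pihomogP _ 0 p)) mderivC.
  have := congr1 (fun q : {poly K} => q`_e) hl.
  rewrite (line_pihomog K0) coef_poly; case: ltnP => // h ->.
  have -> : pihomog mdeg e.+1 p = 0; last by rewrite mderivE || rewrite raddf0 meval0.
  rewrite pihomogE big_seq_cond big1 // => mu /andP[/msize_mdeg_lt h1 /eqP h2].
  by move: h1; rewrite /= h2; lia.
rewrite (eq_bigr (fun i => (if e is e'.+1 then pihomog mdeg e' (mderiv i p) else 0) * M i j)); last first.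
  by move=> i _; rewrite mxE hd.
case: e {hd} => [|e]; first by rewrite big1 // => i _; rewrite mul0r.
move/rowP: hp => /(_ j); rewrite !mxE => /(congr1 (pihomog mdeg e.+1)).
rewrite pihomog0 (big_morph _ (pihomogD _ _) (pihomog0 _ _ _)) => h.
rewrite -[RHS]h; apply: eq_bigr => i _.
by rewrite mxE (pihomogM_homog _ _ (hM i j)) subSS subn0.
Qed.

Lemma inv_in_subalg p : grad p *m M = 0 -> in_subalg H p.
Proof.
move=> hp; rewrite (pihomog_partitionE (leqnn (msize p))).
apply: in_subalg_sum => e _; apply: (jclass_homog (e := e)); first exact: pihomogP.
exact/inv_jclass/inv_homog.
Qed.

End Invariants.

(** Two block eliminations of the same matrix [B]. The powers of [c] replace a division by [c],
    since the identity is later used for [c = 'X^N]. *)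
Lemma det_scalar_sub_comm (R : comNzRingType) (n k : nat) (c : R)
  (U : 'M[R]_(n, k)) (V : 'M[R]_(k, n)) :
  c ^+ k * \det (c%:M - U *m V) = c ^+ n * \det (c%:M - V *m U).
Proof.
pose B := block_mx c%:M U V 1%:M.
have h1 : \det B = \det (c%:M - U *m V).
  have : block_mx 1%:M (- U) 0 1%:M *m B = block_mx (c%:M - U *m V) 0 V 1%:M.
    by rewrite mulmx_block !mul1mx !mul0mx !mulmx1 !add0r mulNmx subrr.
  by move/(congr1 determinant); rewrite det_mulmx det_ublock det_lblock !det1 !mul1r mulr1.
have h2 : c ^+ k * \det B = c ^+ n * \det (c%:M - V *m U).
  have : block_mx 1%:M 0 (- V) c%:M *m B = block_mx c%:M U 0 (c%:M - V *m U).
    rewrite mulmx_block !mul1mx !mul0mx !mulmx1 !addr0 mulNmx mul_scalar_mx mul_mx_scalar.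
    by rewrite mulNmx addNr [- _ + _]addrC.
  by move/(congr1 determinant); rewrite det_mulmx det_lblock det_ublock det1 mul1r !det_scalar.
by rewrite -h1.
Qed.

Lemma sylvester (R : comNzRingType) (n k : nat) (U : 'M[R]_(n, k)) (V : 'M[R]_(k, n)) :
  \det (1%:M + U *m V) = \det (1%:M + V *m U).
Proof.
have := det_scalar_sub_comm 1 (- U) V; rewrite !expr1n !mul1r mulNmx mulmxN !opprK.
by move=> ->.
Qed.

(** * Sums of principal minors *)

Section PrincipalMinors.
Variables (R : comNzRingType) (N : nat).
Implicit Types (A : 'M[R]_N) (S : {set 'I_N}).

Definition incr j (p : {ffun 'I_j -> 'I_N}) :=
  [forall a : 'I_j, forall b : 'I_j, (a < b)%N ==> (p a < p b)%N].

Definition DeltaR (j : nat) (A : 'M[R]_N) : R :=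
  \sum_(p : {ffun 'I_j -> 'I_N} | incr p) \det (\matrix_(a < j, b < j) A (p a) (p b)).

(** Rows outside [S] are those of the identity, so the determinant is the principal minor on [S],
    with no reindexing of [S]. *)
Definition mix S A : 'M[R]_N := \matrix_(i, j) (if i \in S then A i j else (i == j)%:R).

Lemma det_scalar_add (x : R) A :
  \det (x%:M + A) = \sum_(S : {set 'I_N}) x ^+ (N - #|S|) * \det (mix S A).
Proof.
rewrite /determinant.
under eq_bigr => s _.
  under eq_bigr do rewrite mxE addrC.
  rewrite bigA_distr mulr_sumr; over.
rewrite exchange_big; apply: eq_bigr => S _ /=.
rewrite mulr_sumr; apply: eq_bigr => s _.
rewrite mulrCA; congr (_ * _).
have -> : (N - #|S|)%N = #|~: S| by rewrite [RHS]cardsCs setCK card_ord.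
rewrite -prodr_const [X in _ = X * _]big_mkcond -big_split /=; apply: eq_bigr => i _.
rewrite !mxE inE; case: ifP => _ /=; first by rewrite mul1r.
by rewrite mulr_natr.
Qed.

Lemma incr_inj j (p : {ffun 'I_j -> 'I_N}) : incr p -> injective p.
Proof.
move=> hp a b e; case: (ltngtP a b) => [ab|ab|/val_inj //].
  by have := implyP (forallP (forallP hp a) b) ab; rewrite e ltnn.
by have := implyP (forallP (forallP hp b) a) ab; rewrite e ltnn.
Qed.

(** [mix] is the identity plus a matrix that factors through the [j] chosen coordinates; Sylvester's
    identity reduces its determinant to size [j]. *)
Lemma det_mix j (p : {ffun 'I_j -> 'I_N}) A : injective p ->
  \det (mix [set p a | a in 'I_j] A) = \det (\matrix_(a < j, b < j) A (p a) (p b)).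
Proof.
move=> pI.
pose Q : 'M[R]_(N, j) := \matrix_(i, a) (i == p a)%:R.
have hQ (X : 'M[R]_N) : Q *m (Q^T *m X) = \matrix_(i, l) (if i \in [set p a | a in 'I_j] then X i l else 0).
  apply/matrixP => i l; rewrite !mxE.
  have hX a : (Q^T *m X) a l = X (p a) l.
    rewrite mxE (bigD1 (p a)) //= big1 ?addr0 ?mxE ?eqxx ?mul1r // => i' h.
    by rewrite !mxE (negbTE h) mul0r.
  case: imsetP => [[a _ ->]|h].
    rewrite (bigD1 a) //= big1 ?addr0 => [|b ba]; first by rewrite hX mxE eqxx mul1r.
    by rewrite mxE (inj_eq pI) eq_sym (negbTE ba) mul0r.
  rewrite big1 // => a _; rewrite mxE; case: eqP => [e|_]; last by rewrite mul0r.
  by case: h; exists a.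
have -> : mix [set p a | a in 'I_j] A = 1%:M + Q *m (Q^T *m (A - 1%:M)).
  rewrite hQ; apply/matrixP => i l; rewrite !mxE; case: ifP => _; last by rewrite addr0.
  by rewrite addrC subrK.
rewrite sylvester mulmxBr mulmx1 mulmxBl.
have -> : Q^T *m Q = 1%:M.
  apply/matrixP => a b; rewrite !mxE (bigD1 (p a)) //= big1 ?addr0; last first.
    by move=> i h; rewrite !mxE (negbTE h) mul0r.
  by rewrite !mxE eqxx mul1r (inj_eq pI).
rewrite addrC subrK; congr (\det _); apply/matrixP => a b; rewrite !mxE.
rewrite (bigD1 (p b)) //= big1 ?addr0; last first.
  by move=> i h; rewrite !mxE (negbTE h) mulr0.
rewrite !mxE eqxx mulr1 (bigD1 (p a)) //= big1 ?addr0 ?mxE ?eqxx ?mul1r // => i h.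
by rewrite !mxE (negbTE h) mul0r.
Qed.

Lemma sorted_enum_set (S : {set 'I_N}) : sorted ltn [seq val i | i <- enum S].
Proof.
apply: (@subseq_sorted _ _ ltn_trans _ (iota 0 N)); last exact: iota_ltn_sorted.
rewrite -val_enum_ord; apply: map_subseq; rewrite {1}/enum_mem.
by rewrite -enumT; apply: filter_subseq.
Qed.

Lemma incr_sorted j (p : {ffun 'I_j -> 'I_N}) : incr p ->
  [seq val i | i <- enum [set p a | a in 'I_j]] = [seq val (p a) | a <- enum 'I_j].
Proof.
move=> hp; apply: (irr_sorted_eq ltn_trans ltnn); first exact: sorted_enum_set.
  rewrite (map_comp val p); apply: (homo_sorted (e := relpre val ltn)) => //.
  have: sorted ltn [seq val a | a <- enum 'I_j] by rewrite val_enum_ord iota_ltn_sorted.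
  rewrite sorted_map; apply: homo_sorted => a b ab.
  by move: hp => /forallP/(_ a)/forallP/(_ b)/implyP; apply.
move=> x; apply/mapP/mapP => [[i]|[a _ ->]].
  by rewrite mem_enum => /imsetP[a _ ->] ->; exists a; rewrite ?mem_enum.
by exists (p a) => //; rewrite mem_enum imset_f.
Qed.

Lemma DeltaRE j A : DeltaR j A = \sum_(S : {set 'I_N} | #|S| == j) \det (mix S A).
Proof.
pose P := [set p : {ffun 'I_j -> 'I_N} | incr p].
pose h (p : {ffun 'I_j -> 'I_N}) := [set p a | a in 'I_j].
have -> : DeltaR j A = \sum_(p in P) \det (mix (h p) A).
  apply: eq_big => [p|p hp]; first by rewrite inE.
  by rewrite det_mix //; apply: incr_inj.
rewrite -(big_imset (fun S => \det (mix S A))) /=; last first.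
  move=> p q; rewrite !inE => hp hq e; apply/ffunP => a; apply: val_inj.
  have := incr_sorted hp; rewrite -/(h p) e (incr_sorted hq) => /eq_in_map hh.
  by rewrite (hh a) ?mem_enum.
apply: eq_bigl => S; apply/imsetP/eqP => [[p]|sS].
  by rewrite inE => hp ->; rewrite card_imset ?card_ord //; apply: incr_inj.
pose p : {ffun 'I_j -> 'I_N} := [ffun a => enum_val (cast_ord (esym sS) a)].
exists p; last first.
  apply/setP => i; apply/idP/imsetP => [iS|[a _ ->]].
    exists (cast_ord sS (enum_rank_in iS i)) => //.
    by rewrite ffunE cast_ordK enum_rankK_in.
  by rewrite ffunE enum_valP.
rewrite inE; apply/forallP => a; apply/forallP => b; apply/implyP => ab; rewrite !ffunE.
have x0 : 'I_N := enum_val (cast_ord (esym sS) a).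
rewrite !(enum_val_nth x0) /=.
have sz : size (enum S) = j by rewrite -cardE.
rewrite -!(nth_map x0 (val x0) val) ?sz //.
by apply: (sorted_ltn_nth ltn_trans) => //; rewrite ?inE ?size_map ?sz //; exact: sorted_enum_set.
Qed.

Lemma det_scalar_add_Delta (x : R) A :
  \det (x%:M + A) = \sum_(j < N.+1) x ^+ (N - j) * DeltaR j A.
Proof.
rewrite det_scalar_add (partition_big (fun S : {set 'I_N} => inord #|S| : 'I_N.+1) xpredT) //=.
apply: eq_bigr => j _; rewrite DeltaRE mulr_sumr; apply: eq_big => [S|S /eqP <-].
  by rewrite -val_eqE /= inordK // ltnS -[X in (_ <= X)%N](card_ord N) max_card.
by rewrite inordK // ltnS -[X in (_ <= X)%N](card_ord N) max_card.
Qed.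

Lemma DeltaRZ j (t : R) A : DeltaR j (t *: A) = t ^+ j * DeltaR j A.
Proof.
rewrite /DeltaR mulr_sumr; apply: eq_bigr => p _.
by rewrite -detZ; congr (\det _); apply/matrixP => a b; rewrite !mxE.
Qed.

End PrincipalMinors.

Lemma DeltaR_map (R S : comNzRingType) (f : {rmorphism R -> S}) N j (A : 'M[R]_N) :
  DeltaR j (map_mx f A) = f (DeltaR j A).
Proof.
rewrite /DeltaR rmorph_sum; apply: eq_bigr => p _; rewrite -det_map_mx.
by congr (\det _); apply/matrixP => a b; rewrite !mxE.
Qed.

Lemma DeltaE (K : fieldType) N j (A : 'M[K]_N) : Delta j A = DeltaR j A.
Proof. by []. Qed.

Lemma coef_char_poly (R : comNzRingType) N (A : 'M[R]_N) j : (j <= N)%N ->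
  (char_poly A)`_(N - j) = (-1) ^+ j * DeltaR j A.
Proof.
move=> jN; rewrite /char_poly /char_poly_mx -scaleN1r.
have -> : -1 *: map_mx polyC A = map_mx polyC (-1 *: A).
  by apply/matrixP => i l; rewrite !mxE rmorphM rmorphN1.
rewrite det_scalar_add_Delta coef_sum (bigD1 (inord j)) //= inordK // big1 => [|i ij].
  by rewrite addr0 DeltaR_map coefMC coefXn eqxx mul1r DeltaRZ.
rewrite DeltaR_map coefMC coefXn; case: eqP; rewrite ?mul0r // => h.
by case/eqP: ij; apply: val_inj; rewrite /= inordK //; have := ltn_ord i; lia.
Qed.

Lemma char_poly_conj (K : fieldType) N (A B C : 'M[K]_N) : B \in unitmx ->
  B *m A = C *m B -> char_poly A = char_poly C.
Proof.
move=> uB e; rewrite /char_poly /char_poly_mx.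
have uB' : \det (map_mx polyC B) != 0.
  by rewrite det_map_mx polyC_eq0 -unitfE -unitmxE.
apply: (mulfI uB'); rewrite -det_mulmx [RHS]mulrC -det_mulmx; congr (\det _).
by rewrite mulmxBr mulmxBl -!map_mxM e scalar_mxC.
Qed.

Lemma DeltaR_conj (K : fieldType) N j (A B C : 'M[K]_N) : (j <= N)%N -> B \in unitmx ->
  B *m A = C *m B -> DeltaR j A = DeltaR j C.
Proof.
move=> jN uB e; have := char_poly_conj uB e => /(congr1 (fun p : {poly K} => p`_(N - j))).
by rewrite !coef_char_poly //; apply: mulrI; rewrite rpredX // rpredN unitr1.
Qed.

Lemma DeltaR_tr (R : comNzRingType) N j (A : 'M[R]_N) : DeltaR j A^T = DeltaR j A.
Proof.
by apply: eq_bigr => p _; rewrite -det_tr; congr (\det _); apply/matrixP => a b; rewrite !mxE.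
Qed.

Lemma char_poly_nilpotent (K : closedFieldType) N (e : 'M[K]_N) : e ^+ N = 0 -> char_poly e = 'X^N.
Proof.
move=> he; have [r er] := closed_field_poly_normal (char_poly e).
have mp := char_poly_monic e; rewrite (monicP mp) scale1r in er.
have r0 : all (pred1 0) r.
  apply/allP => x xr /=.
  have : root (char_poly e) x by rewrite er root_prod_XsubC.
  rewrite -eigenvalue_root_char => /eigenvalueP[v hv v0].
  have hk k : v *m e ^+ k = x ^+ k *: v.
    elim: k => [|k IH]; first by rewrite !expr0 scale1r -[1]/(1%:M) mulmx1.
    by rewrite exprSr -[_ * e]/(_ *m e) mulmxA IH -scalemxAl hv scalerA -exprSr.
  move: (hk N); rewrite he mulmx0 => /esym/eqP; rewrite scaler_eq0 (negbTE v0) orbF.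
  by rewrite expf_eq0 => /andP[].
have sr : size r = N.
  by have := size_char_poly e; rewrite er size_prod_XsubC => -[].
rewrite er -sr; elim: (r) r0 => [|x l IH] /=; first by rewrite big_nil expr0.
by case/andP => /eqP -> /IH; rewrite big_cons subr0 exprS => ->.
Qed.

(** * Characteristic polynomial of a nilpotent matrix plus a product through few rows *)

Section Slice.
Variables (R : idomainType) (N k : nat) (e : 'M[R]_N) (L : 'M[R]_(k, N)) (U : 'M[R]_(N, k)).
Variable lam : 'I_k -> nat.
Hypothesis he : e ^+ N = 0.
Hypothesis hc : char_poly e = 'X^N.
Hypothesis hL : forall i, row i L *m e ^+ lam i = 0.
Hypothesis hlam : (\sum_i lam i = N)%N.

Definition slice_poly i j : {poly R} :=
  \sum_(s < lam i) ((row i L *m e ^+ s *m U) 0 j) *: 'X^(lam i - s.+1).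

Definition slice_mx : 'M[{poly R}]_k :=
  \matrix_(i, j) ('X^(lam i) *+ (i == j) - slice_poly i j).

(** The polynomial matrix [A] is ['X^N] times the inverse of ['X - e]. With [c = 'X^N],
    [det_scalar_sub_comm] trades the determinant of size [N] for one of size [k], and
    [row i L *m e ^+ lam i = 0] makes row [i] of the latter divisible by ['X^(N - lam i)]. As the
    [lam i] add up to [N], these factors account exactly for the surplus powers of ['X]. *)
Lemma slice_char_poly : char_poly (e + U *m L) = \det slice_mx.
Proof.
pose P p q (A : 'M[R]_(p, q)) := map_mx (@polyC R) A.
pose Z := 'X%:M - P _ _ e.
pose A := \sum_(s < N) 'X^(N - s.+1) *: P _ _ (e ^+ s).
have lN i : (lam i <= N)%N by rewrite -hlam (bigD1 i) //= leq_addr.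
have PX s : P _ _ (e ^+ s) = (P _ _ e) ^+ s by rewrite /P rmorphXn.
have ZA : Z *m A = ('X^N)%:M.
  rewrite /A mulmx_sumr.
  pose T s := 'X^(N - s) *: P _ _ (e ^+ s).
  have -> : \sum_(i < N) Z *m ('X^(N - i.+1) *: P _ _ (e ^+ i)) = \sum_(i < N) (T i - T i.+1).
    apply: eq_bigr => i _; rewrite /T /Z mulmxBl mul_scalar_mx scalerA -exprS -subSn // subSS.
    by rewrite -scalemxAr exprS -[e * _]/(e *m _) /P map_mxM.
  rewrite -(big_mkord xpredT (fun i => T i - T i.+1)).
  rewrite (eq_bigr (fun i => - (T i.+1 - T i))) => [|i _]; last by rewrite opprB.
  rewrite sumrN telescope_sumr // opprB.
  by rewrite /T he /P map_mx0 scaler0 subr0 subn0 expr0 map_mx1 scalemx1.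
have detZ : \det Z = 'X^N by [].
have detA : 'X^N * \det A = 'X^(N * N) by rewrite -detZ -det_mulmx ZA det_scalar exprM.
have X0 l : ('X^l : {poly R}) != 0 by rewrite monic_neq0 // monicXn.
apply: (mulfI (X0 (N * k)%N)).
have e1 : 'X^(N * k) * (\det (Z - P _ _ U *m P _ _ L) * \det A) =
   'X^(N * N) * \det (('X^N)%:M - (P _ _ L *m A) *m P _ _ U).
  rewrite -det_mulmx mulmxBl ZA -(mulmxA (P _ _ U)) !exprM; exact: det_scalar_sub_comm.
have e2 : ('X^N)%:M - (P _ _ L *m A) *m P _ _ U =
    diag_mx (\row_i 'X^(N - lam i)) *m slice_mx.
  have hW i j : ((P _ _ L *m A) *m P _ _ U) i j = 'X^(N - lam i) * slice_poly i j.
    have -> : P _ _ L *m A *m P _ _ U = \sum_(s < N) 'X^(N - s.+1) *: P _ _ (L *m e ^+ s *m U).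
      rewrite /A mulmx_sumr mulmx_suml; apply: eq_bigr => s _.
      by rewrite -scalemxAr -scalemxAl /P !map_mxM.
    rewrite summxE /slice_poly mulr_sumr.
    rewrite (big_ord_widen N (fun s => 'X^(N - lam i) *
       (((row i L *m e ^+ s *m U) 0 j) *: ('X^(lam i - s.+1) : {poly R})))) //.
    rewrite [RHS]big_mkcond; apply: eq_bigr => s _.
    rewrite -scalerAr -exprD -!row_mul [in LHS]mxE [map_mx _ _ i j]mxE mulrC mul_polyC.
    case: ltnP => h.
      by rewrite [in RHS]mxE; congr (_ *: 'X^_); have := lN i; lia.
    suff -> : (L *m e ^+ s *m U) i j = 0 by rewrite scale0r.
    have := congr1 (fun v : 'rV_k => v 0 j)
      (congr1 (fun v => v *m U) (congr1 (fun v => v *m e ^+ (s - lam i)) (hL i))).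
    rewrite -(mulmxA _ (e ^+ lam i)) -[e ^+ lam i *m _]/(e ^+ lam i * _) -exprD subnKC //.
    by rewrite -!row_mul !mul0mx mxE [RHS]mxE.
  move: (_ *m _ *m _) hW => W hW; apply/matrixP => i j.
  rewrite mul_diag_mx !mxE hW mulrBr; congr (_ - _).
  by case: (i == j); rewrite ?mulr0n ?mulr0 // !mulr1n -exprD subnK.
have e3 : \prod_(i < k) 'X^(N - lam i) = 'X^(N * k - N) :> {poly R}.
  rewrite prodrXr; congr ('X^_).
  by rewrite sumnB // sum_nat_const card_ord hlam mulnC.
have Zdef : char_poly (e + U *m L) = \det (Z - P _ _ U *m P _ _ L).
  by rewrite /char_poly /char_poly_mx /Z /P map_mxD map_mxM opprD addrA.
have A0 : \det A != 0.
  by apply: contra_neq (X0 (N * N)%N) => h; rewrite -detA h mulr0.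
apply: (mulIf A0); rewrite Zdef -mulrA e1 e2 det_mulmx det_diag.
under eq_bigr do rewrite mxE; rewrite e3 -detA.
have Nk : (N <= N * k)%N.
  case: (posnP k) => [k0|k0]; last by rewrite leq_pmulr.
  by rewrite -[X in (X <= _)%N]hlam big1 // => i; have := ltn_ord i; rewrite [X in (_ < X)%N]k0.
by rewrite mulrACA -exprD subnKC // [\det A * _]mulrC mulrA.
Qed.

End Slice.

Lemma linfunE (K : fieldType) (aT rT : vectType K) (f : aT -> rT) :
  linear f -> forall x, linfun f x = f x.
Proof.
move=> lf x.
pose g : {linear aT -> rT} := HB.pack f (GRing.isLinear.Build _ _ _ _ f lf).
exact: (lfunE g x).
Qed.

(** * Homogeneous components of the minor sums at [e] and their symmetries *)

Section Expansion.
Variables (K : fieldType) (N : nat).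
Hypothesis K0 : [pchar K] =i pred0.
Local Notation M := 'M[K]_N.
Implicit Types (e x y v w : M) (j d : nat).

Definition Fpoly e j x : {poly K} := DeltaR j (map_mx polyC e + 'X *: map_mx polyC x).

(* [F e j d] is the degree [d] component of [w |-> Delta j (e + w)]. *)
Definition F e j d x : K := (Fpoly e j x)`_d.

Lemma Fpoly_horner e j x t : (Fpoly e j x).[t] = DeltaR j (e + t *: x).
Proof.
rewrite -[LHS]/(horner_eval t (Fpoly e j x)) -DeltaR_map; congr DeltaR.
by apply/matrixP => a b; rewrite !mxE /= /horner_eval hornerD hornerM hornerX !hornerC.
Qed.

Lemma Fpoly_uniq e j x (p : {poly K}) :
  (forall t, t != 0 -> DeltaR j (e + t *: x) = p.[t]) -> forall d, F e j d x = p`_d.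
Proof.
move=> h d; rewrite /F; suff -> : Fpoly e j x = p by [].
by apply: (poly_fun_inj K0) => t t0; rewrite Fpoly_horner h.
Qed.

Definition vx x : 'I_(N * N) -> K := fun i => mxvec x 0 i.

Definition Gen e j : {mpoly K[N * N]} :=
  DeltaR j (\matrix_(a, b) ((e a b)%:MP + 'X_(mxvec_index a b))).

Lemma Gen_meval e j x : (Gen e j).@[vx x] = DeltaR j (e + x).
Proof.
rewrite -[LHS]/(meval (vx x) _) -DeltaR_map; congr DeltaR.
by apply/matrixP => a b; rewrite !mxE raddfD /= mevalC mevalXU /vx mxvecE.
Qed.

Definition Gd e j d : {mpoly K[N * N]} := pihomog mdeg d (Gen e j).

Lemma Gd_meval e j d x : (Gd e j d).@[vx x] = F e j d x.
Proof.
rewrite -(line_pihomog K0); apply/esym/Fpoly_uniq => t _; rewrite line_horner -Gen_meval.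
by apply: meval_eq => i; rewrite add0r /vx linearZ mxE.
Qed.

Definition fsz e j : nat := msize (Gen e j).

Lemma F_sum e j x : DeltaR j (e + x) = \sum_(d < fsz e j) F e j d x.
Proof.
rewrite -Gen_meval (meval_eq (v2 := fun i => 1 * vx x i)); last by move=> i; rewrite mul1r.
rewrite (meval_pihomog 1 (vx x) (leqnn _)); apply: eq_bigr => d _.
by rewrite expr1n mulr1 -/(Gd e j d) Gd_meval.
Qed.

Lemma F_homog e j d x t : F e j d (t *: x) = t ^+ d * F e j d x.
Proof.
rewrite -!Gd_meval -(homog_scale _ _ (pihomogP _ _ _)); apply: meval_eq => i.
by rewrite /vx linearZ mxE.
Qed.

Lemma F_curve e j d (n : nat) (X : 'I_n -> M) : exists p : {poly K},
  forall t, p.[t] = F e j d (\sum_(i < n) t ^+ i *: X i).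
Proof.
pose q a : {poly K} := \sum_(i < n) (vx (X i) a) *: 'X^i.
exists (curve q (Gd e j d)) => t; rewrite -Gd_meval curve_horner; apply: meval_eq => a.
rewrite horner_sum /vx linear_sum summxE; apply: eq_bigr => i _.
by rewrite linearZ mxE !hornerE mulrC.
Qed.

Definition transl e j d y := forall x, F e j d (x + (y *m e - e *m y)) = F e j d x.

Lemma translD e j d y z : transl e j d y -> transl e j d z -> transl e j d (y + z).
Proof.
move=> hy hz x.
rewrite (_ : x + _ = (x + (y *m e - e *m y)) + (z *m e - e *m z)) ?hz //.
rewrite mulmxDl mulmxDr.
move: (y *m e) (z *m e) (e *m y) (e *m z) => A B C D.
by apply/matrixP => a b; rewrite !mxE; ring.
Qed.

Lemma transl_sum e j d (I : Type) (r : seq I) (P : pred I) (f : I -> M) :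
  (forall i, P i -> transl e j d (f i)) -> transl e j d (\sum_(i <- r | P i) f i).
Proof.
move=> h; elim/big_rec: _ => [x|i y Pi hy]; first by rewrite mul0mx mulmx0 subr0 addr0.
exact: translD (h i Pi) hy.
Qed.

Lemma transl_scalar e j d c : transl e j d c%:M.
Proof. by move=> x; rewrite scalar_mxC subrr addr0. Qed.

(** As [y *m y = 0], the inverse of [1 + t y] is [1 - t y], and conjugating [e + t x] gives
    [e + t X(t)] with [X] polynomial in [t] and [X(0) = x + [y, e]]. The lower components vanish
    identically, so the coefficient of [t ^+ d] in the expansion is the component of degree [d] at
    [X(0)]. *)
Lemma transl_sq0 e j d y : (j <= N)%N -> (forall d' x, (d' < d)%N -> F e j d' x = 0) ->
  y *m y = 0 -> transl e j d y.
Proof.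
move=> jN low y2 x.
pose X0 := x + (y *m e - e *m y).
pose X1 := y *m x - x *m y - y *m e *m y.
pose X2 := - (y *m x *m y).
pose X t := \sum_(i < 3) t ^+ i *: [tuple X0; X1; X2]`_i.
have XE t : X t = X0 + t *: X1 + t ^+ 2 *: X2.
  by rewrite /X !big_ord_recr big_ord0 /= add0r expr0 scale1r expr1.
have conj t : DeltaR j (e + t *: X t) = DeltaR j (e + t *: x).
  have inv : (1%:M - t *: y) *m (1%:M + t *: y) = 1%:M.
    rewrite mulmxBl !mulmxDr !mul1mx !mulmx1 -!scalemxAl -!scalemxAr y2 !scaler0 addr0.
    by rewrite addrK.
  have u : 1%:M + t *: y \in unitmx by have := mulmx1_unit inv; case.
  apply/esym/(DeltaR_conj jN u).
  have -> : e + t *: X t = (1%:M + t *: y) *m (e + t *: x) *m (1%:M - t *: y).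
    rewrite XE /X0 /X1 /X2 mulmxBr mulmx1 mulmxDl mul1mx -scalemxAr mulmxDl.
    rewrite -scalemxAl mulmxDr -scalemxAr !mulmxDl -!scalemxAl mulmxDl -!scalemxAl.
    move: (y *m e *m y) (y *m x *m y) (y *m e) (y *m x) (e *m y) (x *m y) => A1 A2 A3 A4 A5 A6.
    by apply/matrixP => a b; rewrite !mxE; ring.
  by rewrite -[RHS]mulmxA inv mulmx1.
have hp d' : exists p : {poly K}, forall t, p.[t] = F e j d' (X t).
  by apply: (F_curve e j d' (fun i => [tuple X0; X1; X2]`_i)).
pose n := maxn (fsz e j) d.+1.
have [p hpp] : exists p : nat -> {poly K}, forall d' t, (p d').[t] = F e j d' (X t).
  have [f hf] := fin_all_exists (fun i : 'I_n => hp i).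
  exists (fun d' => if insub d' is Some i then f i else 0) => d' t.
  case: insubP => [i _ <-|]; first exact: hf.
  rewrite -leqNgt horner0 => h; rewrite -Gd_meval /Gd.
  rewrite pihomogE big_seq_cond big1 ?meval0 // => mu /andP[/msize_mdeg_lt h1 /eqP h2].
  by move: h1 h; rewrite /= h2 /n /fsz geq_max => h1 /andP[]; lia.
have F0 d' x' : (fsz e j <= d')%N -> F e j d' x' = 0.
  move=> h; rewrite -Gd_meval /Gd.
  rewrite pihomogE big_seq_cond big1 ?meval0 // => mu /andP[/msize_mdeg_lt h1 /eqP h2].
  by move: h1 h; rewrite /= h2 /fsz; lia.
have Fs x' : DeltaR j (e + x') = \sum_(d' < n) F e j d' x'.
  rewrite F_sum (big_ord_widen n (fun d' => F e j d' x')) ?leq_maxl //.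
  rewrite big_mkcond; apply: eq_bigr => i _; case: ltnP => // h.
  by rewrite F0.
have e1 : \sum_(d' < n) p d' * 'X^d' = \sum_(d' < n) (F e j d' x) *: 'X^d' :> {poly K}.
  apply: (poly_fun_inj K0) => t _; rewrite !horner_sum.
  transitivity (DeltaR j (e + t *: x)).
    rewrite -conj Fs; apply: eq_bigr => i _.
    by rewrite !hornerE hpp F_homog mulrC.
  by rewrite Fs; apply: eq_bigr => i _; rewrite !hornerE F_homog mulrC.
have dn : (d < n)%N by rewrite leq_max leqnn orbT.
have := congr1 (fun q : {poly K} => q`_d) e1; rewrite !coef_sum.
rewrite (bigD1 (Ordinal dn)) //= big1 ?addr0; last first.
  move=> i /eqP ni; rewrite coefMXn; case: ltnP => // h.
  have id : (i < d)%N by rewrite ltn_neqAle h andbT; apply/eqP => ed; apply: ni; apply: val_inj.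
  suff -> : p i = 0 by rewrite coef0.
  by apply: (poly_fun_inj K0) => t _; rewrite hpp horner0 low.
rewrite coefMXn ltnn subnn -horner_coef0 hpp XE scale0r expr0n scale0r !addr0 => ->.
rewrite (bigD1 (Ordinal dn)) //= big1 ?addr0; last first.
  move=> i /eqP ni; rewrite coefZ coefXn; case: eqP; rewrite ?mulr0 // => h.
  by case: ni; apply: val_inj.
by rewrite coefZ coefXn eqxx mulr1.
Qed.

(** Scalars and matrices of square zero span all matrices, and [transl] is additive. Off-diagonal
    units have square zero; diagonal units are reached through the differences [E a a - E b b]. *)
Lemma F_transl e j d y x : (j <= N)%N -> (forall d' x, (d' < d)%N -> F e j d' x = 0) ->
  F e j d (x + (y *m e - e *m y)) = F e j d x.
Proof.
move=> jN low.
have sq0 z : z *m z = 0 -> transl e j d z by apply: transl_sq0.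
pose E a b := delta_mx a b : M.
have off c a b : a != b -> transl e j d (c *: E a b).
  move=> ab; apply: sq0; rewrite -scalemxAl -scalemxAr mul_delta_mx_0 ?scaler0 //.
  by rewrite eq_sym.
have diag c a b : transl e j d (c *: (E a a - E b b)).
  case: (eqVneq a b) => [->|ab].
    by rewrite subrr scaler0 => x'; rewrite mul0mx mulmx0 subr0 addr0.
  (* In the coordinates [a], [b] the first summand has both rows equal to (1, -1) up to the factor
     [c], hence square zero. *)
  have -> : c *: (E a a - E b b) = c *: (E a a - E b b - E a b + E b a) + (c *: E a b + (- c) *: E b a).
    by apply/matrixP => p q; rewrite !mxE; ring.
  apply: translD; last by apply: translD; apply: off; rewrite // eq_sym.
  apply: sq0; rewrite -scalemxAl -scalemxAr.
  rewrite !(mulmxDl, mulmxDr, mulNmx, mulmxN) !mul_delta_mx !mul_delta_mx_0 ?(eq_sym b) //.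
  by apply/matrixP => p q; rewrite !mxE; ring.
suff : transl e j d y by apply.
rewrite (matrix_sum_delta y); apply: transl_sum => a _; apply: transl_sum => b _.
case: (eqVneq a b) => [<-|ab]; last exact: off.
have N0 : (N%:R : K) != 0.
  by have := leq_ltn_trans (leq0n _) (ltn_ord a); case: (N) => // n _; apply: natr_neq0.
(* Summed over [b] the differences give [N] times the diagonal unit minus the identity, whence the
   weight [y a a / N] and the scalar correction. *)
have -> : y a a *: delta_mx a a = \sum_(b < N) (y a a / N%:R) *: (E a a - E b b) + (y a a / N%:R)%:M.
  rewrite -scaler_sumr sumrB sumr_const card_ord.
  have -> : \sum_i E i i = 1%:M.
    apply/matrixP => p q; rewrite summxE (bigD1 p) //= big1 ?addr0; first by rewrite !mxE eqxx andTb eq_sym.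
    by move=> i ip; rewrite mxE eq_sym (negbTE ip).
  by rewrite scalerBr scalemx1 subrK -scaler_nat scalerA divfK.
by apply: translD; [apply: transl_sum => i _; exact: diag|exact: transl_scalar].
Qed.

Lemma F_conj e j d (g x : M) : (j <= N)%N -> g \in unitmx -> g *m e = e *m g ->
  F e j d (g *m x *m invmx g) = F e j d x.
Proof.
move=> jN ug ge; apply: Fpoly_uniq => t _.
rewrite -/(Fpoly e j x) Fpoly_horner; apply/esym/(DeltaR_conj jN ug).
by rewrite mulmxDr mulmxDl ge -scalemxAr -scalemxAl mulmxKV.
Qed.

Section Sigma.
Variable Om : M.
Hypothesis hOm : Om \in unitmx.
Hypothesis hOmT : Om^T = - Om.

(** The involutive Lie algebra automorphism of [gl] with fixed space [sp]; by [sigM] it reverses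
    associative products up to sign. *)
Definition sig x : M := - (invmx Om *m x^T *m Om).

Lemma spE x : (x \in sp Om) = (sig x == x).
Proof.
rewrite /sp memv_ker linfunE; last first.
  move=> a u v; rewrite linearP /= mulmxDl mulmxDr -scalemxAl -scalemxAr scalerDr.
  by rewrite addrACA.
rewrite /sig; apply/eqP/eqP => [h|h].
  have h' : x^T *m Om = - (Om *m x) by apply/eqP; rewrite -subr_eq0 opprK h.
  by rewrite -mulmxA h' mulmxN mulKmx // opprK.
by rewrite -{2}h mulmxN -!mulmxA mulKVmx // subrr.
Qed.

Lemma sig_sig x : sig (sig x) = x.
Proof.
have e1 : (invmx Om)^T = - invmx Om.
  rewrite trmx_inv hOmT; apply: (can_inj (mulmxK hOm)); rewrite mulNmx mulVmx //.
  have u' : - Om \in unitmx by rewrite -hOmT unitmx_tr.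
  by apply: oppr_inj; rewrite opprK -mulmxN mulVmx.
rewrite /sig linearN /= !trmx_mul trmxK e1 hOmT !(mulNmx, mulmxN) !opprK !mulmxA.
by rewrite mulVmx // mul1mx mulmxKV.
Qed.

Lemma sigD x y : sig (x + y) = sig x + sig y.
Proof. by rewrite /sig linearD /= mulmxDr mulmxDl opprD. Qed.

Lemma sigZ c x : sig (c *: x) = c *: sig x.
Proof. by rewrite /sig linearZ /= -scalemxAr -scalemxAl scalerN. Qed.

Lemma sigM x y : sig (x *m y) = - (sig y *m sig x).
Proof. by rewrite /sig trmx_mul mulmxN mulNmx opprK !mulmxA mulmxK. Qed.

Lemma mxtrace_sig x : \tr (sig x) = - \tr x.
Proof. by rewrite /sig linearN /= mxtrace_mulC mulmxA mulmxV // mul1mx mxtrace_tr. Qed.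

Lemma DeltaR_sig j x : (j <= N)%N -> DeltaR j (sig x) = (-1) ^+ j * DeltaR j x.
Proof.
move=> jN; rewrite /sig -scaleN1r DeltaRZ; congr (_ * _).
rewrite -[RHS]DeltaR_tr; apply: (DeltaR_conj jN hOm).
by rewrite !mulmxA mulmxV // mul1mx.
Qed.

Lemma F_sig e j d x : (j <= N)%N -> sig e = e -> F e j d (sig x) = (-1) ^+ j * F e j d x.
Proof.
move=> jN se; rewrite {2}/F -coefCM; apply: Fpoly_uniq => t _.
by rewrite hornerM hornerC Fpoly_horner -DeltaR_sig // sigD sigZ se.
Qed.

Definition spproj x : M := 2%:R^-1 *: (x + sig x).

Lemma sig_spproj x : sig (spproj x) = spproj x.
Proof. by rewrite sigZ sigD sig_sig addrC. Qed.

Lemma spproj_sp x : spproj x \in sp Om.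
Proof. by rewrite spE sig_spproj. Qed.

End Sigma.
End Expansion.

(** * Jordan bases adapted to the form *)

Section NormalForm.
Variable K : fieldType.
Hypothesis K0 : [pchar K] =i pred0.

Definition form p (G : 'M[K]_p) (u v : 'rV[K]_p) : K := (u *m G *m v^T) 0 0.

(* Jordan chains [ell i *m e ^+ s] of rows, dual to each other under [G] through the
   involution [inv], which moves an index by at most one. *)
Record jordan_form p (G e : 'M[K]_p) (k : nat) (lam inv : nat -> nat) (eps : nat -> K)
    (ell : nat -> 'rV[K]_p) : Prop := JordanForm {
  jf_inv_lt : forall i, (i < k)%N -> (inv i < k)%N;
  jf_invK : forall i, (i < k)%N -> inv (inv i) = i;
  jf_lam_inv : forall i, (i < k)%N -> lam (inv i) = lam i;
  jf_inv_near : forall i, (i < k)%N -> (inv i <= i.+1)%N;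
  jf_odd : forall i, (i < k)%N -> odd (lam i) = (inv i != i);
  jf_sorted : forall i j, (i <= j)%N -> (j < k)%N -> (lam j <= lam i)%N;
  jf_lam_gt0 : forall i, (i < k)%N -> (0 < lam i)%N;
  jf_eps : forall i, (i < k)%N -> eps i != 0;
  jf_gram : forall i j s, (i < k)%N -> (j < k)%N ->
    form G (ell i *m e ^+ s) (ell j) = if (j == inv i) && (s.+1 == lam i) then eps i else 0;
  jf_nil : forall i, (i < k)%N -> ell i *m e ^+ lam i = 0;
  jf_total : (\sum_(i < k) lam i = p)%N
}.

Section Skew.
Variables (p : nat) (G e : 'M[K]_p).
Hypothesis hG : G^T = - G.
Hypothesis he : e *m G = - (G *m e^T).

Local Notation psi u v s := (form G (u *m e ^+ s) v).

Lemma formDl u v w : form G (u + v) w = form G u w + form G v w.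
Proof. by rewrite /form !mulmxDl mxE. Qed.
Lemma formZl c u w : form G (c *: u) w = c * form G u w.
Proof. by rewrite /form -!scalemxAl mxE. Qed.
Lemma formDr u v w : form G w (u + v) = form G w u + form G w v.
Proof. by rewrite /form linearD mulmxDr mxE. Qed.
Lemma formZr c u w : form G w (c *: u) = c * form G w u.
Proof. by rewrite /form linearZ -scalemxAr mxE. Qed.
Lemma form0l w : form G 0 w = 0.
Proof. by rewrite /form !mul0mx mxE. Qed.
Lemma form0r w : form G w 0 = 0.
Proof. by rewrite /form trmx0 mulmx0 mxE. Qed.

Lemma formC u v : form G u v = - form G v u.
Proof.
rewrite /form -[u *m G *m v^T]trmxK mxE trmx_mul trmxK trmx_mul hG mulNmx mulmxN mxE.
by rewrite mulmxA.
Qed.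

Lemma eG s : e ^+ s *m G = (-1) ^+ s *: (G *m (e ^+ s)^T).
Proof.
elim: s => [|s IH]; first by rewrite !expr0 scale1r trmx1 mulmx1 -[1 *m G]/(1%:M *m G) mul1mx.
rewrite exprSr -[e ^+ s * e]/(e ^+ s *m e) -mulmxA he mulmxN mulmxA IH -scalemxAl -mulmxA.
by rewrite -trmx_mul exprS mulN1r scaleNr -[e *m _]/(e * _) -exprS exprSr.
Qed.

Lemma form_adj u v s : form G (u *m e ^+ s) v = (-1) ^+ s * form G u (v *m e ^+ s).
Proof. by rewrite /form -(mulmxA u) eG -scalemxAr -scalemxAl mxE trmx_mul !mulmxA. Qed.

Lemma psiC u v s : psi v u s = (-1) ^+ s.+1 * psi u v s.
Proof. by rewrite form_adj formC exprS -mulrA mulN1r mulrN. Qed.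

Lemma psi_shift u v s q : psi (u *m e ^+ q) v s = psi u v (q + s).
Proof. by rewrite -mulmxA exprD. Qed.

Lemma psi_shiftr u v s q : psi u (v *m e ^+ q) s = (-1) ^+ q * psi u v (s + q).
Proof.
rewrite exprD -[e ^+ s * e ^+ q]/(e ^+ s *m e ^+ q) mulmxA (form_adj _ v q) mulrA -exprD addnn.
by rewrite -signr_odd odd_double mul1r.
Qed.

Lemma half_eq0 (x : K) : x = - x -> x = 0.
Proof.
move=> /eqP; rewrite -addr_eq0 -mulr2n -mulr_natr mulf_eq0 => /orP[/eqP //|].
by rewrite (negbTE (natr_neq0 K0 1)).
Qed.

Lemma psi_even u s : ~~ odd s -> psi u u s = 0.
Proof.
move=> os; apply: half_eq0; rewrite {1}psiC -signr_odd /= os expr1 mulN1r.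
by [].
Qed.

Variable r : nat.
Hypothesis hr : e ^+ r.+1 = 0.

Lemma psi0 u v s : (r < s)%N -> psi u v s = 0.
Proof. by move=> h; rewrite -(subnKC h) exprD hr mul0r mulmx0 form0l. Qed.

Lemma psi0A u v t : psi u v (r + t.+1) = 0.
Proof. by apply: psi0; lia. Qed.

(* Descending elimination: one correction kills the pairing of order [s] without
   disturbing the orders above [s]. *)
Lemma isotropic_even u : odd r -> psi u u r != 0 ->
  exists u', psi u' u' r != 0 /\ forall s, (s < r)%N -> psi u' u' s = 0.
Proof.
move=> odr hu.
suff main t : (t <= r)%N -> exists u', psi u' u' r != 0 /\
    forall s, (r - t <= s)%N -> (s < r)%N -> psi u' u' s = 0.
  have [u' [h1 h2]] := main r (leqnn r); exists u'; split=> // s sr.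
  by apply: h2; rewrite ?subnn.
elim: t => [|t IH] tr.
  by exists u; split=> // s; rewrite subn0 ltnNge => ->.
have [w [w1 w2]] := IH (ltnW tr).
pose s0 := (r - t.+1)%N.
case: (boolP (odd s0)) => os; last first.
  exists w; split=> // s h1 h2; case: (eqVneq s s0) => [->|ns]; first exact: psi_even.
  by apply: w2 => //; rewrite /s0 in ns; lia.
(* [r] and [s0] are both odd, so the shift by [t.+1] produces no sign and the two cross terms add up
   instead of cancelling. *)
have oq : ~~ odd t.+1 by have := odr; rewrite -(subnK tr) oddD -/s0 os; case: (odd _).
pose c := - psi w w s0 / (2%:R * psi w w r).
have calc s : psi (w + c *: (w *m e ^+ t.+1)) (w + c *: (w *m e ^+ t.+1)) s =
   psi w w s + 2%:R * c * psi w w (s + t.+1) + c ^+ 2 * psi w w (s + t.+1 + t.+1).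
  rewrite mulmxDl -scalemxAl !(formDl, formDr, formZl, formZr) !psi_shiftr !psi_shift.
  have -> : (-1) ^+ t.+1 = 1 :> K by rewrite -signr_odd (negbTE oq) expr0.
  rewrite (addnC t.+1 s) (addnC t.+1 (s + t.+1)); ring.
exists (w + c *: (w *m e ^+ t.+1)); split.
  by rewrite calc -addnA addSn !psi0A !mulr0 !addr0.
move=> s h1 h2; rewrite calc [X in c ^+ 2 * X]psi0; last by lia.
rewrite mulr0 addr0; case: (eqVneq s s0) => [es|ns].
  rewrite es /s0 subnK // /c; field.
  by rewrite w1 (natr_neq0 K0 1).
by rewrite w2 ?[X in _ * X]psi0 ?mulr0 ?addr0 //; rewrite /s0 in ns; lia.
Qed.

(** For even [r] the top pairing is alternating, so [v] cannot correct itself as in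
    [isotropic_even]; the correction is taken from the chain of [u], which pairs nontrivially with
    [v] at order [r]. *)
Lemma isotropic_odd u v : ~~ odd r -> psi u v r != 0 ->
  exists v', psi u v' r != 0 /\ forall s, psi v' v' s = 0.
Proof.
move=> odr hu.
suff main t : (t <= r)%N -> exists v', psi u v' r != 0 /\
    forall s, (r - t <= s)%N -> psi v' v' s = 0.
  have [u' [h1 h2]] := main r (leqnn r); exists u'; split=> // s.
  by apply: h2; rewrite subnn.
elim: t => [|t IH] tr.
  exists v; split=> // s; rewrite subn0 leq_eqVlt => /orP[/eqP <-|]; last exact: psi0.
  exact: psi_even.
have [w [w1 w2]] := IH (ltnW tr).
pose s0 := (r - t.+1)%N.
case: (boolP (odd s0)) => os; last first.
  exists w; split=> // s h1; case: (eqVneq s s0) => [->|ns]; first exact: psi_even.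
  by apply: w2; rewrite /s0 in ns; lia.
pose c := - psi w w s0 / (2%:R * psi u w r).
pose w' := w + c *: (u *m e ^+ t.+1).
have calc s : psi w' w' s = psi w w s + (1 + (-1) ^+ s.+1) * c * psi u w (s + t.+1)
    + c ^+ 2 * (-1) ^+ t.+1 * psi u u (s + t.+1 + t.+1).
  rewrite /w' mulmxDl -scalemxAl !(formDl, formDr, formZl, formZr) !psi_shiftr !psi_shift.
  rewrite (addnC t.+1 s) (psiC u w) mulrA -exprD.
  have -> : (-1) ^+ (t.+1 + (s + t.+1).+1) = (-1) ^+ s.+1 :> K.
    by rewrite -signr_odd -[in RHS]signr_odd; congr (_ ^+ _); congr nat_of_bool; lia.
  rewrite (addnC t.+1 (s + t.+1)); ring.
exists w'; split.
  by rewrite /w' formDr formZr psi_shiftr psi0A !mulr0 addr0.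
move=> s h1; case: (boolP (odd s)) => os1; last exact: psi_even.
rewrite calc [X in c ^+ 2 * _ * X]psi0; last by lia.
rewrite mulr0 addr0; case: (eqVneq s s0) => [es|ns].
  rewrite es /s0 subnK // -signr_odd /= -/s0 os expr0 /c; field.
  by rewrite w1 (natr_neq0 K0 1).
by rewrite [X in _ * X]psi0 ?mulr0 ?addr0 ?w2 //; rewrite /s0 in ns; lia.
Qed.

(** All self-pairings of [v] vanish, so corrections of [v] inside its own chain keep it isotropic;
    they clear the pairings with [u] below order [r] from the top down. *)
Lemma orthogonal_cross u v : psi u v r != 0 -> (forall s, psi v v s = 0) ->
  exists v', [/\ psi u v' r != 0, forall s, psi v' v' s = 0 &
    forall s, (s < r)%N -> psi u v' s = 0].
Proof.
move=> hu hv.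
suff main t : (t <= r)%N -> exists v', [/\ psi u v' r != 0, forall s, psi v' v' s = 0 &
    forall s, (r - t <= s)%N -> (s < r)%N -> psi u v' s = 0].
  have [u' [h1 h2 h3]] := main r (leqnn r); exists u'; split=> // s sr.
  by apply: h3; rewrite ?subnn.
elim: t => [|t IH] tr.
  by exists v; split=> // s; rewrite subn0 ltnNge => ->.
have [w [w1 w2 w3]] := IH (ltnW tr).
pose s0 := (r - t.+1)%N.
pose c := - (-1) ^+ t.+1 * psi u w s0 / psi u w r.
pose w' := w + c *: (w *m e ^+ t.+1).
have calc s : psi u w' s = psi u w s + c * (-1) ^+ t.+1 * psi u w (s + t.+1).
  by rewrite /w' formDr formZr psi_shiftr mulrA.
exists w'; split.
- by rewrite calc psi0A !mulr0 addr0.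
- move=> s; rewrite /w' mulmxDl -scalemxAl !(formDl, formDr, formZl, formZr).
  by rewrite !psi_shiftr !psi_shift !w2 !mulr0 !addr0.
move=> s h1 h2; rewrite calc; case: (eqVneq s s0) => [es|ns].
  have sq : (-1) ^+ t.+1 * (-1) ^+ t.+1 = 1 :> K by rewrite -exprD addnn -signr_odd odd_double.
  rewrite es /s0 subnK // /c -/s0.
  move: ((-1) ^+ t.+1) sq => z sq; move: (psi u w s0) (psi u w r) w1 => a b b0.
  have -> : - z * a / b * z * b = - (z * z * a) by field.
  by rewrite sq mul1r subrr.
by rewrite [X in _ * X]psi0 ?mulr0 ?addr0 ?w3 //; rewrite /s0 in ns; lia.
Qed.

End Skew.

Lemma antidiag_unit r (a : 'I_r -> K) (A : 'M[K]_r) : (forall i, a i != 0) ->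
  (forall i j : 'I_r, A i j = if (i + j).+1 == r then a i else 0) -> A \in unitmx.
Proof.
move=> a0 hA; rewrite -row_free_unit -kermx_eq0; apply/eqP/row_matrixP => l; rewrite row0.
have: row l (kermx A) *m A = 0 by rewrite -row_mul mulmx_ker row0.
move: (row l _) => v hv; apply/rowP => i; rewrite [RHS]mxE.
move/rowP: hv => /(_ (rev_ord i)); rewrite !mxE (bigD1 i) //= big1 ?addr0.
  rewrite hA /= (_ : (i + (r - i.+1)).+1 == r); last by have := ltn_ord i; lia.
  by move/eqP; rewrite mulf_eq0 (negbTE (a0 i)) orbF => /eqP.
move=> j ji; rewrite hA /=; case: eqP; rewrite ?mulr0 // => h.
by case/eqP: ji; apply: val_inj => /=; have := ltn_ord i; lia.
Qed.

(** The orthogonal of [T] is stable since [e] is skew-adjoint, and it is a complement on which the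
    form stays nondegenerate since the Gram matrix of [T] is invertible. The basis [B] presents it
    as a smaller space of row vectors, to which an induction applies. *)
Lemma orth_split p t (G e : 'M[K]_p) (T : 'M[K]_(t, p)) (S : 'M[K]_t) :
  G \in unitmx -> e *m G = - (G *m e^T) -> T *m e = S *m T ->
  T *m G *m T^T \in unitmx ->
  exists (q : nat) (B : 'M[K]_(q, p)) (e' : 'M[K]_q),
   [/\ (q + t = p)%N, row_free B, B *m e = e' *m B, B *m G *m T^T = 0 & B *m G *m B^T \in unitmx].
Proof.
move=> uG he hT uT.
have rT : \rank T = t.
  apply/eqP; rewrite eqn_leq rank_leq_row /=.
  have : row_free (T *m G *m T^T) by rewrite row_free_unit.
  by rewrite /row_free => /eqP {1}<-; rewrite -mulmxA; exact: mxrankM_maxl.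
pose X := G *m T^T.
have rX : \rank X = t.
  by rewrite -mxrank_tr trmx_mul trmxK mxrankMfree // row_free_unit unitmx_tr.
pose B := row_base (kermx X).
have BX : B *m X = 0 by apply/sub_kermxP; rewrite eq_row_base.
have sB : (B *m e <= B)%MS.
  rewrite eq_row_base; apply/sub_kermxP.
  have eX : e *m X = - (X *m S^T).
    by rewrite /X mulmxA he mulNmx -!mulmxA -!trmx_mul hT.
  by rewrite -mulmxA eX mulmxN mulmxA BX mul0mx oppr0.
exists (\rank (kermx X)), B, (B *m e *m pinvmx B).
have q_t : (\rank (kermx X) + t = p)%N.
  by rewrite mxrank_ker rX subnK // -rX rank_leq_row.
have fB : row_free B by rewrite row_base_free.
split=> //; first by rewrite mulmxKpV.
  by rewrite -mulmxA.
rewrite -row_free_unit -kermx_eq0; apply/eqP/row_matrixP => l; rewrite row0.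
have: row l (kermx (B *m G *m B^T)) *m (B *m G *m B^T) = 0 by rewrite -row_mul mulmx_ker row0.
move: (row l _) => v hv.
have fC : row_free (col_mx B T).
  rewrite -kermx_eq0; apply/eqP/row_matrixP => i; rewrite row0.
  have: row i (kermx (col_mx B T)) *m col_mx B T = 0 by rewrite -row_mul mulmx_ker row0.
  move: (row i _) => w; rewrite -(hsubmxK w) mul_row_col => hw.
  have r0 : rsubmx w = 0.
    have := congr1 (fun z => z *m X) hw; rewrite mulmxDl -mulmxA BX mulmx0 add0r mul0mx.
    rewrite -mulmxA /X (mulmxA T) => /(congr1 (fun z => z *m invmx (T *m G *m T^T))).
    by rewrite mul0mx mulmxK.
  rewrite r0 mul0mx addr0 in hw; rewrite r0.
  have [C hC] := row_freeP fB.
  have := congr1 (fun z => z *m C) hw; rewrite -mulmxA hC mulmx1 mul0mx => ->.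
  by rewrite row_mx0.
have fuC : row_full (col_mx B T) by move: fC; rewrite /row_free /row_full => /eqP ->; rewrite q_t.
have [D hD] := row_fullP fuC.
have vBG : v *m B *m G = 0.
  have : v *m B *m G *m (col_mx B T)^T = 0.
    rewrite tr_col_mx mul_mx_row -(mulmxA v) -(mulmxA v) hv.
    by rewrite -(mulmxA v) -[B *m G *m T^T]mulmxA BX mulmx0 row_mx0.
  move/(congr1 (fun z => z *m D^T)); rewrite -mulmxA -trmx_mul hD trmx1 mulmx1 => ->.
  by rewrite mul0mx.
have vB : v *m B = 0.
  by have := congr1 (fun z => z *m invmx G) vBG; rewrite mulmxK // mul0mx.
have [C hC] := row_freeP fB.
by have := congr1 (fun z => z *m C) vB; rewrite -mulmxA hC mulmx1 mul0mx.
Qed.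

Lemma exists_form_neq0 p (H : 'M[K]_p) : H != 0 -> exists u v, form H u v != 0.
Proof.
move=> H0; case: (pickP (fun ij : 'I_p * 'I_p => H ij.1 ij.2 != 0)) => [[i j] /= hij|h]; last first.
  by case/eqP: H0; apply/matrixP => i j; rewrite mxE; apply/eqP/negPn; rewrite (h (i, j)).
exists (delta_mx 0 i), (delta_mx 0 j).
by rewrite /form -rowE trmx_delta -colE !mxE.
Qed.

Lemma exists_sym_neq0 p (H : 'M[K]_p) : H^T = H -> H != 0 -> exists u, form H u u != 0.
Proof.
move=> sH /exists_form_neq0[u [v huv]].
have hs : form H v u = form H u v.
  by rewrite /form -[v *m H *m u^T]trmxK mxE !trmx_mul trmxK sH mulmxA.
case: (eqVneq (form H u u) 0) => [hu|]; last by exists u.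
case: (eqVneq (form H v v) 0) => [hv|]; last by exists v.
exists (u + v); rewrite formDl !formDr hu hv hs add0r addr0 -mulr2n -mulr_natl mulf_eq0.
by rewrite negb_or huv (natr_neq0 K0 1).
Qed.

Definition chain p (e : 'M[K]_p) r (u : 'rV[K]_p) : 'M[K]_(r, p) := \matrix_(s < r) (u *m e ^+ s).
Definition shift_mx r : 'M[K]_r := \matrix_(i, j) (j == i.+1 :> nat)%:R.

Lemma chain_stable p (e : 'M[K]_p) r u : e ^+ r = 0 -> chain e r u *m e = shift_mx r *m chain e r u.
Proof.
move=> er; apply/row_matrixP => i; rewrite !row_mul rowK.
rewrite -mulmxA -[_ ^+ _ *m e]/(_ ^+ _ * e) -exprSr; case: (ltnP i.+1 r) => h.
  rewrite (_ : row i (shift_mx r) = delta_mx 0 (Ordinal h)); first by rewrite -rowE rowK.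
  by apply/rowP => j; rewrite !mxE.
have -> : i.+1 = r by apply/eqP; rewrite eqn_leq h ltn_ord.
rewrite er mulmx0 (_ : row i _ = 0) ?mul0mx //.
by apply/rowP => j; rewrite !mxE; case: eqP => // ej; move: (ltn_ord j); rewrite ej ltnNge h.
Qed.

Lemma form_chain p (G e : 'M[K]_p) r u v (i j : 'I_r) :
  (chain e r u *m G *m (chain e r v)^T) i j = form G (u *m e ^+ i) (v *m e ^+ j).
Proof.
rewrite /form -[in RHS](rowK (fun s : 'I_r => u *m e ^+ s) i) -[in RHS](rowK (fun s : 'I_r => v *m e ^+ s) j).
rewrite -/(chain e r u) -/(chain e r v) -row_mul tr_row [LHS]mxE [RHS]mxE.
by apply: eq_bigr => l _; rewrite [in RHS]mxE; congr (_ * _); rewrite [RHS]mxE.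
Qed.

Lemma orth_chain p q (G e : 'M[K]_p) (B : 'M[K]_(q, p)) r u x (s : nat) : e ^+ r = 0 ->
  B *m G *m (chain e r u)^T = 0 -> form G (x *m B) (u *m e ^+ s) = 0.
Proof.
move=> er hB; case: (ltnP s r) => h; last first.
  by rewrite -(subnKC h) exprD er mul0r mulmx0 form0r.
rewrite /form -[u *m _](rowK (fun s : 'I_r => u *m e ^+ s) (Ordinal h)) -/(chain e r u).
have := congr1 (fun z => (x *m z) 0 (Ordinal h)) hB; rewrite mulmx0 [RHS]mxE => <-.
rewrite tr_row !mulmxA [LHS]mxE [RHS]mxE; apply: eq_bigr => l _.
by congr (_ * _); rewrite mxE.
Qed.

Section Extend.
Variables (p q : nat) (G e : 'M[K]_p) (B : 'M[K]_(q, p)) (e' : 'M[K]_q) (r : nat).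
Hypothesis hG : G^T = - G.
Hypothesis he : e *m G = - (G *m e^T).
Hypothesis hr : e ^+ r = 0.
Hypothesis fB : row_free B.
Hypothesis hB : B *m e = e' *m B.
Local Notation G' := (B *m G *m B^T).

Lemma ext_skew : G'^T = - G'.
Proof. by rewrite !trmx_mul trmxK hG mulNmx mulmxN mulmxA. Qed.

Lemma ext_adj : e' *m G' = - (G' *m e'^T).
Proof.
have h : e' *m G' = B *m (e *m G) *m B^T by rewrite !mulmxA -hB.
rewrite h he mulmxN mulNmx; congr (- _).
by rewrite -!mulmxA -!trmx_mul hB.
Qed.

Lemma ext_pow s : e' ^+ s *m B = B *m e ^+ s.
Proof.
elim: s => [|s IH]; first by rewrite !expr0 mul1mx -[1]/(1%:M) mulmx1.
rewrite exprSr -[_ * e']/(_ *m e') -mulmxA -hB mulmxA IH -mulmxA.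
by rewrite -[e ^+ s *m e]/(e ^+ s * e) -exprSr.
Qed.

Lemma ext_nil s : e ^+ s = 0 -> e' ^+ s = 0.
Proof.
move=> es; have [C hC] := row_freeP fB.
by rewrite -[_ ^+ s]mulmx1 -hC mulmxA ext_pow es mulmx0 mul0mx.
Qed.

Lemma ext_form s x y : form G (x *m B *m e ^+ s) (y *m B) = form G' (x *m e' ^+ s) y.
Proof. by rewrite /form trmx_mul -(mulmxA x B) -ext_pow !mulmxA. Qed.

(** The pairing of order [lam i - 1] is nonzero on chain [i], so that power of [e] is nonzero. This
    keeps the lengths sorted when a longest chain is put in front. *)
Lemma ext_lam k lam inv eps ell i : jordan_form G' e' k lam inv eps ell ->
  (i < k)%N -> (lam i <= r)%N.
Proof.
move=> jf ik; have l0 := jf_lam_gt0 jf ik.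
have := jf_gram jf (lam i).-1 ik (jf_inv_lt jf ik); rewrite eqxx prednK // eqxx /=.
rewrite leqNgt => h; apply/negP => h1; have := jf_eps jf ik.
rewrite -h (_ : (lam i).-1 = r + ((lam i).-1 - r))%N; last by lia.
by rewrite exprD (ext_nil hr) mul0r mulmx0 form0l eqxx.
Qed.

End Extend.

Lemma subn_of_add a b c : (a + b)%N = c -> (c - a)%N = b.
Proof. by move=> <-; rewrite addKn. Qed.

(** Induction on the dimension, splitting off longest chains. If [e ^+ r] is the last nonzero power,
    its pairing is symmetric for odd [r], which gives a chain dual to itself, and alternating for
    even [r], which gives two chains dual to each other. The new chains come first, so [inv] only
    fixes indices or swaps neighbours, and the lengths stay sorted. *)
Theorem jordan_form_exists p (G e : 'M[K]_p) : G^T = - G -> G \in unitmx ->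
  e *m G = - (G *m e^T) -> (exists m, e ^+ m = 0) ->
  exists k lam inv eps ell, jordan_form G e k lam inv eps ell.
Proof.
have [b] := ubnP p; elim: b p G e => // b IH p G e; rewrite ltnS => pb hG uG he nil.
case: (posnP p) => [p0|p0].
  exists 0%N, (fun=> 0%N), (fun=> 0%N), (fun=> 0), (fun=> 0); split=> //.
  by rewrite big_ord0 p0.
have nil' : exists m, e ^+ m == 0 by case: nil => m em; exists m; apply/eqP.
case: (ex_minnP nil') => r1 /eqP er1 min.
have one0 : (1%:M : 'M[K]_p) != 0.
  apply/eqP => /matrixP/(_ (Ordinal p0) (Ordinal p0)); rewrite !mxE eqxx => /eqP.
  by rewrite oner_eq0.
case: r1 er1 min => [|r] er min; first by case/eqP: one0; exact: er.
have er0 : e ^+ r != 0 by apply/negP => /min; rewrite ltnn.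
have H0 : e ^+ r *m G != 0.
  apply: contraNneq er0 => h; have := congr1 (fun z => z *m invmx G) h.
  by rewrite mulmxK // mul0mx => ->.
have psiE u v : form (e ^+ r *m G) u v = form G (u *m e ^+ r) v by rewrite /form mulmxA.
have finish t (T : 'M[K]_(t, p)) (S : 'M[K]_t) : (0 < t)%N -> T *m e = S *m T ->
   T *m G *m T^T \in unitmx -> exists q (B : 'M[K]_(q, p)) (e' : 'M[K]_q),
     [/\ (q + t = p)%N, row_free B, B *m e = e' *m B, B *m G *m T^T = 0 &
     exists k lam inv eps ell, jordan_form (B *m G *m B^T) e' k lam inv eps ell].
  move=> t0 hT uT; have [q [B [e' [qt fB hB BT uB]]]] := orth_split uG he hT uT.
  exists q, B, e'; split=> //; apply: IH => //.
  - by apply: leq_trans pb; rewrite -qt -addn1 leq_add2l.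
  - exact: ext_skew.
  - exact: (ext_adj he hB).
  by case: nil => m em; exists m; apply: (ext_nil fB hB).
case: (boolP (odd r)) => odr.
  have sH : (e ^+ r *m G)^T = e ^+ r *m G.
    rewrite trmx_mul hG mulNmx (eG he) -signr_odd odr expr1 scaleN1r //.
  have [u0] := exists_sym_neq0 sH H0; rewrite psiE => hu0.
  have [u [hu iso]] := isotropic_even hG he er odr hu0.
  pose T := chain e r.+1 u.
  have gT s : (s <= r)%N -> form G (u *m e ^+ s) u = if s == r then form G (u *m e ^+ r) u else 0.
    by move=> sr; case: eqP => [->//|/eqP ne]; apply: iso; rewrite ltn_neqAle ne.
  have uT : T *m G *m T^T \in unitmx.
    apply: (@antidiag_unit _ (fun i => (-1) ^+ (r - i) * form G (u *m e ^+ r) u)) => [i|i j].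
      by rewrite mulf_neq0 // signr_eq0.
    rewrite form_chain (psi_shiftr he).
    case: (ltngtP (i + j) r) => h.
    - by rewrite (gT _ (ltnW h)) (ltn_eqF h) mulr0 eqSS (ltn_eqF h).
    - by rewrite (psi0 G er) // mulr0 eqSS (gtn_eqF h).
    have rij := subn_of_add h.
    by rewrite rij h eqxx.
  have [q [B [e' [qt fB hB BT [k [lam [inv [eps [ell jf]]]]]]]]] :=
    finish _ T _ (ltn0Sn _) (chain_stable u er) uT.
  exists k.+1, (fun i => if i is i'.+1 then lam i' else r.+1),
    (fun i => if i is i'.+1 then (inv i').+1 else 0%N),
    (fun i => if i is i'.+1 then eps i' else form G (u *m e ^+ r) u),
    (fun i => if i is i'.+1 then ell i' *m B else u).
  have orth x s : form G (x *m B) (u *m e ^+ s) = 0 by apply: orth_chain er BT.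
  split.
  - by case=> // i /(jf_inv_lt jf).
  - by case=> // i /(jf_invK jf) ->.
  - by case=> // i /(jf_lam_inv jf).
  - by case=> // i /(jf_inv_near jf).
  - by case=> [_|i /(jf_odd jf) ->]; rewrite //= odr.
  - case=> [|i] [|j] // ij jk; last exact: (jf_sorted jf).
    exact: (ext_lam er fB hB jf).
  - by case=> // i /(jf_lam_gt0 jf).
  - by case=> // i /(jf_eps jf).
  - case=> [|i] [|j] s ik jk /=.
    + case: (ltnP r s) => h; first by rewrite (psi0 G er) // eqSS (gtn_eqF h).
      by rewrite gT // eqSS.
    + by rewrite formC // orth oppr0.
    + by rewrite (form_adj he) orth mulr0.
    + by rewrite (ext_form G hB) (jf_gram jf).
  - case=> [|i] ik /=; first by rewrite er mulmx0.
    by rewrite -mulmxA -(ext_pow hB) mulmxA (jf_nil jf) ?mul0mx.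
  by rewrite big_ord_recl /= (jf_total jf) addnC.
have [u0 [v0]] := exists_form_neq0 H0; rewrite psiE => h0.
(* First [v1] is made isotropic with the help of [u0], then [u0] with the help of [v1]; once the
   cross terms are cleared, only the pairing of order [r] between the two chains remains. *)
have [v1 [h1 iv1]] := isotropic_odd hG he er odr h0.
have h1' : form G (v1 *m e ^+ r) u0 != 0 by rewrite (psiC hG he) mulf_neq0 // signr_eq0.
have [u [h2 iu]] := isotropic_odd hG he er odr h1'.
have h2' : form G (u *m e ^+ r) v1 != 0 by rewrite (psiC hG he) mulf_neq0 // signr_eq0.
have [v [huv iv cross]] := orthogonal_cross he er h2' iv1.
have cross' s : (s < r)%N -> form G (v *m e ^+ s) u = 0.
  by move=> sr; rewrite (psiC hG he) cross // mulr0.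
have hvu : form G (v *m e ^+ r) u = - form G (u *m e ^+ r) v.
  by rewrite (psiC hG he) -signr_odd /= odr expr1 mulN1r.
pose T := col_mx (chain e r.+1 u) (chain e r.+1 v).
pose S : 'M[K]_(r.+1 + r.+1) := block_mx (shift_mx _) 0 0 (shift_mx _).
have hT : T *m e = S *m T.
  by rewrite mul_col_mx !chain_stable // mul_block_col !mul0mx addr0 add0r.
have uT : T *m G *m T^T \in unitmx.
  have hA x y : form G (x *m e ^+ r) y != 0 -> (forall s, (s < r)%N -> form G (x *m e ^+ s) y = 0) ->
      chain e r.+1 x *m G *m (chain e r.+1 y)^T \in unitmx.
    move=> hxy hc.
    apply: (@antidiag_unit _ (fun i => (-1) ^+ (r - i) * form G (x *m e ^+ r) y)) => [i|i j].
      by rewrite mulf_neq0 // signr_eq0.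
    rewrite form_chain (psi_shiftr he).
    case: (ltngtP (i + j) r) => h.
    - by rewrite hc // mulr0 eqSS (ltn_eqF h).
    - by rewrite (psi0 G er) // mulr0 eqSS (gtn_eqF h).
    have rij := subn_of_add h.
    by rewrite rij h eqSS eqxx.
  have h0' x : (forall s, form G (x *m e ^+ s) x = 0) ->
      chain e r.+1 x *m G *m (chain e r.+1 x)^T = 0.
    by move=> hx; apply/matrixP => i j; rewrite form_chain (psi_shiftr he) hx mulr0 mxE.
  have uA := hA u v huv cross.
  have uA' : chain e r.+1 v *m G *m (chain e r.+1 u)^T \in unitmx.
    by apply: hA => //; rewrite hvu oppr_eq0.
  rewrite mul_col_mx tr_col_mx mul_col_row (h0' u iu) (h0' v iv).
  rewrite -row_free_unit -kermx_eq0; apply/eqP/row_matrixP => l; rewrite row0.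
  move: (chain e r.+1 u *m _ *m _) (chain e r.+1 v *m _ *m _) uA uA' => A A' uA uA'.
  have: row l (kermx (block_mx 0 A A' 0)) *m block_mx 0 A A' 0 = 0 by rewrite -row_mul mulmx_ker row0.
  move: (row l _) => w; rewrite -(hsubmxK w) mul_row_block !mulmx0 add0r addr0 -row_mx0.
  case/eq_row_mx => e1 e2.
  have -> : lsubmx w = 0 by have := congr1 (fun z => z *m invmx A) e2; rewrite mulmxK // mul0mx.
  have -> : rsubmx w = 0 by have := congr1 (fun z => z *m invmx A') e1; rewrite mulmxK // mul0mx.
  by rewrite row_mx0.
have [q [B [e' [qt fB hB BT [k [lam [inv [eps [ell jf]]]]]]]]] :=
  finish _ T S (isT : (0 < r.+1 + r.+1)%N) hT uT.
have [BTu BTv] : B *m G *m (chain e r.+1 u)^T = 0 /\ B *m G *m (chain e r.+1 v)^T = 0.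
  by move: BT; rewrite tr_col_mx mul_mx_row -row_mx0 => /eq_row_mx.
have orthu x s : form G (x *m B) (u *m e ^+ s) = 0 by apply: orth_chain er BTu.
have orthv x s : form G (x *m B) (v *m e ^+ s) = 0 by apply: orth_chain er BTv.
exists k.+2, (fun i => if i is i'.+2 then lam i' else r.+1),
  (fun i => match i with i'.+2 => (inv i').+2 | 1%N => 0%N | _ => 1%N end),
  (fun i => match i with i'.+2 => eps i' | 1%N => form G (v *m e ^+ r) u | _ => form G (u *m e ^+ r) v end),
  (fun i => match i with i'.+2 => ell i' *m B | 1%N => v | _ => u end).
split.
- by case=> [|[|i]] // /(jf_inv_lt jf).
- by case=> [|[|i]] // /(jf_invK jf) ->.
- by case=> [|[|i]] // /(jf_lam_inv jf).
- by case=> [|[|i]] // /(jf_inv_near jf).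
- by case=> [_|[_|i /(jf_odd jf) ->]]; rewrite //= odr.
- case=> [|[|i]] [|[|j]] // ij jk; try exact: (ext_lam er fB hB jf).
  exact: (jf_sorted jf).
- by case=> [|[|i]] // /(jf_lam_gt0 jf).
- by case=> [|[|i]] //= ik; [rewrite hvu oppr_eq0|exact: (jf_eps jf)].
- case=> [|[|i]] [|[|j]] s ik jk /=.
  + by rewrite iu.
  + rewrite eqSS; case: (ltngtP s r) => h; [exact: cross|exact: (psi0 G er)|by rewrite h].
  + by rewrite formC // orthu oppr0.
  + rewrite eqSS; case: (ltngtP s r) => h; [exact: cross'|exact: (psi0 G er)|by rewrite h].
  + by rewrite iv.
  + by rewrite formC // orthv oppr0.
  + by rewrite (form_adj he) orthu mulr0.
  + by rewrite (form_adj he) orthv mulr0.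
  + by rewrite (ext_form G hB) (jf_gram jf).
- case=> [|[|i]] ik /=; [by rewrite er mulmx0|by rewrite er mulmx0|].
  by rewrite -mulmxA -(ext_pow hB) mulmxA (jf_nil jf) ?mul0mx.
by rewrite !big_ord_recl /= (jf_total jf) -qt addnA addnC.
Qed.

End NormalForm.

(** * The slice *)

Section Theta.
Variable K : fieldType.
Local Notation KK := {poly {poly K}}.

(* Elements of [KK] are read as polynomials in an outer variable [z] with coefficients in
   [K[tau]]; [theta r] substitutes [tau := tau * z ^ r]. *)
Definition theta_in (r : nat) : {poly K} -> KK :=
  horner_eval ('X%:P * 'X^r) \o map_poly (polyC \o polyC).
HB.instance Definition _ r := GRing.RMorphism.on (theta_in r).
Definition theta (r : nat) : KK -> KK := horner_eval 'X \o map_poly (theta_in r).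
HB.instance Definition _ r := GRing.RMorphism.on (theta r).

Lemma theta_in_X r : theta_in r 'X = 'X%:P * 'X^r.
Proof. by rewrite /theta_in /= map_polyX /horner_eval hornerX. Qed.

Lemma theta_in_C r (c : K) : theta_in r c%:P = c%:P%:P.
Proof. by rewrite /theta_in /= map_polyC /horner_eval hornerC. Qed.

Lemma theta_X r : theta r 'X = 'X.
Proof. by rewrite /theta /= map_polyX /horner_eval hornerX. Qed.

Lemma theta_C r (p : {poly K}) : theta r p%:P = theta_in r p.
Proof. by rewrite /theta /= map_polyC /horner_eval hornerC. Qed.

Lemma theta_map r (p : {poly K}) : theta r (map_poly polyC p) = map_poly polyC p.
Proof.
rewrite -(coefK p) poly_def !rmorph_sum; apply: eq_bigr => i _.
by rewrite -mul_polyC !rmorphM /= !map_polyC /= theta_C theta_in_C !rmorphXn /= !map_polyX theta_X.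
Qed.

(** The substitution shears exponents, moving [z ^ a * tau ^ d] to [z ^ (a + r * d) * tau ^ d].
    Divisibility by a power of [z] afterwards is a bound along a line of slope governed by [r] in
    the Newton diagram. *)
Lemma coef_theta r (f : KK) w d :
  (theta r f)`_w`_d = if (r * d <= w)%N then f`_(w - r * d)`_d else 0.
Proof.
rewrite -{1}(coefK f) poly_def rmorph_sum coef_sum coef_sum.
transitivity (\sum_(i < size f) (if (w == i + r * d)%N then f`_i`_d else 0)).
  apply: eq_bigr => i _; rewrite -mul_polyC rmorphM rmorphXn /= theta_C theta_X.
  rewrite -{1}(coefK f`_i) poly_def rmorph_sum mulr_suml !coef_sum.
  transitivity (\sum_(a < size f`_i) (if (a == d :> nat) && (w == i + r * d)%N then f`_i`_a else 0)).
    apply: eq_bigr => a _; rewrite -mul_polyC rmorphM rmorphXn /= theta_in_C theta_in_X.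
    rewrite exprMn -exprM -rmorphXn -!mulrA -exprD coefCM coefCM coefCM coefXn.
    case: eqP => [->|ne]; last first.
      rewrite mulr0 coef0 mulr0; case: eqP => //= ad; case: eqP => // e.
      by case: ne; rewrite e ad addnC.
    rewrite mulr1 coefXn eq_sym; case: eqP => [->|]; rewrite ?mulr0 // mulr1.
    by rewrite addnC eqxx.
  case: (ltnP d (size f`_i)) => h; last first.
    rewrite big1 => [|a _]; last by case: eqP => // ad; move: (ltn_ord a); rewrite ad ltnNge h.
    by rewrite [f`_i`_d]nth_default // if_same.
  rewrite (bigD1 (Ordinal h)) //= eqxx big1 ?addr0 // => a ad.
  by case: eqP => // e; case/eqP: ad; apply: val_inj.
case: leqP => h; last first.
  by rewrite big1 // => i _; case: eqP => // e; move: h; rewrite e ltnNge leq_addl.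
case: (ltnP (w - r * d) (size f)) => h2; last first.
  rewrite big1 => [|i _]; first by rewrite [f`_(w - _)]nth_default // coef0.
  by case: eqP => // e; move: (ltn_ord i) h2; rewrite e addnK => a; rewrite leqNgt a.
rewrite (bigD1 (Ordinal h2)) //= subnK // eqxx big1 ?addr0 // => i ne.
by case: eqP => // e; case/eqP: ne; apply: val_inj; rewrite /= e addnK.
Qed.

End Theta.

Lemma rmorph_slice_entry (R S : comNzRingType) (f : {rmorphism R -> S}) (x u v : R) a (b : bool) :
  f (x ^+ a *+ b - u * v) = f x ^+ a *+ b - f u * f v.
Proof. by rewrite rmorphB rmorphMn rmorphXn rmorphM. Qed.

Lemma theta_entry (K : fieldType) r a (b : bool) (v : {poly {poly K}}) :
  theta r ('X^a *+ b - 'X%:P * v) = 'X^a *+ b - 'X%:P * 'X^r * theta r v.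
Proof.
transitivity (theta r 'X ^+ a *+ b - theta r 'X%:P * theta r v); last by rewrite theta_X theta_C theta_in_X.
exact: (@rmorph_slice_entry _ _ (theta r : {rmorphism {poly {poly K}} -> {poly {poly K}}})).
Qed.

Lemma theta_det (K : fieldType) r k (A : 'M[{poly {poly K}}]_k) :
  theta r (\det A) = \det (map_mx (theta r) A).
Proof. exact: (esym (det_map_mx (theta r : {rmorphism {poly {poly K}} -> {poly {poly K}}}) A)). Qed.

Lemma det_add_delta (R : comNzRingType) k (A : 'M[R]_k) a b (c : R) :
  \det (A + c *: delta_mx a b) = \det A + c * cofactor A a b.
Proof.
rewrite (expand_det_row _ a) [in RHS](expand_det_row A a).
rewrite (eq_bigr (fun j => A a j * cofactor A a j + (if j == b then c * cofactor A a b else 0))).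
  by rewrite big_split -big_mkcond big_pred1_eq.
move=> j _; have -> : cofactor (A + c *: delta_mx a b) a j = cofactor A a j.
  rewrite /cofactor; congr (_ * \det _); apply/matrixP => x y; rewrite !mxE.
  by rewrite eq_sym (negbTE (neq_lift _ _)) mulr0 addr0.
rewrite !mxE eqxx /= mulrDl; case: eqP => [->|_]; first by rewrite mulr1.
by rewrite mulr0 mul0r.
Qed.

(** * Cells of the partition and vanishing of the low components *)

Section Blocks.
Variables (K : closedFieldType) (N : nat) (Om e : 'M[K]_N).
Hypothesis K0 : [pchar K] =i pred0.
Hypothesis uOm : Om \in unitmx.
Hypothesis hOm : Om^T = - Om.
Hypothesis he : sig Om e = e.
Hypothesis hnil : e ^+ N = 0.
Local Notation G := (invmx Om).
Variables (k : nat) (lam inv : nat -> nat) (eps : nat -> K) (ell : nat -> 'rV[K]_N).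
Hypothesis jf : jordan_form G e k lam inv eps ell.

Lemma G_skew : G^T = - G.
Proof.
rewrite trmx_inv hOm; apply: (can_inj (mulmxK uOm)); rewrite mulNmx mulVmx //.
have u' : - Om \in unitmx by rewrite -hOm unitmx_tr.
by apply: oppr_inj; rewrite opprK -mulmxN mulVmx.
Qed.

Lemma e_adj : e *m G = - (G *m e^T).
Proof. by rewrite -{1}he /sig mulNmx mulmxK. Qed.

Definition Lam m := (\sum_(0 <= i < m) lam i)%N.

Lemma LamS m : Lam m.+1 = (Lam m + lam m)%N.
Proof. by rewrite /Lam big_nat_recr. Qed.

Lemma Lam0 : Lam 0 = 0%N.
Proof. by rewrite /Lam big_geq. Qed.

Lemma Lam_k : Lam k = N.
Proof. by rewrite /Lam big_mkord (jf_total jf). Qed.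

Lemma leq_Lam a b : (a <= b)%N -> (Lam a <= Lam b)%N.
Proof.
elim: b => [|b IH]; first by rewrite leqn0 => /eqP->.
by rewrite leq_eqVlt => /orP[/eqP->//|]; rewrite ltnS => /IH h; rewrite LamS (leq_trans h) // leq_addr.
Qed.

(* [dg j] is the degree of the lowest component of [Delta j (e + x)]. *)
Definition dg j := find (fun m => j <= Lam m)%N (iota 0 k.+1).

Lemma dgP j : (0 < j <= N)%N -> [/\ (0 < dg j)%N, (dg j <= k)%N, (Lam (dg j).-1 < j)%N & (j <= Lam (dg j))%N].
Proof.
case/andP => j0 jN.
have hs : has (fun m => j <= Lam m)%N (iota 0 k.+1).
  by apply/hasP; exists k; rewrite ?mem_iota ?Lam_k //= add0n.
have lt : (dg j < k.+1)%N by have := hs; rewrite has_find size_iota.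
have h1 := nth_find 0%N hs; rewrite nth_iota // add0n in h1.
have h0 : (0 < dg j)%N.
  by rewrite lt0n; apply: contraTneq j0 => e0; rewrite -leqNgt -Lam0 -e0.
split=> //; rewrite ltnNge; apply/negP => h2.
have lt1 : ((dg j).-1 < dg j)%N by rewrite prednK.
have := before_find 0%N lt1; rewrite nth_iota; last by rewrite (leq_ltn_trans (leq_pred _)).
by rewrite add0n h2.
Qed.

Lemma dg_uniq j m : (Lam m < j)%N -> (j <= Lam m.+1)%N -> (m < k)%N -> dg j = m.+1.
Proof.
move=> h1 h2 mk.
have jN : (0 < j <= N)%N.
  by rewrite (leq_ltn_trans (leq0n _) h1) (leq_trans h2) // -Lam_k leq_Lam.
have [d0 dk g1 g2] := dgP jN.
apply/eqP; rewrite eqn_leq; apply/andP; split; rewrite leqNgt; apply/negP => h.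
  have := leq_Lam (_ : m.+1 <= (dg j).-1)%N; rewrite -ltnS prednK // => /(_ h).
  by move/(leq_trans h2); rewrite leqNgt g1.
have := leq_Lam (_ : dg j <= m)%N; rewrite -ltnS => /(_ h).
by move/(leq_trans g2); rewrite leqNgt h1.
Qed.

Lemma leq_dg i j : (0 < i)%N -> (i <= j <= N)%N -> (dg i <= dg j)%N.
Proof.
move=> i0 /andP[ij jN].
have hi : (0 < i <= N)%N by rewrite i0 (leq_trans ij).
have hj : (0 < j <= N)%N by rewrite (leq_trans i0).
have [_ _ g1 _] := dgP hi; have [d0 _ _ g2] := dgP hj.
rewrite leqNgt; apply/negP => h.
have h' : (dg j <= (dg i).-1)%N by rewrite -ltnS prednK // (leq_ltn_trans _ h).
by have := leq_trans g2 (leq_Lam h'); rewrite leqNgt (leq_trans g1).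
Qed.

(* The cells [(i, p)], [p < lam i], of the partition are numbered by [c : 'I_N] through
   [c.+1 = Lam i.+1 - p]. *)
Definition bk (c : nat) := (dg c.+1).-1.
Definition pk (c : nat) := (Lam (dg c.+1) - c.+1)%N.

Lemma bkP (c : 'I_N) : [/\ (bk c < k)%N, (pk c < lam (bk c))%N, dg c.+1 = (bk c).+1 &
  (pk c + c.+1 = Lam (bk c).+1)%N].
Proof.
have hc : (0 < c.+1 <= N)%N by rewrite ltn_ord.
have [d0 dk g1 g2] := dgP hc.
have ed : dg c.+1 = (bk c).+1 by rewrite /bk prednK.
rewrite /pk ed in g1 g2 dk *; split=> //; last by rewrite subnK.
by move: g1 g2; rewrite /= LamS; lia.
Qed.

Lemma cell_exists i p : (i < k)%N -> (p < lam i)%N -> exists c : 'I_N, bk c = i /\ pk c = p.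
Proof.
move=> ik pl.
have h2 : (Lam i.+1 - p <= N)%N by rewrite (leq_trans (leq_subr _ _)) // -Lam_k leq_Lam.
have h1 : (0 < Lam i.+1 - p)%N by rewrite LamS; lia.
have h3 : ((Lam i.+1 - p).-1 < N)%N by rewrite prednK.
exists (Ordinal h3); rewrite /bk /pk /= prednK //.
have -> : dg (Lam i.+1 - p) = i.+1 by apply: dg_uniq => //; rewrite ?leq_subr // LamS; lia.
by split=> //; rewrite subKn // LamS; lia.
Qed.

Lemma cell_inj (c c' : 'I_N) : bk c = bk c' -> pk c = pk c' -> c = c'.
Proof.
move=> eb ep; apply: val_inj; have [_ _ _ h] := bkP c; have [_ _ _ h'] := bkP c'.
by apply/eqP; rewrite -eqSS -(eqn_add2l (pk c)) h eb -h' ep.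
Qed.

(** The column dual to the end of chain [b]: by [ell_rr], [ell i *m e ^+ s *m rr b] is 1 if [i = b]
    and [s.+1 = lam b], and 0 otherwise. The index [inv b] appears because chain [b] pairs with
    chain [inv b]. *)
Definition rr b : 'cV[K]_N := (eps b)^-1 *: (G *m (ell (inv b))^T).

Lemma inv_eq i j : (i < k)%N -> (j < k)%N -> (inv i == inv j) = (i == j).
Proof.
move=> ik jk; apply/eqP/eqP => [h|-> //].
by rewrite -(jf_invK jf ik) h (jf_invK jf jk).
Qed.

Lemma ell_rr i b s : (i < k)%N -> (b < k)%N ->
  ell i *m e ^+ s *m rr b = ((i == b) && (s.+1 == lam b))%:R%:M.
Proof.
move=> ik bk'; rewrite [LHS]mx11_scalar; congr (_%:M).
rewrite /rr -scalemxAr mxE mulmxA.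
have := jf_gram jf s ik (jf_inv_lt jf bk'); rewrite /form => ->.
rewrite inv_eq // eq_sym; case: eqP => [->|_] /=; last by rewrite mulr0.
by case: eqP => _; rewrite ?mulr0 // mulVf // (jf_eps jf).
Qed.

Definition Bs : 'M[K]_N := \matrix_(c < N) (ell (bk c) *m e ^+ pk c).
(** Its columns form the basis dual to the Jordan basis of rows [Bs]. *)
Definition Rs : 'M[K]_N := (\matrix_(c < N) (e ^+ (lam (bk c) - (pk c).+1) *m rr (bk c))^T)^T.

Lemma BsRs : Bs *m Rs = 1%:M.
Proof.
apply/matrixP => c c'.
have -> : (Bs *m Rs) c c' = (row c Bs *m col c' Rs) 0 0.
  by rewrite [LHS]mxE [RHS]mxE; apply: eq_bigr => l _; rewrite [row _ _ _ _]mxE [col _ _ _ _]mxE.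
have -> : row c Bs = ell (bk c) *m e ^+ pk c by rewrite rowK.
have -> : col c' Rs = e ^+ (lam (bk c') - (pk c').+1) *m rr (bk c').
  by apply/matrixP => x y; rewrite !ord1 /Rs [LHS]mxE mxE mxE mxE.
rewrite mulmxA -(mulmxA (ell _)) -[e ^+ _ *m e ^+ _]/(e ^+ _ * e ^+ _) -exprD.
have [b1 p1 _ _] := bkP c; have [b2 p2 _ _] := bkP c'.
rewrite ell_rr // !mxE mulr1n; congr (_%:R); congr nat_of_bool.
apply/andP/eqP => [[/eqP eb /eqP ep]|<-]; last first.
  by split=> //; apply/eqP; move: p1; lia.
by apply: cell_inj => //; move: ep; rewrite -eb in p2 *; lia.
Qed.

Lemma RsBs : Rs *m Bs = 1%:M.
Proof. exact: mulmx1C BsRs. Qed.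

Lemma decomp (x : 'M[K]_N) : x = \sum_(c < N) (x *m col c Rs) *m ell (bk c) *m e ^+ pk c.
Proof.
rewrite -{1}(mulmx1 x) -RsBs mulmxA; apply/matrixP => i j.
rewrite mxE summxE; apply: eq_bigr => c _.
rewrite -mulmxA [RHS]mxE big_ord1 [Bs _ _]mxE; congr (_ * _).
by rewrite [LHS]mxE [RHS]mxE; apply: eq_bigr => l _; rewrite [col _ _ _ _]mxE.
Qed.

Definition L : 'M[K]_(k, N) := \matrix_(i < k) ell i.

Lemma comm_pow_image (x : 'M[K]_N) s : exists y, x *m e ^+ s = e ^+ s *m x + (y *m e - e *m y).
Proof.
elim: s => [|s [y hy]].
  by exists 0; rewrite expr0 -[1]/(1%:M) mulmx1 mul1mx mul0mx mulmx0 subrr addr0.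
exists (y *m e + e ^+ s *m x).
have -> : x *m e ^+ s.+1 = x *m e ^+ s *m e by rewrite exprSr -mulmxA.
have -> : e ^+ s.+1 *m x = e *m (e ^+ s *m x) by rewrite exprS mulmxA.
rewrite hy !mulmxDl !mulmxDr mulNmx !mulmxA.
move: (y *m e *m e) (e *m y *m e) (e ^+ s *m x *m e) (e *m e ^+ s *m x) => A1 A2 A3 A4.
by apply/matrixP => i j; rewrite !mxE; ring.
Qed.

(** Expanding [x] in the Jordan basis gives terms ending in [ell b *m e ^+ p]. Modulo commutators
    with [e] the power moves to the far left, and what is left has its rows spanned by the [ell b]
    alone. *)
Lemma slice_decomp (x : 'M[K]_N) : exists y U, x = U *m L + (y *m e - e *m y).
Proof.
have [f hf] := fin_all_exists (fun c : 'I_N => comm_pow_image ((x *m col c Rs) *m ell (bk c)) (pk c)).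
have hL (c : 'I_N) : ell (bk c) = row (Ordinal (let: And4 h _ _ _ := bkP c in h)) L by rewrite rowK.
exists (\sum_(c < N) f c), (\sum_(c < N) e ^+ pk c *m (x *m col c Rs) *m delta_mx 0 (Ordinal (let: And4 h _ _ _ := bkP c in h))).
rewrite {1}(decomp x) mulmx_suml mulmx_suml mulmx_sumr -sumrB -big_split; apply: eq_bigr => c _.
by rewrite hf; congr (_ + _); rewrite [in LHS]hL rowE !mulmxA.
Qed.

(* [\det (SM (Yof U))] is [\det (z - e - tau U L)]. *)
Definition SM (Y : 'I_k -> 'I_k -> {poly K}) : 'M[{poly {poly K}}]_k :=
  \matrix_(i, j) ('X^(lam i) *+ (i == j) - 'X%:P * map_poly polyC (Y i j)).

Definition Yof (U : 'M[K]_(N, k)) (i j : 'I_k) : {poly K} :=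
  \sum_(s < lam i) ((ell i *m e ^+ s *m U) 0 j) *: 'X^(lam i - s.+1).

Lemma F_slice U j d : (j <= N)%N ->
  F e j d (U *m L) = (-1) ^+ j * ((\det (SM (Yof U)))`_(N - j))`_d.
Proof.
move=> jN.
pose P p q (A : 'M[K]_(p, q)) := map_mx (@polyC K) A.
have hc : char_poly (P _ _ e) = 'X^N.
  by rewrite -map_char_poly char_poly_nilpotent // map_polyXn.
have h1 : (P _ _ e) ^+ N = 0 by rewrite /P -rmorphXn /= hnil map_mx0.
have h2 (i : 'I_k) : row i (P _ _ L) *m (P _ _ e) ^+ lam i = 0.
  by rewrite /P -rmorphXn /= -map_row -map_mxM rowK (jf_nil jf) ?map_mx0.
have h3 : (\sum_(i < k) lam i = N)%N := jf_total jf.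
have := slice_char_poly ('X *: P _ _ U) h1 hc h2 h3.
have -> : slice_mx (P _ _ e) (P _ _ L) ('X *: P _ _ U) (fun i : 'I_k => lam i) = SM (Yof U).
  apply/matrixP => i l; rewrite !mxE; congr (_ - _).
  rewrite /slice_poly /Yof rmorph_sum mulr_sumr; apply: eq_bigr => s _.
  rewrite -!mul_polyC rmorphM /= map_polyC map_polyXn mulrA -rmorphM /=; congr (_%:P * _).
  by rewrite -scalemxAr mxE /P -rmorphXn /= -map_row -!map_mxM mxE rowK.
move=> <-; have -> : 'X *: P _ _ U *m P _ _ L = 'X *: P _ _ (U *m L).
  by rewrite -scalemxAl /P map_mxM.
rewrite coef_char_poly // -[in RHS](rmorphN1 polyC) -rmorphXn coefCM mulrA -exprD addnn.
by rewrite -[(-1) ^+ j.*2]signr_odd odd_double mul1r.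
Qed.

Lemma theta_SM r Y i j : theta r (SM Y i j) =
  'X^(lam i) *+ (i == j) - 'X%:P * 'X^r * map_poly polyC (Y i j).
Proof.
have -> : SM Y i j = 'X^(lam i) *+ (i == j) - 'X%:P * map_poly polyC (Y i j) by rewrite mxE.
by rewrite theta_entry theta_map.
Qed.

(** The power of [z] that comes out of the rows of [SM Y] after [tau := tau * z ^ r]: row [i] is
    divisible by the smaller of [z ^ lam i] and [z ^ r]. *)
Definition kap r := (\sum_(i < k) minn (lam i) r)%N.

Lemma kapE m : (0 < m <= k)%N -> (kap (lam m.-1) + Lam m = m * lam m.-1 + N)%N.
Proof.
case/andP => m0 mk.
have -> : kap (lam m.-1) = (\sum_(0 <= i < k) minn (lam i) (lam m.-1))%N by rewrite big_mkord.
have h1 : (\sum_(0 <= i < m) minn (lam i) (lam m.-1) = m * lam m.-1)%N.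
  rewrite -[X in (X * _)%N]subn0 -sum_nat_const_nat big_nat_cond [RHS]big_nat_cond.
  apply: eq_bigr => i /andP[/andP[_ im] _]; apply/minn_idPr/(jf_sorted jf); first by rewrite -ltnS prednK.
  by rewrite prednK.
have h2 : (\sum_(m <= i < k) minn (lam i) (lam m.-1) = \sum_(m <= i < k) lam i)%N.
  rewrite big_nat_cond [RHS]big_nat_cond; apply: eq_bigr => i /andP[/andP[mi ik] _].
  by apply/minn_idPl/(jf_sorted jf) => //; rewrite (leq_trans (leq_pred _)).
rewrite -Lam_k /Lam (big_cat_nat (n := m)) //= h1 h2 [in RHS](big_cat_nat (n := m)) //= -addnA.
by congr (_ + _)%N; rewrite addnC.
Qed.

Lemma coef_SM_low r Y q d : (q + r * d < kap r)%N -> ((\det (SM Y))`_q)`_d = 0.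
Proof.
move=> h.
have := coef_theta r (\det (SM Y)) (q + r * d) d; rewrite leq_addl addnK => <-.
rewrite theta_det.
have -> : map_mx (theta r) (SM Y) = diag_mx (\row_(i < k) 'X^(minn (lam i) r)) *m
   \matrix_(i < k, j < k) ('X^(lam i - minn (lam i) r) *+ (i == j)
     - 'X%:P * 'X^(r - minn (lam i) r) * map_poly polyC (Y i j)).
  apply/matrixP => i j; rewrite mul_diag_mx [LHS]mxE theta_SM !mxE mulrBr mulrnAr -exprD.
  rewrite subnKC ?geq_minl //; congr (_ - _).
  by rewrite -{1}(subnKC (geq_minr (lam i) r)) exprD; ring.
rewrite det_mulmx det_diag; under eq_bigr do rewrite mxE; rewrite prodrXr.
by rewrite mulrC coefMXn h coef0.
Qed.

(** The slope [r = lam (dg j).-1] is the length of the chain into which [j] falls. By [kapE], the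
    bound [N - j + r * d < kap r] at the extreme value [d = (dg j).-1] amounts to
    [Lam (dg j).-1 < j]. *)
Lemma F_low_slice U j d : (0 < j <= N)%N -> (d < dg j)%N -> F e j d (U *m L) = 0.
Proof.
move=> jN dj; have [d0 dk g1 g2] := dgP jN; case/andP: jN => j0 jN.
rewrite F_slice // (@coef_SM_low (lam (dg j).-1)) ?mulr0 //.
have hk := kapE (_ : 0 < dg j <= k)%N; rewrite d0 dk in hk; have := hk isT.
have := LamS (dg j).-1; rewrite prednK // => eL.
have : (lam (dg j).-1 * d <= lam (dg j).-1 * (dg j).-1)%N by rewrite leq_mul2l -ltnS prednK // dj orbT.
have : (dg j * lam (dg j).-1 = lam (dg j).-1 * (dg j).-1 + lam (dg j).-1)%N.
  by rewrite -{1}(prednK d0) mulSn mulnC addnC.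
move: (dg j * _)%N (lam _ * d)%N (lam _ * _.-1)%N => a b c0; lia.
Qed.

(** Induction on [d], because the translation invariance that reduces [x] to the slice is available
    only once the smaller components are known to vanish. *)
Lemma F_low j d x : (0 < j <= N)%N -> (d < dg j)%N -> F e j d x = 0.
Proof.
move=> hj; elim/ltn_ind: d x => d IH x dj.
have [y [U ->]] := slice_decomp x.
rewrite F_transl //; first exact: F_low_slice.
  by case/andP: hj.
by move=> d' x' dd; apply: IH => //; apply: ltn_trans dd dj.
Qed.

End Blocks.

(** * The two points *)

Section Hessenberg.
Variable R : comNzRingType.

(** Entries are indexed by [nat], so that deleting rows and columns is a shift of indices without
    casts between ordinals. *)
Definition ndet (f : nat -> nat -> R) n := \det (\matrix_(i < n, j < n) f i j).

Lemma eq_ndet f g n : (forall i j, (i < n)%N -> (j < n)%N -> f i j = g i j) -> ndet f n = ndet g n.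
Proof. by move=> h; congr (\det _); apply/matrixP => i j; rewrite !mxE h. Qed.

Lemma ndet_col0 f n : (forall i, (i < n)%N -> f i.+1 0%N = 0) ->
  ndet f n.+1 = f 0%N 0%N * ndet (fun i j => f i.+1 j.+1) n.
Proof.
move=> h; rewrite /ndet (expand_det_col _ ord0) big_ord_recl big1 ?addr0 => [|i _]; last first.
  by rewrite mxE /= h // mul0r.
rewrite mxE /cofactor /= expr0 mul1r; congr (_ * \det _).
by apply/matrixP => i j; rewrite !mxE.
Qed.

(** Deleting row 0 and column [b] of an upper Hessenberg matrix leaves a block triangular one: in
    its first [b] columns the old subdiagonal is the diagonal, and the other diagonal block is the
    trailing part after index [b]. *)
Lemma hess_minor f b n : (b <= n)%N -> (forall i j, (j.+1 < i)%N -> (i <= n)%N -> f i j = 0) ->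
  ndet (fun i j => f i.+1 (bump b j)) n =
  (\prod_(i < b) f i.+1 i) * ndet (fun i j => f (i + b.+1)%N (j + b.+1)%N) (n - b).
Proof.
elim: b f n => [|b IH] f n bn hf.
  rewrite big_ord0 mul1r subn0; apply: eq_ndet => i j _ _.
  by rewrite !addn1.
case: n bn hf => [//|n] bn hf.
rewrite ndet_col0 => [|i hi]; last by rewrite hf.
rewrite big_ord_recl -mulrA; congr (_ * _).
have IH' := IH (fun i j => f i.+1 j.+1) n bn.
transitivity (ndet (fun i j => f i.+2 (bump b j).+1) n).
  by apply: eq_ndet => i j _ _; rewrite bumpS.
rewrite IH' => [|i j h1 h2]; last exact: hf.
congr (_ * _); rewrite subSS; apply: eq_ndet => i j _ _.
by rewrite !addnS.
Qed.

Lemma ndet_diag (d : nat -> R) n : ndet (fun i j => d i *+ (i == j)) n = \prod_(i < n) d i.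
Proof.
transitivity (\prod_(i < n) (\row_(i < n) d i) 0 i); last by apply: eq_bigr => i _; rewrite mxE.
by rewrite -det_diag; congr (\det _); apply/matrixP => i j; rewrite !mxE.
Qed.

End Hessenberg.

Section TauLow.
Variable K : closedFieldType.

(* [ev0] substitutes [tau := 0]. *)
Definition ev0 : {poly {poly K}} -> {poly K} := map_poly (horner_eval 0).
HB.instance Definition _ := GRing.RMorphism.on ev0.

Lemma coef_ev0 f w : (ev0 f)`_w = f`_w`_0.
Proof. by rewrite coef_map /= /horner_eval horner_coef0. Qed.

Lemma ev0_entry a (b : bool) v : ev0 ('X^a *+ b - 'X%:P * v) = 'X^a *+ b.
Proof.
transitivity (ev0 'X ^+ a *+ b - ev0 'X%:P * ev0 v).
  exact: (@rmorph_slice_entry _ _ (ev0 : {rmorphism {poly {poly K}} -> {poly K}})).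
by rewrite /ev0 map_polyX map_polyC /= /horner_eval hornerX mul0r subr0.
Qed.

Lemma ev0_ndet f n : ev0 (ndet f n) = ndet (fun i j => ev0 (f i j)) n.
Proof.
transitivity (\det (map_mx ev0 (\matrix_(i < n, j < n) f i j))).
  exact: (esym (det_map_mx (ev0 : {rmorphism {poly {poly K}} -> {poly K}}) _)).
by congr (\det _); apply/matrixP => i j; rewrite !mxE.
Qed.

(** Each subdiagonal entry is [- tau] times a constant, so the minor is [tau ^ b] times a trailing
    minor. Up to order [b] in [tau] the latter counts only at [tau = 0], where it is diagonal with
    entries [z ^ lam i]. *)
Lemma cofactor_hess k lam (Y : 'I_k -> 'I_k -> {poly K}) (C : nat -> nat -> K) (a b : 'I_k) p w d :
  (forall i j, Y i j = (C i j)%:P) -> a = 0%N :> nat ->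
  (forall i j, (j.+1 < i)%N -> (i < k)%N -> C i j = 0) -> (d <= b)%N ->
  ((cofactor (SM lam Y) a b * 'X^p)`_w)`_d =
    if (d == b) && (w == p + \sum_(b.+1 <= i < k) lam i)%N then \prod_(i < b) C i.+1 i else 0.
Proof.
move=> hY a0 hC db.
pose h (i j : nat) : {poly {poly K}} := 'X^(lam i) *+ (i == j) - 'X%:P * (C i j)%:P%:P.
have k0 : (0 < k)%N by apply: leq_ltn_trans (ltn_ord a).
pose T := ndet (fun i j => h (i + b.+1)%N (j + b.+1)%N) (k.-1 - b).
have -> : cofactor (SM lam Y) a b = ('X^b)%:P * ((\prod_(i < b) C i.+1 i)%:P%:P * T).
  rewrite /cofactor a0 add0n.
  have -> : \det (row' a (col' b (SM lam Y))) = ndet (fun i j => h i.+1 (bump b j)) k.-1.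
    congr (\det _); apply/matrixP => i j; rewrite !mxE /h hY map_polyC /= a0.
    by rewrite /bump leq0n /= -val_eqE /= a0 /bump leq0n.
  rewrite hess_minor; first last.
  - move=> i j ji ik; rewrite /h hC ?mulr0 ?subr0; last by lia.
      by rewrite (_ : (i == j) = false) ?mulr0n //; apply/eqP; lia.
    by [].
  - by rewrite -ltnS prednK.
  rewrite -/T !mulrA; congr (_ * _).
  have -> : \prod_(i < b) h i.+1 i = (-1) ^+ b * \prod_(i < b) ('X%:P * (C i.+1 i)%:P%:P).
    rewrite -[b in (-1) ^+ b]card_ord -prodr_const -big_split; apply: eq_bigr => i _.
    change (h i.+1 i = (-1) * ('X%:P * (C i.+1 i)%:P%:P)).
    by rewrite mulN1r /h (gtn_eqF (ltnSn i)) mulr0n sub0r.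
  rewrite mulrA -exprMn mulN1r opprK expr1n mul1r big_split prodr_const card_ord.
  by rewrite -rmorphXn -!rmorph_prod.
rewrite -!mulrA coefCM coefXnM; case: (ltnP d b) => [lt|ge]; first by rewrite (ltn_eqF lt).
have -> : d = b by apply/eqP; rewrite eqn_leq db.
rewrite subnn eqxx /= coefCM coefCM -coef_ev0.
have -> : ev0 (T * 'X^p) = ev0 T * 'X^p.
  by rewrite rmorphM rmorphXn /= /ev0 map_polyX.
have -> : ev0 T = 'X^(\sum_(b.+1 <= i < k) lam i).
  rewrite /T ev0_ndet (eq_ndet (g := fun i j => 'X^(lam (i + b.+1)%N) *+ (i == j))) => [|i j _ _].
    have -> : (\sum_(b.+1 <= i < k) lam i = \sum_(i < k.-1 - b) lam (i + b.+1))%N.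
      by rewrite -{1}(add0n b.+1) big_addn big_mkord; have -> : (k - b.+1 = k.-1 - b)%N by lia.
    by rewrite ndet_diag prodrXr.
  by rewrite ev0_entry eqn_add2r.
rewrite -exprD coefXn addnC.
by case: eqP => _; rewrite ?mulr1 ?mulr0.
Qed.

End TauLow.

Lemma prod_window (R : comNzRingType) (I : Type) (r : seq I) (P : pred I) (f : I -> {poly R}) (lo hi : I -> nat) d :
  (forall i d, (d < lo i)%N || (hi i < d)%N -> (f i)`_d = 0) ->
  (d < \sum_(i <- r | P i) lo i)%N || (\sum_(i <- r | P i) hi i < d)%N ->
  (\prod_(i <- r | P i) f i)`_d = 0.
Proof.
move=> hf; elim: r d => [|i r IH] d.
  by rewrite !big_nil ltn0 /= coef1; case: d.
rewrite !big_cons; case: (P i); last exact: IH.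
move=> h; rewrite coefM big1 // => j _; have jd := ltn_ord j.
case hj: ((j < lo i) || (hi i < j))%N; first by rewrite hf // mul0r.
rewrite IH ?mulr0 //; move: h hj jd.
by move: (\sum_(i0 <- r | P i0) lo i0)%N (\sum_(i0 <- r | P i0) hi i0)%N => u v; lia.
Qed.

Lemma sum_ord_ltn k m : (m <= k)%N -> (\sum_(l < k) (l < m) = m)%N.
Proof.
move=> mk; transitivity (\sum_(l < k | (l < m)%N) 1)%N.
  by rewrite [RHS]big_mkcond; apply: eq_bigr => l _; case: ltnP.
by rewrite -(big_ord_widen k (fun=> 1%N)) // sum1_card card_ord.
Qed.

Section Diagonal.
Variables (K : closedFieldType) (k : nat) (lam : nat -> nat).
Variable (a : nat -> K).

Definition dfac l : {poly {poly K}} := 'X^(lam l) - 'X%:P * (a l)%:P%:P.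

Lemma cofactor_diag (Y : 'I_k -> 'I_k -> {poly K}) (b : 'I_k) :
  (forall i j, Y i j = (a i *+ (i == j))%:P) ->
  cofactor (SM lam Y) b b = \prod_(l < k | l != b) dfac l.
Proof.
move=> hY.
(* The determinant is affine in the entry at [(b, b)], with the cofactor as slope; the two values of
   [c] used below make this entry 1 and 0. *)
have hD c : \det (SM lam Y + c *: delta_mx b b) = (dfac b + c) * \prod_(l < k | l != b) dfac l.
  have -> : SM lam Y + c *: delta_mx b b = diag_mx (\row_(l < k) (if l == b then dfac b + c else dfac l)).
    apply/matrixP => i j; rewrite [LHS]mxE [X in X + _]mxE [X in _ + X]mxE [delta_mx _ _ _ _]mxE.
    rewrite [RHS]mxE [in RHS]mxE hY /dfac map_polyC /=.
    case: (eqVneq i j) => [<-|ne] /=; last first.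
      rewrite !mulr0n !rmorph0 mulr0 subr0 add0r.
      by case: (eqVneq i b) => [eb|_] /=; rewrite ?mulr0 // -eb eq_sym (negbTE ne) mulr0.
    by rewrite !mulr1n andbb; case: (eqVneq i b) => [->|_]; rewrite ?mulr1 ?mulr0 ?addr0.
  rewrite det_diag (bigD1 b) //= mxE eqxx; congr (_ * _); apply: eq_bigr => l lb.
  by rewrite mxE (negbTE lb).
have := hD (1 - dfac b); have := hD (- dfac b); rewrite !det_add_delta subrr mul0r.
move=> h1; rewrite [dfac b + _]addrC subrK mul1r => <-.
by rewrite mulrBl mul1r addrCA -mulNr h1 addr0.
Qed.

(* What is left of [dfac l] after [tau := tau * z ^ r], division by the power of [z] and [z := 0]. *)
Definition dlow r l : {poly K} := (lam l <= r)%N%:R - (r <= lam l)%N%:R *: (a l *: 'X).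

Lemma theta_dprod r (P : pred 'I_k) q :
  theta r ((\prod_(l < k | P l) dfac l) * 'X^q) =
  (\prod_(l < k | P l) ('X^(lam l) - 'X%:P * 'X^r * (a l)%:P%:P)) * 'X^q.
Proof.
transitivity ((\prod_(l < k | P l) theta r (dfac l)) * theta r 'X ^+ q).
  pose th : {rmorphism {poly {poly K}} -> {poly {poly K}}} := theta r.
  by have := (rmorphM th (\prod_(l < k | P l) dfac l) ('X^q)); rewrite rmorph_prod rmorphXn.
rewrite theta_X; congr (_ * _); apply: eq_bigr => l _.
by have := theta_entry r (lam l) true (a l)%:P%:P; rewrite theta_C theta_in_C.
Qed.

(** Only the factor [b] is missing, so after the shear the product has lowest exponent at least
    [kap - minn (lam b) r + q] in [z]. The hypotheses put [w] at or below this exponent; at it, the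
    coefficient is found by setting [z := 0] in the remaining factors, which become the [dlow]. *)
Lemma coef_theta_dprod r (b : 'I_k) q w :
  (w + r <= kap k lam r + q)%N -> (r <= lam b)%N || (w + minn (lam b) r < kap k lam r + q)%N ->
  (theta r ((\prod_(l < k | l != b) dfac l) * 'X^q))`_w =
  if (w + r == kap k lam r + q)%N && (r <= lam b)%N then \prod_(l < k | l != b) dlow r l else 0.
Proof.
move=> hw hb; rewrite theta_dprod.
pose Q l : {poly {poly K}} := 'X^(lam l - minn (lam l) r) - 'X%:P * 'X^(r - minn (lam l) r) * (a l)%:P%:P.
have -> : \prod_(l < k | l != b) ('X^(lam l) - 'X%:P * 'X^r * (a l)%:P%:P) =
    'X^(\sum_(l < k | l != b) minn (lam l) r) * \prod_(l < k | l != b) Q l.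
  rewrite -prodrXr -big_split; apply: eq_bigr => l _; rewrite /Q.
  set m := minn (lam l) r.
  have e1 : 'X^(lam l) = 'X^m * 'X^(lam l - m) :> {poly {poly K}} by rewrite -exprD subnKC ?geq_minl.
  have e2 : 'X^r = 'X^m * 'X^(r - m) :> {poly {poly K}} by rewrite -exprD subnKC ?geq_minr.
  change ('X^(lam l) - 'X%:P * 'X^r * (a l)%:P%:P =
     'X^m * ('X^(lam l - m) - 'X%:P * 'X^(r - m) * (a l)%:P%:P)).
  by rewrite e1 {}e2; ring.
have hk : (kap k lam r = minn (lam b) r + \sum_(l < k | l != b) minn (lam l) r)%N.
  by rewrite /kap (bigD1 b).
rewrite mulrAC -exprD coefXnM.
move: hk hw hb; set S := (\sum_(l < k | l != b) _)%N => hk hw hb.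
case: ifP => h1.
  case: ifP => // /andP[/eqP e1 e2]; move: h1; rewrite (minn_idPr e2) in hk; lia.
have e2 : (r <= lam b)%N by move: hb h1; rewrite hk; lia.
rewrite (minn_idPr e2) in hk.
have e1 : (w = S + q)%N by lia.
have -> : (w + r == kap k lam r + q)%N by apply/eqP; lia.
rewrite e2 e1 subnn -horner_coef0 horner_prod; apply: eq_bigr => l _.
rewrite /Q /dlow !hornerE.
case: (ltngtP (lam l) r) => h.
- rewrite subnn expr0 scale0r.
  have -> : (r - lam l = (r - lam l).-1.+1)%N by lia.
  by rewrite exprS !mul0r mulr0 mul0r.
- rewrite subnn expr0 mulr1 scale1r.
  have -> : (lam l - r = (lam l - r).-1.+1)%N by lia.
  by rewrite exprS mul0r -mul_polyC mulrC.
by rewrite h subnn expr0 mulr1 scale1r -mul_polyC mulrC.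
Qed.

Lemma coef_dlow r l d : (d < (r < lam l))%N || ((r <= lam l) < d)%N -> (dlow r l)`_d = 0.
Proof.
rewrite /dlow coefB coefZ coefZ coefX.
case: (ltngtP (lam l) r) => h; rewrite /= ?scale0r ?mul0r ?subr0 ?coef1 ?coef0 ?sub0r.
- by case: d.
- by case: d => [|[|d]] //= _; rewrite mulr0 mulr0 oppr0.
by case: d => [|[|d]] //= _; rewrite !mulr0 subr0.
Qed.

Lemma coef_dlow_prod r (P : pred 'I_k) d :
  (d < \sum_(l < k | P l) (r < lam l))%N || (\sum_(l < k | P l) (r <= lam l) < d)%N ->
  (\prod_(l < k | P l) dlow r l)`_d = 0.
Proof.
apply: (@prod_window _ 'I_k _ _ (fun l => dlow r l) (fun l => nat_of_bool (r < lam l)%N)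
  (fun l => nat_of_bool (r <= lam l)%N)) => l d' h.
exact: coef_dlow.
Qed.

End Diagonal.

(** * Derivatives of the lowest components at the two points *)

Section Points.
Variables (K : closedFieldType) (N : nat) (Om e : 'M[K]_N).
Hypothesis K0 : [pchar K] =i pred0.
Hypothesis uOm : Om \in unitmx.
Hypothesis hOm : Om^T = - Om.
Hypothesis he : sig Om e = e.
Hypothesis hnil : e ^+ N = 0.
Local Notation G := (invmx Om).
Variables (k : nat) (lam inv : nat -> nat) (eps : nat -> K) (ell : nat -> 'rV[K]_N).
Hypothesis jf : jordan_form G e k lam inv eps ell.
Local Notation L := (L k ell).
Local Notation Lam := (Lam lam).
Local Notation dg := (dg k lam).
Local Notation bk := (bk k lam).
Local Notation pk := (pk k lam).
Local Notation rr := (rr Om inv eps ell).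
Local Notation SM := (SM lam).
Local Notation Yof := (Yof e lam ell).

Definition dF j (x v : 'M[K]_N) := der (Gd e j (dg j)) (vx x) (vx v).

Lemma vx_lin (x v : 'M[K]_N) t i : vx (x + t *: v) i = vx x i + t * vx v i.
Proof. by rewrite /vx linearD linearZ !mxE. Qed.

Lemma dF_uniq j (x v : 'M[K]_N) c0 c1 : (forall t : K, t != 0 -> F e j (dg j) (x + t *: v) = c0 + t * c1) ->
  dF j x v = c1.
Proof.
move=> h; apply: (der_uniq (c0 := c0) K0) => t t0; rewrite -(h t t0) -(Gd_meval K0).
by apply: meval_eq => i; rewrite vx_lin.
Qed.

Lemma dF_sum j x (I : finType) (c : I -> K) (v : I -> 'M[K]_N) :
  dF j x (\sum_i c i *: v i) = \sum_i c i * dF j x (v i).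
Proof.
rewrite -der_lin; apply: der_eq => // i; rewrite /vx linear_sum summxE.
by apply: eq_bigr => a _; rewrite linearZ mxE.
Qed.

(** For even [j] the component is invariant under [sig], so at a fixed point of [sig] its
    derivatives along [v] and [sig Om v] agree. This allows the elementary directions of [gl] to be
    used for minors on [sp]. *)
Lemma dF_spproj j x v : (j <= N)%N -> ~~ odd j -> sig Om x = x -> dF j x (spproj Om v) = dF j x v.
Proof.
move=> jN ej hx.
have hs : dF j x (sig Om v) = dF j x v.
  rewrite /dF /der -/(der (Gd e j (dg j)) (vx x) (vx v)).
  have hl : (line (vx x) (vx (sig Om v)) (Gd e j (dg j))) = line (vx x) (vx v) (Gd e j (dg j)).
    apply: (poly_fun_inj K0) => t _; rewrite !line_horner.
    have hh w : (Gd e j (dg j)).@[fun i => vx x i + t * vx w i] = F e j (dg j) (x + t *: w).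
      by rewrite -(Gd_meval K0); apply: meval_eq => i; rewrite vx_lin.
    rewrite !hh -{1}hx -sigZ -sigD (F_sig K0) //.
    by rewrite -signr_odd (negbTE ej) mul1r.
  by rewrite -[LHS]line1 hl line1.
have -> : spproj Om v = \sum_(i < 2) 2%:R^-1 *: (if i == 0 then v else sig Om v).
  by rewrite big_ord_recl big_ord1 /= /spproj scalerDr.
rewrite dF_sum big_ord_recl big_ord1 /= hs -mulrDl -[in RHS](mul1r (dF j x v)); congr (_ * _).
have := natr_neq0 K0 1 => n2.
by apply: (mulfI n2); rewrite mulrDr mulfV // mulr1.
Qed.

Definition dU a b p : 'M[K]_(N, k) := e ^+ p *m rr a *m delta_mx 0 b.

Lemma dU_L a (b : 'I_k) p : dU a b p *m L = e ^+ p *m rr a *m ell b.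
Proof. by rewrite /dU -mulmxA -rowE rowK. Qed.

Lemma Yof_lin (U V : 'M[K]_(N, k)) t i j : Yof (U + t *: V) i j = Yof U i j + t *: Yof V i j.
Proof.
rewrite /Yof scaler_sumr -big_split; apply: eq_bigr => s _.
by rewrite mulmxDr -scalemxAr mxE [in X in _ + X]mxE scalerDl scalerA.
Qed.

Lemma Yof_dU (a b : 'I_k) p i j : (p < lam a)%N ->
  Yof (dU a b p) i j = 'X^p *+ ((i == a) && (j == b)).
Proof.
move=> pl; rewrite /Yof /dU.
have hE (s : nat) : (s < lam i)%N -> (ell i *m e ^+ s *m (e ^+ p *m rr a *m delta_mx 0 b)) 0 j =
    ((i == a) && (s + p.+1 == lam a)%N && (j == b))%:R.
  move=> sl; rewrite !mulmxA -(mulmxA (ell i)) -[e ^+ s *m e ^+ p]/(e ^+ s * e ^+ p) -exprD.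
  rewrite (ell_rr jf) // addnS; rewrite mxE big_ord1 !mxE eqxx mulr1n -natrM mulnb.
  by [].
under eq_bigr do rewrite hE //.
case: (eqVneq i a) => [->|_] /=; last by rewrite big1 // => s _; rewrite scale0r.
have hs : (lam a - p.+1 < lam a)%N by rewrite -subn_gt0; lia.
rewrite (bigD1 (Ordinal hs)) //= big1 ?addr0 => [|s /eqP ne].
  rewrite subnK // eqxx; case: (j == b); rewrite ?scale0r // scale1r.
  by congr ('X^_); lia.
case: eqP => [h|_]; last by rewrite scale0r.
by case: ne; apply: val_inj => /=; apply: (canRL (addnK _)).
Qed.

(** By [Yof_dU] this direction adds [z ^ p] to the entry [(a, b)] of [Y], so the determinant changes
    by [- tau * z ^ p] times a cofactor; the factor [tau] explains [(dg j).-1] and the sign explains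
    [j.+1]. *)
Lemma dF_slice j (U : 'M[K]_(N, k)) (a b : 'I_k) p : (0 < j <= N)%N -> (p < lam a)%N ->
  dF j (U *m L) (e ^+ p *m rr a *m ell b) =
  (-1) ^+ j.+1 * ((cofactor (SM (Yof U)) a b * 'X^p)`_(N - j))`_(dg j).-1.
Proof.
move=> jN pl; have [d0 _ _ _] := dgP jf jN; case/andP: (jN) => _ jN'.
apply: (dF_uniq (c0 := F e j (dg j) (U *m L))) => t _.
rewrite -dU_L scalemxAl -mulmxDl !(F_slice hnil jf) //.
have -> : SM (Yof (U + t *: dU a b p)) =
    SM (Yof U) + (- (t%:P%:P * 'X%:P * 'X^p)) *: delta_mx a b.
  apply/matrixP => i l; rewrite mxE Yof_lin Yof_dU // [RHS]mxE [X in _ = X + _]mxE -addrA.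
  congr (_ + _); rewrite rmorphD mulrDr opprD; congr (_ + _).
  rewrite [RHS]mxE [delta_mx _ _ _ _]mxE mulNr; congr (- _).
  rewrite -mul_polyC rmorphM /= map_polyC /= rmorphMn /= map_polyXn.
  by case: (_ && _); rewrite ?mulr1n ?mulr0n; ring.
rewrite det_add_delta coefD coefD mulrDr; congr (_ + _).
have -> : - (t%:P%:P * 'X%:P * 'X^p) * cofactor (SM (Yof U)) a b =
   (- t%:P)%:P * ('X%:P * (cofactor (SM (Yof U)) a b * 'X^p)) by rewrite rmorphN; ring.
rewrite coefCM coefCM mulNr coefN coefCM coefXM eqn0Ngt d0 /= exprS.
by ring.
Qed.

(** The slice point whose [Y] is constant in [z], with entries [eps i * C (inv i) j]; it lies in
    [sp] as soon as [C] is symmetric. *)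
Definition pt (C : nat -> nat -> K) : 'M[K]_N :=
  G *m L^T *m (\matrix_(i < k, j < k) C i j) *m L.

Lemma pt_lin C D s t : pt (fun i j => s * C i j + t * D i j) = s *: pt C + t *: pt D.
Proof.
rewrite /pt.
have -> : \matrix_(i < k, j < k) (s * C i j + t * D i j) =
   s *: (\matrix_(i < k, j < k) C i j) + t *: (\matrix_(i < k, j < k) D i j).
  by apply/matrixP => i j; rewrite !mxE.
by rewrite mulmxDr mulmxDl -!scalemxAr -!scalemxAl.
Qed.

Lemma sig_pt C : (forall i j, (i < k)%N -> (j < k)%N -> C i j = C j i) -> sig Om (pt C) = pt C.
Proof.
move=> hC; rewrite /sig /pt !trmx_mul trmxK (G_skew uOm hOm).
have -> : (\matrix_(i < k, j < k) C i j)^T = \matrix_(i < k, j < k) C i j.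
  by apply/matrixP => i j; rewrite !mxE hC.
by rewrite !mulmxN mulNmx opprK !mulmxA mulmxKV.
Qed.

Lemma Yof_pt (C : nat -> nat -> K) (i j : 'I_k) : Yof (G *m L^T *m (\matrix_(i < k, j < k) C i j)) i j = (eps i * C (inv i) j)%:P.
Proof.
have ik := ltn_ord i; have iik := jf_inv_lt jf ik.
have hE (s : nat) : (s < lam i)%N -> (ell i *m e ^+ s *m (G *m L^T *m (\matrix_(i < k, j < k) C i j))) 0 j =
    if s.+1 == lam i then eps i * C (inv i) j else 0.
  move=> sl; rewrite !mulmxA mxE.
  have h (a : 'I_k) : (ell i *m e ^+ s *m G *m L^T) 0 a = if (a == inv i :> nat) && (s.+1 == lam i) then eps i else 0.
    rewrite -(jf_gram jf) // /form [LHS]mxE [RHS]mxE; apply: eq_bigr => l _.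
    by congr (_ * _); rewrite [LHS]mxE [RHS]mxE mxE.
  rewrite (bigD1 (Ordinal iik)) //= h mxE eqxx /= big1 ?addr0 => [|a /eqP ne].
    by case: eqP => _ //; rewrite mul0r.
  rewrite h; case: eqP => [ea|_] /=; last by rewrite mul0r.
  by case: ne; apply: val_inj.
have l0 := jf_lam_gt0 jf ik.
rewrite /Yof; under eq_bigr do rewrite hE //.
have hs : ((lam i).-1 < lam i)%N by rewrite prednK.
rewrite (bigD1 (Ordinal hs)) //= big1 ?addr0 => [|s /eqP ne].
  by rewrite prednK // eqxx subnn expr0 -mul_polyC mulr1.
case: eqP => [h|_]; last by rewrite scale0r.
by case: ne; apply: val_inj => /=; apply: succn_inj; rewrite prednK.
Qed.

(** [inv i != i] occurs only for odd [lam i]; then [e ^+ (lam i - 1)] is self-adjoint for the form,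
    and skewness of the form reverses the sign. *)
Lemma eps_inv i : (i < k)%N -> eps (inv i) = if inv i == i then eps i else - eps i.
Proof.
move=> ik; have iik := jf_inv_lt jf ik; have l0 := jf_lam_gt0 jf ik.
case: eqP => [-> //|ne].
have h1 := jf_gram jf (lam i).-1 ik iik; rewrite eqxx prednK // eqxx /= in h1.
have h2 := jf_gram jf (lam i).-1 iik ik.
rewrite (jf_invK jf) // eqxx (jf_lam_inv jf) // prednK // eqxx /= in h2.
rewrite (form_adj (e_adj uOm he)) in h1; rewrite (formC (G_skew uOm hOm)) in h2.
rewrite -h1 -h2.
have -> : (-1) ^+ (lam i).-1 = 1 :> K; last by rewrite mul1r.
rewrite -signr_odd; have -> : odd (lam i).-1 = false; last by [].
have := jf_odd jf ik; rewrite -{1}(prednK l0) /=; have /eqP/negbTE-> := ne.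
by case: (odd _).
Qed.

(* Distinct nonzero eigenvalues for which the diagonal point lies in [sp]. *)
Definition acoef i : K := if (i <= inv i)%N then i.+1%:R else - (inv i).+1%:R.

Lemma acoef_neq0 i : acoef i != 0.
Proof. by rewrite /acoef; case: ifP => _; rewrite ?oppr_eq0 natr_neq0. Qed.

Lemma acoef_inv i : (i < k)%N -> acoef (inv i) = if inv i == i then acoef i else - acoef i.
Proof.
move=> ik; case: eqP => [-> //|/eqP ne]; rewrite /acoef (jf_invK jf) //.
by case: ltngtP ne => // _ _; rewrite opprK.
Qed.

Lemma acoef_inj i j : (i < k)%N -> (j < k)%N -> acoef i = acoef j -> i = j.
Proof.
move=> ik jk.
have hn a b : (a.+1%:R : K) != - b.+1%:R.
  by rewrite -subr_eq0 opprK -natrD addSn natr_neq0.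
rewrite /acoef; case: ifP => _; case: ifP => _ h.
- by have [] := natr_inj K0 h.
- by have := hn i (inv j); rewrite h eqxx.
- by have := hn j (inv i); rewrite h eqxx.
have [h'] := natr_inj K0 (oppr_inj h).
by rewrite -(jf_invK jf ik) h' (jf_invK jf).
Qed.

Definition ct_al (a b : nat) : K := if a == inv b then acoef b / eps b else 0.
Definition al := pt ct_al.

Lemma sig_al : sig Om al = al.
Proof.
apply: sig_pt => i j ik jk; rewrite /ct_al.
case: (eqVneq i (inv j)) => [->|ne].
  rewrite (jf_invK jf) // eqxx eps_inv // acoef_inv //.
  by case: (inv j == j); rewrite // invrN mulrNN.
by case: eqP => // h; rewrite h (jf_invK jf) // eqxx in ne.
Qed.

Lemma coef_al i j : (i < k)%N -> (j < k)%N -> eps i * ct_al (inv i) j = acoef i *+ (i == j).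
Proof.
move=> ik jk; rewrite /ct_al (inv_eq jf) //; case: eqP => [->|_]; last by rewrite mulr0.
by rewrite mulrC mulfVK // (jf_eps jf).
Qed.

(* Symmetrising the subdiagonal of ones puts the point into [sp] and leaves it Hessenberg
   because [inv] moves indices by at most one. *)
Definition cs (a b : nat) : K := if (b.+1 < k)%N && (a == inv b.+1) then (eps b.+1)^-1 else 0.
Definition ct_be (a b : nat) : K := cs a b + cs b a.
Definition be := pt ct_be.

Lemma sig_be : sig Om be = be.
Proof. by apply: sig_pt => i j _ _; rewrite /ct_be addrC. Qed.

Definition sub_be i := eps i.+1 * ct_be (inv i.+1) i.

(** The entry is 1, or 2 when [inv] swaps [i] and [i.+1], in which case both summands of the
    symmetrisation fall on the same place. *)
Lemma sub_be_neq0 i : (i.+1 < k)%N -> sub_be i != 0.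
Proof.
move=> ik; have ik' := ltnW ik; have iik := jf_inv_lt jf ik.
rewrite /sub_be /ct_be /cs ik eqxx /= mulrDr mulfV ?(jf_eps jf) //.
case: ifP => [/andP[h1 /eqP h2]|_]; last by rewrite mulr0 addr0 oner_eq0.
have e1 : inv i = (inv i.+1).+1 by rewrite {1}h2 (jf_invK jf).
have := jf_inv_near jf ik'; have := jf_inv_near jf iik.
rewrite (jf_invK jf) // => g1 g2.
have -> : (inv i.+1).+1 = i.+1 by lia.
by rewrite mulfV ?(jf_eps jf) //; apply: (natr_neq0 K0 1).
Qed.

Lemma coef_be_hess i j : (j.+1 < i)%N -> (i < k)%N -> eps i * ct_be (inv i) j = 0.
Proof.
move=> ji ik; have jk : (j < k)%N by lia.
have jk' : (j.+1 < k)%N by lia.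
have iik := jf_inv_lt jf ik.
rewrite /ct_be /cs (inv_eq jf) // (gtn_eqF ji) andbF add0r.
case: ifP => [/andP[h1 /eqP h2]|_]; last by rewrite mulr0.
have e1 : inv j = (inv i).+1 by rewrite h2 (jf_invK jf).
have := jf_inv_near jf jk; have := jf_inv_near jf iik; rewrite (jf_invK jf) // e1.
by lia.
Qed.

Lemma lam_le0 c : (c < k)%N -> (lam c <= lam 0)%N.
Proof. by move=> ck; apply: (jf_sorted jf). Qed.

Lemma Lam_split m : (m <= k)%N -> (Lam m + \sum_(m <= i < k) lam i = N)%N.
Proof. by move=> mk; rewrite -(Lam_k jf) /Lam -big_cat_nat. Qed.

Definition vdir (c : 'I_N) := e ^+ pk c *m rr 0 *m ell (bk c).

(** [al] contributes only to the diagonal of [Y], so [cofactor_hess] applies and the subdiagonal of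
    [t *: be] yields the power of [t]. For cells [c'] from [c] on, the exponents of [tau] and [z]
    match the required coefficient only at [c' = c], which makes the matrix of derivatives
    triangular. *)
Lemma dF_vdir s t (c c' : 'I_N) : (c <= c')%N ->
  dF c.+1 (s *: al + t *: be) (vdir c') =
    if c == c' then ((-1) ^+ c * \prod_(i < bk c) sub_be i) * t ^+ (dg c.+1).-1 else 0.
Proof.
move=> cc; have [b1 p1 g1 q1] := bkP uOm jf c; have [b2 p2 g2 q2] := bkP uOm jf c'.
have k0 : (0 < k)%N by apply: leq_ltn_trans b1.
rewrite /al /be -pt_lin /pt.
(* Chain 0 is a longest one, so every exponent [pk c'] is admissible in row 0. *)
have p2' : (pk c' < lam (Ordinal k0))%N by apply: leq_trans p2 (lam_le0 b2).
have := @dF_slice c.+1 (G *m L^T *m (\matrix_(i < k, j < k) (s * ct_al i j + t * ct_be i j)))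
  (Ordinal k0) (Ordinal b2) (pk c') _ p2'.
rewrite /vdir ltn_ord /= => -> //.
pose C i j := s * (acoef i *+ (i == j)) + t * (eps i * ct_be (inv i) j).
have hdg : (bk c <= bk c')%N.
  by rewrite -ltnS -g1 -g2; apply: (leq_dg jf); rewrite ?ltn_ord ?andbT.
rewrite (@cofactor_hess _ _ _ _ C) //=; first last.
- move=> i j ji ik; rewrite /C coef_be_hess // mulr0 addr0 (gtn_eqF (ltnW ji)) mulr0n mulr0 //.
- move=> i j; rewrite (Yof_pt (fun i j => s * ct_al i j + t * ct_be i j)) mulrDr mulrCA coef_al // /C; congr (_ + _)%:P.
  by rewrite mulrCA.
rewrite g1 /=.
case: (eqVneq c c') => [<-|ne]; last first.
  case: eqP => [eb|_] /=; last by rewrite mulr0.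
  case: eqP => [h|_]; last by rewrite mulr0.
  have hs := Lam_split b2; case/eqP: ne; apply: val_inj => /=.
  by move: h q1 q2 hs; rewrite eb; have := ltn_ord c; have := ltn_ord c'; lia.
rewrite eqxx /=; have -> : (N - c.+1 == pk c + \sum_((bk c).+1 <= i < k) lam i)%N.
  by apply/eqP; have := Lam_split b1; have := ltn_ord c; lia.
rewrite !exprS mulrA mulN1r opprK mul1r -!mulrA; congr (_ * _).
have -> : t ^+ bk c = \prod_(i < bk c) t by rewrite prodr_const card_ord.
rewrite -big_split; apply: eq_bigr => i _.
change (C i.+1 i = sub_be i * t).
by rewrite /C (gtn_eqF (ltnSn i)) mulr0n mulr0 add0r mulrC.
Qed.

Definition wdir (c : 'I_N) := e ^+ pk c *m rr (bk c) *m ell (bk c).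

Let B (c : 'I_N) : 'I_k := Ordinal (let: And4 h _ _ _ := bkP uOm jf c in h).

Lemma dF_wdir (c c' : 'I_N) : dF c'.+1 al (wdir c) = (-1) ^+ c'.+2 *
  (((\prod_(l < k | l != B c) dfac lam acoef l) * 'X^(pk c))`_(N - c'.+1))`_(dg c'.+1).-1.
Proof.
have [b1 p1 _ _] := bkP uOm jf c.
have hj : (0 < c'.+1 <= N)%N by rewrite ltn_ord.
have := @dF_slice c'.+1 (G *m L^T *m (\matrix_(i < k, j < k) ct_al i j)) (B c) (B c) (pk c) hj p1.
rewrite (@cofactor_diag _ _ _ acoef) => [<- //|i j].
by rewrite (Yof_pt ct_al) coef_al.
Qed.

(** The derivatives are coefficients of products of all but one of the factors
    [z ^ lam l - tau * acoef l]. Cells are treated by increasing [pk], then decreasing length; the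
    shear of slope [r = lam (bk c0)] isolates the cells with the same [pk] and length as [c0], and
    the distinct [acoef] separate these. *)
Lemma dF_wdir_inj (v : 'I_N -> K) :
  (forall c' : 'I_N, \sum_c v c * dF c'.+1 al (wdir c) = 0) -> forall c, v c = 0.
Proof.
move=> hv.
pose T (c : 'I_N) := (\prod_(l < k | l != B c) dfac lam acoef l) * 'X^(pk c).
pose g : {poly {poly K}} := \sum_c (v c)%:P%:P * T c.
have hg (c' : 'I_N) : (g`_(N - c'.+1))`_(dg c'.+1).-1 = 0.
  apply: (mulfI (_ : (-1) ^+ c'.+2 != 0 :> K)); first by rewrite signr_eq0.
  rewrite mulr0 -[RHS](hv c') /g !coef_sum mulr_sumr; apply: eq_bigr => c _.
  by rewrite dF_wdir !coefCM mulrCA.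
(* The measure encodes this lexicographic order, as [N - lam] stays below [N.+1]. *)
move=> c0; move: {2}(pk c0 * N.+1 + (N - lam (bk c0)))%N (leqnn (pk c0 * N.+1 + (N - lam (bk c0)))) => m.
elim/ltn_ind: m c0 => m IH c0 hm.
have lamN (c : 'I_N) : (lam (bk c) <= N)%N.
  have [b1 _ _ _] := bkP uOm jf c.
  by apply: leq_trans (leq_addr _ _) (eq_leq (etrans (esym (bigD1 (Ordinal b1) isT)) (jf_total jf))).
have IH' (c : 'I_N) : (pk c < pk c0)%N || (pk c == pk c0) && (lam (bk c0) < lam (bk c))%N -> v c = 0.
  move=> h; apply: (IH _ _ c (leqnn _)); apply: leq_trans hm.
  case/orP: h => [h|/andP[/eqP-> h]]; last by have := lamN c; lia.
  have : ((pk c).+1 * N.+1 <= pk c0 * N.+1)%N by rewrite leq_mul2r h orbT.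
  by rewrite mulSn; lia.
set r := lam (bk c0); set p := pk c0.
have [b0 p0 _ _] := bkP uOm jf c0; rewrite -/r -/p in p0.
have hk : (r <= kap k lam r)%N.
  by rewrite /kap (bigD1 (B c0)) //= minnn leq_addr.
(* The lowest exponent of [z] after the shear for cells with [pk = p] and [lam = r]; all other cells
   whose coefficient is not yet known to vanish start higher. *)
pose w := (kap k lam r - r + p)%N.
have hw : (w + r = kap k lam r + p)%N by rewrite /w; lia.
pose S (c : 'I_N) := (pk c == p) && (lam (bk c) == r).
pose E : {poly K} := \sum_(c | S c) v c *: \prod_(l < k | l != B c) dlow lam acoef r l.
have hE : (theta r g)`_w = E.
  have -> : theta r g = \sum_c (v c)%:P%:P * theta r (T c).
    pose th : {rmorphism {poly {poly K}} -> {poly {poly K}}} := theta r.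
    transitivity (\sum_c th ((v c)%:P%:P * T c)); first by rewrite -(rmorph_sum th).
    apply: eq_bigr => c _; rewrite (rmorphM th); congr (_ * _).
    by rewrite -[RHS](theta_in_C r) -theta_C.
  rewrite coef_sum /E [RHS]big_mkcond; apply: eq_bigr => c _; rewrite coefCM mul_polyC.
  have [vz|nvz] := eqVneq (v c) 0; first by rewrite vz !scale0r if_same.
  have hc : ~~ ((pk c < p)%N || (pk c == p) && (r < lam (bk c))%N).
    by apply: contraNN nvz => /IH'->.
  rewrite coef_theta_dprod; first last.
  - change ((r <= lam (bk c))%N || (w + minn (lam (bk c)) r < kap k lam r + pk c)%N).
    by move: hc hw; clear; case: (ltngtP (pk c) p) => //= h; lia.
  - by rewrite hw leq_add2l; move: hc; case: ltngtP.
  rewrite hw eqn_add2l eq_sym /= /S; case: eqP hc => [->|ne] /=; last by rewrite scaler0.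
  by rewrite ltnn /= -leqNgt => hc; rewrite eqn_leq hc /=; case: ifP => //; rewrite scaler0.
have hB c : S c -> lam (B c) = r by case/andP => _ /eqP.
(* Unless [lam d = r], degree [d] lies outside the degree window of every product in [E]. If
   [lam d = r], the coefficient is the one tested by the hypothesis for the cell with [bk = d] and
   [pk = p]. *)
have hE0 : E = 0.
  apply/polyP => d; rewrite coef0.
  case: (ltnP d k) => dk; last first.
    rewrite /E coef_sum big1 // => c Sc; rewrite coefZ; apply/eqP; rewrite mulf_eq0; apply/orP; right; apply/eqP.
    apply: coef_dlow_prod.
    apply/orP; right; apply: leq_trans dk.
    rewrite -[X in (_ <= X)%N](sum_ord_ltn (leqnn k)) [X in (_ <= X)%N](bigD1 (B c)) //=.
    have [bc _ _ _] := bkP uOm jf c; rewrite bc add1n ltnS.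
    by apply: leq_sum => l _; rewrite ltn_ord leq_b1.
  case: (ltngtP (lam d) r) => hd.
  - rewrite /E coef_sum big1 // => c Sc; rewrite coefZ; apply/eqP; rewrite mulf_eq0; apply/orP; right; apply/eqP.
    apply: coef_dlow_prod.
    apply/orP; right.
    have hl (l : 'I_k) : (r <= lam l)%N -> (l < d)%N.
      by move=> h; rewrite ltnNge; apply/negP => dl; have := jf_sorted jf dl (ltn_ord l); lia.
    rewrite -[X in (_ < X)%N](sum_ord_ltn (ltnW dk)) [X in (_ < X)%N](bigD1 (B c)) //=.
    have hBc := hl (B c); rewrite hB // leqnn /= in hBc; rewrite hBc // add1n ltnS.
    by apply: leq_sum => l _; case h: (r <= lam l)%N; rewrite ?(hl _ h).
  - rewrite /E coef_sum big1 // => c Sc; rewrite coefZ; apply/eqP; rewrite mulf_eq0; apply/orP; right; apply/eqP.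
    apply: coef_dlow_prod.
    apply/orP; left.
    have hl (l : 'I_k) : (l <= d)%N -> (r < lam l)%N.
      by move=> dl; have := jf_sorted jf dl dk; lia.
    rewrite -[X in (X <= _)%N](sum_ord_ltn dk) (bigD1 (B c)) //= ltnS.
    have hBc := hl (B c); rewrite hB // ltnn /= in hBc.
    have -> : (bk c <= d)%N = false by apply/negP => /hBc.
    rewrite add0n; apply: leq_sum => l _; rewrite ltnS.
    by case h: (l <= d)%N; rewrite ?(hl _ h).
  have pd : (p < lam d)%N by rewrite hd.
  have [c' [eb ep]] := cell_exists uOm jf dk pd.
  have [_ _ g' q'] := bkP uOm jf c'.
  have hkd := kapE jf (m := d.+1) dk; rewrite /= hd in hkd.
  rewrite -hE coef_theta.
  rewrite eb ep in q'; rewrite eb in g'.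
  have hc' := ltn_ord c'.
  have e1 : (w + c'.+1 = r * d + N)%N.
    by move: hkd; rewrite mulSn mulnC; move: (r * d)%N => rd; lia.
  have e2 : (w - r * d = N - c'.+1)%N by move: e1; move: (r * d)%N => rd; lia.
  have e3 : (r * d <= w)%N by move: e1; move: (r * d)%N => rd; lia.
  by rewrite e3 e2; have := hg c'; rewrite g'.
(* At the inverse of [acoef (bk c0)] the factor [dlow] of this chain vanishes, so only the product
   that omits it, the one for [c0], survives. *)
have a0 := acoef_neq0 (bk c0).
have := congr1 (horner^~ (acoef (bk c0))^-1) hE0; rewrite horner0 /E horner_sum.
have S0 : S c0 by rewrite /S !eqxx.
have hd l : (dlow lam acoef r l).[(acoef (bk c0))^-1] =
    (lam l <= r)%N%:R - (r <= lam l)%N%:R * (acoef l / acoef (bk c0)).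
  by rewrite /dlow; case: (_ <= _)%N; case: (_ <= _)%N; rewrite !hornerE.
rewrite (bigD1 c0) //= [X in _ + X]big1 ?addr0 => [|c /andP[Sc cc]]; last first.
  rewrite hornerZ horner_prod (bigD1 (B c0)) /=; last first.
    apply: contraNneq cc => h; apply/eqP/(cell_inj uOm jf).
      by have := congr1 val h.
    by case/andP: Sc => /eqP-> _.
  by rewrite hd leqnn mul1r mulfV // subrr mul0r mulr0.
rewrite hornerZ => /eqP; rewrite mulf_eq0 => /orP[/eqP //|].
rewrite horner_prod => /prodf_eq0[l lb /eqP].
rewrite hd; case: (ltngtP (lam l) r) => hl.
- by rewrite mul0r subr0 => /eqP; rewrite oner_eq0.
- by rewrite mul1r sub0r => /eqP; rewrite oppr_eq0 mulf_eq0 invr_eq0 !(negbTE (acoef_neq0 _)).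
rewrite mul1r => /eqP; rewrite subr_eq0 eq_sym -(inj_eq (mulIf a0)) mulfVK // mul1r => /eqP h.
case/negP: lb; apply/eqP/val_inj => /=; apply: acoef_inj => //.
Qed.

End Points.

(** * The stabiliser of the diagonal point *)

Section Stab.
Variables (K : closedFieldType) (N : nat) (Om e : 'M[K]_N).
Hypothesis K0 : [pchar K] =i pred0.
Hypothesis uOm : Om \in unitmx.
Hypothesis hOm : Om^T = - Om.
Hypothesis he : sig Om e = e.
Hypothesis hnil : e ^+ N = 0.
Local Notation G := (invmx Om).
Variables (k : nat) (lam inv : nat -> nat) (eps : nat -> K) (ell : nat -> 'rV[K]_N).
Hypothesis jf : jordan_form G e k lam inv eps ell.
Local Notation bk := (bk k lam).
Local Notation pk := (pk k lam).
Local Notation rr := (rr Om inv eps ell).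
Local Notation al := (al Om k inv eps ell).
Local Notation acoef := (acoef K inv).

Lemma comm_powr (x : 'M[K]_N) s : e *m x = x *m e -> x *m e ^+ s = e ^+ s *m x.
Proof.
move=> h; elim: s => [|s IH]; first by rewrite expr0 -[1]/(1%:M) mulmx1 mul1mx.
by rewrite exprSr -[e ^+ s * e]/(e ^+ s *m e) mulmxA IH -!mulmxA h.
Qed.

Lemma e_pow_G s : e ^+ s *m G = (-1) ^+ s *: (G *m (e ^+ s)^T).
Proof.
elim: s => [|s IH]; first by rewrite !expr0 scale1r -[1]/(1%:M) trmx1 mulmx1 mul1mx.
rewrite {1}exprS -[e * _]/(e *m e ^+ s) -mulmxA IH -scalemxAr mulmxA (e_adj uOm he).
rewrite mulNmx scalerN -mulmxA -trmx_mul -[e ^+ s *m e]/(e ^+ s * e) -exprSr.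
by rewrite [(-1) ^+ s.+1]exprS mulN1r scaleNr.
Qed.

Lemma rr_nil b : (b < k)%N -> e ^+ lam b *m rr b = 0.
Proof.
move=> bk'; rewrite /rr -scalemxAr mulmxA e_pow_G -scalemxAl -mulmxA -trmx_mul.
by rewrite -(jf_lam_inv jf) // (jf_nil jf) ?trmx0 ?mulmx0 ?scaler0 // (jf_inv_lt jf).
Qed.

Lemma alE : al = \sum_(b < k) acoef b *: (rr b *m ell b).
Proof.
rewrite /al /pt.
have -> : \matrix_(i < k, j < k) ct_al inv eps i j = \sum_(b < k) ct_al inv eps (inv b) b *: \matrix_(i < k, j < k) (((i == inv b :> nat) && (j == b))%:R).
  apply/matrixP => i j; rewrite summxE mxE (bigD1 j) //= big1 ?addr0 => [|b bj].
    rewrite mxE [X in _ * X]mxE eqxx andbT /ct_al eqxx.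
    by case: eqP => _; rewrite ?mulr1 ?mulr0.
  by rewrite mxE [X in _ * X]mxE [j == b]eq_sym (negbTE bj) andbF mulr0.
rewrite mulmx_sumr mulmx_suml; apply: eq_bigr => b _.
have ib := jf_inv_lt jf (ltn_ord b).
have -> : \matrix_(i < k, j < k) (((i == inv b :> nat) && (j == b))%:R) = delta_mx (Ordinal ib) b :> 'M[K]_k.
  by apply/matrixP => i j; rewrite !mxE.
rewrite -scalemxAr -scalemxAl /ct_al eqxx /rr -scalemxAl scalerA; congr (_ *: _).
have -> : delta_mx (Ordinal ib) b = (delta_mx (0 : 'I_1) (Ordinal ib))^T *m delta_mx (0 : 'I_1) b :> 'M[K]_k.
  by rewrite trmx_delta mul_delta_mx.
rewrite !mulmxA -(mulmxA G) -trmx_mul -rowE -mulmxA -rowE.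
by rewrite !rowK.
Qed.

Lemma mxtrace_col_row (x : 'cV[K]_N) (y : 'rV[K]_N) : \tr (x *m y) = (y *m x) 0 0.
Proof. by rewrite mxtrace_mulC /mxtrace big_ord1. Qed.

(** If [u *m e ^+ lam j = 0], this is the matrix commuting with [e] that sends [ell j] to [u] and
    every other [ell i] to 0. *)
Definition eta j u : 'M[K]_N := \sum_(s < lam j) e ^+ (lam j - s.+1) *m rr j *m u *m e ^+ s.

Lemma eta_comm j u : (j < k)%N -> u *m e ^+ lam j = 0 -> e *m eta j u = eta j u *m e.
Proof.
move=> jk hu.
pose f s := e ^+ (lam j - s) *m rr j *m u *m e ^+ s.
have l0 := jf_lam_gt0 jf jk.
rewrite /eta mulmx_sumr mulmx_suml.
transitivity (\sum_(s < lam j) f s).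
  apply: eq_bigr => s _; rewrite /f !mulmxA; congr (_ *m _ *m _ *m _).
  by rewrite -[e *m _]/(e * _) -exprS subnSK.
transitivity (\sum_(s < lam j) f s.+1); last first.
  by apply: eq_bigr => s _; rewrite /f exprSr -[e ^+ s * e]/(e ^+ s *m e) mulmxA.
have f0 : f 0%N = 0 by rewrite /f subn0 rr_nil // !mul0mx.
have fl : f (lam j) = 0 by rewrite /f subnn expr0 mul1mx -mulmxA hu mulmx0.
case: (lam j) l0 fl => // m _ fl.
rewrite big_ord_recl [RHS]big_ord_recr /= f0 fl add0r addr0.
by [].
Qed.

Lemma ell_al i s : (i < k)%N ->
  ell i *m e ^+ s *m al = if s.+1 == lam i then acoef i *: ell i else 0.
Proof.
move=> ik; rewrite alE mulmx_sumr (bigD1 (Ordinal ik)) //= big1 ?addr0 => [|b bi].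
  rewrite -scalemxAr mulmxA (ell_rr jf) // eqxx /= mul_scalar_mx.
  by case: eqP; rewrite ?scale1r ?scale0r ?scaler0.
rewrite -scalemxAr mulmxA (ell_rr jf) // (_ : (i == b) = false) ?scale0r ?mul_scalar_mx ?scale0r ?scaler0 //.
by apply/eqP => ib; case/eqP: bi; apply: val_inj.
Qed.

Lemma al_rr j s : (j < k)%N ->
  al *m (e ^+ s *m rr j) = if s.+1 == lam j then acoef j *: rr j else 0.
Proof.
move=> jk; rewrite alE mulmx_suml (bigD1 (Ordinal jk)) //= big1 ?addr0 => [|b bi].
  rewrite -scalemxAl -mulmxA (mulmxA (ell j)) (ell_rr jf) // eqxx /= mul_mx_scalar.
  by case: eqP; rewrite ?scale1r ?scale0r ?scaler0.
rewrite -scalemxAl -mulmxA (mulmxA (ell b)) (ell_rr jf) // (_ : (_ == _) = false).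
  by rewrite mul_mx_scalar scale0r scaler0.
by apply/eqP => ib; case/eqP: bi; apply: val_inj.
Qed.

Lemma tr_eta j u (m : 'M[K]_N) :
  \tr (m *m eta j u) = \sum_(s < lam j) (u *m e ^+ s *m m *m (e ^+ (lam j - s.+1) *m rr j)) 0 0.
Proof.
rewrite /eta mulmx_sumr linear_sum; apply: eq_bigr => s _ /=.
rewrite -(mulmxA _ u) mulmxA mxtrace_col_row.
by rewrite !mulmxA.
Qed.

(** The coadjoint stabiliser, inside the centraliser of [e] in [sp], of the functional defined by
    [al]. *)
Definition stab (x : 'M[K]_N) := [/\ sig Om x = x, e *m x = x *m e &
  forall y, sig Om y = y -> e *m y = y *m e -> \tr (al *m (x *m y - y *m x)) = 0].

(** [x] and [al] are fixed by [sig], so the trace takes equal values at [y] and [sig Om y], hence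
    also at the projection of [y] to [sp]. It can then be tested on the matrices [eta], which need
    not lie in [sp]. *)
Lemma stab_gl x y : stab x -> e *m y = y *m e -> \tr (al *m (x *m y - y *m x)) = 0.
Proof.
case=> sx ex hx ey.
have n2 := natr_neq0 K0 1.
have sal := sig_al uOm hOm he jf.
pose T z := \tr (al *m (x *m z - z *m x)).
have TE z : T (sig Om z) = T z.
  have hs : sig Om (x *m z - z *m x) = x *m sig Om z - sig Om z *m x.
    by rewrite sigD -scaleN1r sigZ !sigM // sx scaleN1r opprK addrC.
  rewrite /T -hs mxtrace_mulC; have -> : sig Om (x *m z - z *m x) *m al = - sig Om (al *m (x *m z - z *m x)).
    by rewrite sigM // sal opprK.
  by rewrite linearN /= mxtrace_sig // opprK.
have TD (z w : 'M[K]_N) : T (z + w) = T z + T w.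
  by rewrite /T (mulmxDl z) (mulmxDr x) opprD addrACA [in LHS]mulmxDr mxtraceD.
have TZ c z : T (c *: z) = c * T z.
  by rewrite /T -scalemxAl -scalemxAr -scalerBr -scalemxAr mxtraceZ.
have esy : e *m sig Om y = sig Om y *m e.
  by have := congr1 (sig Om) ey; rewrite !sigM // he => /oppr_inj.
have h : T (spproj Om y) = 0.
  apply: hx; first by rewrite sig_spproj.
  by rewrite /spproj -scalemxAr -scalemxAl mulmxDl mulmxDr ey esy.
move/eqP: h; rewrite /spproj TZ TD TE mulf_eq0 invr_eq0 (negbTE n2) /= -mulr2n -mulr_natl mulf_eq0.
by rewrite (negbTE n2) => /eqP.
Qed.

(** Testing against [eta j (ell i *m e ^+ q)] gives [acoef i *: X (q + lam j - lam i) = acoef j *: X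
    q]. For unequal lengths this ties each [X] to one of larger index, and [X] vanishes for large
    indices; for equal lengths the distinct [acoef] force [X q = 0]. *)
Lemma stab_offdiag x i j c : stab x -> (i < k)%N -> (j < k)%N -> i != j ->
  ell i *m x *m e ^+ c *m rr j = 0.
Proof.
move=> hx ik jk ij; have [sx ex _] := hx.
pose X c := (ell i *m x *m e ^+ c *m rr j).
have xe s : x *m e ^+ s = e ^+ s *m x by apply: comm_powr.
have X0 d : (lam i <= d)%N || (lam j <= d)%N -> X d = 0.
  case/orP=> h.
    by rewrite /X -(mulmxA (ell i)) xe mulmxA -(subnKC h) exprD -[e ^+ lam i * _]/(_ *m _) mulmxA (jf_nil jf) // !mul0mx.
  by rewrite /X -(subnK h) exprD -[_ * e ^+ lam j]/(_ *m _) -!mulmxA rr_nil // !mulmx0.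
have key q : (q < lam i)%N -> (lam i <= q + lam j)%N ->
    acoef i *: X (q + lam j - lam i)%N = acoef j *: X q.
  move=> qi ql.
  pose u := ell i *m e ^+ q.
  have hu : u *m e ^+ lam j = 0.
    by rewrite /u -mulmxA -[e ^+ q *m _]/(_ * _) -exprD -(subnKC ql) exprD -[_ * _]/(_ *m _) mulmxA (jf_nil jf) // mul0mx.
  have := stab_gl hx (eta_comm jk hu).
  rewrite mulmxBr linearB /= => /eqP; rewrite subr_eq0 => /eqP.
  rewrite mulmxA tr_eta mulmxA mxtrace_mulC mulmxA tr_eta => h.
  have h1 : \sum_(s < lam j) (u *m e ^+ s *m (al *m x) *m (e ^+ (lam j - s.+1) *m rr j)) 0 0 =
      (acoef i *: X (q + lam j - lam i)%N) 0 0.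
    have hs : (lam i - q.+1 < lam j)%N by lia.
    have hu' s : u *m e ^+ s *m al = if (q + s).+1 == lam i then acoef i *: ell i else 0.
      by rewrite /u -(mulmxA (ell i)) -[e ^+ q *m _]/(_ * _) -exprD ell_al.
    rewrite (bigD1 (Ordinal hs)) //= big1 ?addr0 => [|s /eqP si]; rewrite (mulmxA _ al) hu'.
      have -> : (q + (lam i - q.+1)).+1 == lam i by apply/eqP; lia.
      have -> : (lam j - (lam i - q.+1).+1 = q + lam j - lam i)%N by lia.
      by rewrite -!scalemxAl /X !mulmxA.
    case: eqP => [es|_]; last by rewrite !mul0mx mxE.
    by case: si; apply: val_inj => /=; lia.
  have h2 : \sum_(s < lam j) (u *m e ^+ s *m (x *m al) *m (e ^+ (lam j - s.+1) *m rr j)) 0 0 =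
      (acoef j *: X q) 0 0.
    have hs : (0 < lam j)%N by lia.
    rewrite (bigD1 (Ordinal hs)) //= big1 ?addr0 => [|s /eqP si]; rewrite -(mulmxA _ _ (e ^+ _ *m _)) -(mulmxA x) al_rr //.
      have -> : (lam j - 1).+1 == lam j by apply/eqP; lia.
      rewrite -scalemxAr -scalemxAr expr0 -[1]/(1%:M) mulmx1 /u /X.
      by rewrite -!(mulmxA (ell i)) (mulmxA (e ^+ q)) -xe.
    case: eqP => [es|_]; last by rewrite !mulmx0 mxE.
    by case: si; apply: val_inj => /=; have := ltn_ord s; lia.
  by rewrite [LHS]mx11_scalar [RHS]mx11_scalar -h1 -h2 h.
have ai := acoef_neq0 K0 inv i; have aj := acoef_neq0 K0 inv j.
have aij : acoef i != acoef j by apply: contraNneq ij => /(acoef_inj K0 jf ik jk)->.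
have H d c' : (N <= c' + d)%N -> X c' = 0.
  elim/ltn_ind: d c' => d IH c' hd.
  have li : (lam i <= N)%N by rewrite -(jf_total jf) (bigD1 (Ordinal ik)) //= leq_addr.
  case hc : ((lam i <= c') || (lam j <= c'))%N; first exact: X0.
  have ci : (c' < lam i)%N by move: hc; lia.
  have cj : (c' < lam j)%N by move: hc; lia.
  case: (ltngtP (lam i) (lam j)) => hl.
  - have := key c' ci; rewrite (IH (d - (lam j - lam i))%N) ?scaler0; try lia.
    move=> h; have /eqP : acoef j *: X c' = 0 by rewrite -h //; lia.
    by rewrite scaler_eq0 (negbTE aj) => /eqP.
  - have := key (c' + (lam i - lam j))%N.
    have -> : (c' + (lam i - lam j) + lam j - lam i = c')%N by lia.
    rewrite [X (c' + _)%N](IH (d - (lam i - lam j))%N) ?scaler0; try lia.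
    move=> h; have /eqP : acoef i *: X c' = 0 by rewrite h //; lia.
    by rewrite scaler_eq0 (negbTE ai) => /eqP.
  have := key c' ci; rewrite hl addnK => h.
  have /eqP : (acoef i - acoef j) *: X c' = 0 by rewrite scalerBl h ?subrr //; lia.
  by rewrite scaler_eq0 subr_eq0 (negbTE aij) => /eqP.
exact: (H N c (leq_addl _ _)).
Qed.

Lemma pow_span (v : 'rV[K]_N) : v = \sum_(c < N) (v *m e ^+ (lam (bk c) - (pk c).+1) *m rr (bk c)) *m (ell (bk c) *m e ^+ pk c).
Proof.
have -> : \sum_(c < N) (v *m e ^+ (lam (bk c) - (pk c).+1) *m rr (bk c)) *m (ell (bk c) *m e ^+ pk c)
   = v *m Rs Om e k lam inv eps ell *m Bs e k lam ell.
  rewrite [RHS]mulmx_sum_row; apply: eq_bigr => c _.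
  rewrite rowK [X in X *m _]mx11_scalar mul_scalar_mx; congr (_ *: _).
  have hc : col c (Rs Om e k lam inv eps ell) = e ^+ (lam (bk c) - (pk c).+1) *m rr (bk c).
    by apply/matrixP => x y; rewrite !ord1 /Rs [LHS]mxE mxE mxE mxE.
  rewrite -mulmxA -hc [LHS]mxE [RHS]mxE; apply: eq_bigr => l _.
  by rewrite [col _ _ _ _]mxE.
by rewrite -mulmxA RsBs // mulmx1.
Qed.

Lemma Bs_inj p (x y : 'M[K]_(N, p)) :
  (forall i s, (i < k)%N -> ell i *m e ^+ s *m x = ell i *m e ^+ s *m y) -> x = y.
Proof.
move=> h; rewrite -[x]mul1mx -[y]mul1mx -(RsBs uOm jf) -!mulmxA; congr (_ *m _).
by apply/row_matrixP => c; rewrite !row_mul rowK; have [b1 _ _ _] := bkP uOm jf c; apply: h.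
Qed.

(* [omega] is cyclic for the elements of the stabiliser, which act diagonally on the chains. *)
Definition omega : 'rV[K]_N := \sum_(i < k) ell i.

Lemma omega_rr x i c : stab x -> (i < k)%N ->
  omega *m x *m e ^+ c *m rr i = ell i *m x *m e ^+ c *m rr i.
Proof.
move=> hx ik; rewrite /omega !mulmx_suml (bigD1 (Ordinal ik)) //= big1 ?addr0 // => j ji.
by apply: stab_offdiag => //; apply: contraNneq ji => h; apply/eqP/val_inj.
Qed.

(** Only rows of chain [i] occur in [ell i *m x], so [x] acts on [ell i] as a polynomial in [e],
    which commutes with everything that commutes with [e]. Commutativity of the stabiliser
    follows. *)
Lemma stab_ell x i : stab x -> (i < k)%N -> exists P : 'M[K]_N,
  (forall y, e *m y = y *m e -> P *m y = y *m P) /\ ell i *m x = ell i *m P.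
Proof.
move=> hx ik; have [_ ex _] := hx.
exists (\sum_(c < N | bk c == i) (ell i *m x *m e ^+ (lam (bk c) - (pk c).+1) *m rr (bk c)) 0 0 *: e ^+ pk c).
split=> [y ey|].
  rewrite mulmx_suml mulmx_sumr; apply: eq_bigr => c _.
  have h : e ^+ pk c *m y = y *m e ^+ pk c by rewrite (comm_powr _ ey).
  by rewrite -scalemxAl h scalemxAr.
rewrite {1}(pow_span (ell i *m x)) (bigID (fun c : 'I_N => bk c == i)) /= [X in _ + X]big1 ?addr0.
  rewrite mulmx_sumr; apply: eq_bigr => c /eqP eb.
  move: (_ *m rr (bk c)) => Z; rewrite {1}(mx11_scalar Z) mul_scalar_mx eb.
  by rewrite -scalemxAr.
move=> c ne; have [b1 _ _ _] := bkP uOm jf c.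
by rewrite stab_offdiag ?mul0mx // eq_sym.
Qed.

Lemma stab_comm x y : stab x -> stab y -> x *m y = y *m x.
Proof.
move=> hx hy; have [_ ex _] := hx; have [_ ey _] := hy.
apply: Bs_inj => i s ik.
have [P [cP hP]] := stab_ell hx ik; have [Q [cQ hQ]] := stab_ell hy ik.
have PQ : P *m Q = Q *m P.
  have eQ : e *m Q = Q *m e by rewrite cQ.
  exact: cP.
rewrite -!(mulmxA (ell i)) !(mulmxA (e ^+ s)) -!(comm_powr s) //.
rewrite -!mulmxA -!(comm_powr s) // !mulmxA hP hQ.
by rewrite -(mulmxA (ell i)) cP // mulmxA hQ -[in RHS](mulmxA (ell i)) cQ // mulmxA hP -!(mulmxA (ell i)) PQ.
Qed.

Lemma omega_inj x : stab x -> omega *m x = 0 -> x = 0.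
Proof.
move=> hx hw; have [_ ex _] := hx.
apply: Bs_inj => i s ik; rewrite mulmx0 -mulmxA -(comm_powr s) // mulmxA.
have -> : ell i *m x = 0; last by rewrite mul0mx.
rewrite (pow_span (ell i *m x)) big1 // => c _.
have [b1 _ _ _] := bkP uOm jf c.
case: (eqVneq i (bk c)) => [eb|ne]; last by rewrite stab_offdiag // mul0mx.
by rewrite {1}eb -omega_rr // hw !mul0mx.
Qed.

(** Elements of the stabiliser are skew-adjoint and commute. Moving [x] across the form gives minus
    [form G omega (omega *m (y *m x))]; exchanging the arguments first and moving [y] gives plus the
    same value. *)
Lemma omega_isotropic x y : stab x -> stab y -> form G (omega *m x) (omega *m y) = 0.
Proof.
move=> hx hy.
have adj z u v : stab z -> form G (u *m z) v = - form G u (v *m z).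
  move=> [sz _ _]; rewrite /form -(mulmxA u).
  by rewrite -{1}sz /sig mulNmx mulmxK // trmx_mul mulmxN mulNmx mxE !mulmxA.
have h1 : form G (omega *m x) (omega *m y) = - form G omega (omega *m (y *m x)).
  by rewrite adj // mulmxA.
have h2 : form G (omega *m x) (omega *m y) = form G omega (omega *m (y *m x)).
  by rewrite (formC (G_skew uOm hOm)) adj // opprK -(stab_comm hx hy) mulmxA.
apply/eqP; have n2 := natr_neq0 K0 1; rewrite -(inj_eq (mulfI n2)) mulr0 mulr_natl mulr2n.
by rewrite {1}h1 h2 addNr.
Qed.

Lemma stab_dim q (x : 'I_q -> 'M[K]_N) : (forall a, stab (x a)) ->
  (forall c : 'I_q -> K, \sum_a c a *: x a = 0 -> forall a, c a = 0) -> (q.*2 <= N)%N.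
Proof.
move=> hx hi.
pose W := \matrix_(a < q) (omega *m x a).
have rW : \rank W = q.
  apply/eqP; rewrite -[_ == _]/(row_free W); apply/inj_row_free => v hv.
  have s1 : stab 0.
    split; rewrite ?mulmx0 ?mul0mx //; first by rewrite /sig trmx0 mulmx0 mul0mx oppr0.
    by move=> y _ _; rewrite mul0mx mulmx0 subrr mulmx0 mxtrace0.
  have hst : stab (\sum_a v 0 a *: x a).
    elim/big_ind: _ => // [z w [z1 z2 z3] [w1 w2 w3]|a _].
      split; rewrite ?sigD ?z1 ?w1 // ?mulmxDl ?mulmxDr ?z2 ?w2 // => y y1 y2.
      by rewrite mulmxDl (mulmxDr y) opprD addrACA mulmxDr mxtraceD z3 // w3 // addr0.
    have [z1 z2 z3] := hx a; split; rewrite ?sigZ ?z1 // -?scalemxAl -?scalemxAr ?z2 // => y y1 y2.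
    by rewrite -scalemxAl -scalemxAr -scalerBr -scalemxAr mxtraceZ z3 // mulr0.
  have h0 : \sum_a v 0 a *: x a = 0.
    apply: omega_inj => //; rewrite mulmx_sumr -[RHS]hv mulmx_sum_row; apply: eq_bigr => a _.
    by rewrite rowK scalemxAr.
  by apply/rowP => a; rewrite mxE (hi _ h0).
have hW : W *m G *m W^T = 0.
  apply/matrixP => a b; rewrite [RHS]mxE -[RHS](omega_isotropic (hx a) (hx b)) /form.
  rewrite -[omega *m x a](rowK (fun a => omega *m x a)) -[omega *m x b](rowK (fun a => omega *m x a)) -/W.
  rewrite -row_mul [LHS]mxE [RHS]mxE; apply: eq_bigr => l _.
  by congr (_ * _); rewrite [RHS]mxE // [RHS]mxE mxE.
have := mulmx0_rank_max hW.
rewrite mxrank_tr rW mxrankMfree ?rW ?addnn //.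
by rewrite row_free_unit unitmx_inv.
Qed.

End Stab.

(** * Centralisers in an sl2-triple *)

Section SL2.
Variables (K : fieldType) (N : nat).
Local Notation M := 'M[K]_N.
Hypothesis K0 : [pchar K] =i pred0.
Variables (E F H : {linear M -> M}).
Hypothesis hEF : forall v, E (F v) = F (E v) + H v.
Hypothesis hHE : forall v, H (E v) = E (H v) + 2%:R *: E v.
Hypothesis hHF : forall v, H (F v) = F (H v) - 2%:R *: F v.
Hypothesis nilE : forall v, exists a, iter a E v = 0.
Hypothesis nilF : forall v, exists a, iter a F v = 0.

Lemma hw_H z l m : H z = l *: z -> H (iter m F z) = (l - m.*2%:R) *: iter m F z.
Proof.
move=> hz; elim: m => [|m IH]; first by rewrite subr0.
rewrite /= hHF IH linearZ /=; move: (F _) => w.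
by apply/matrixP => a b; rewrite !mxE doubleS -addn2 natrD; ring.
Qed.

Lemma hw_E z l m : E z = 0 -> H z = l *: z ->
  E (iter m.+1 F z) = (m.+1%:R * (l - m%:R)) *: iter m F z.
Proof.
move=> ez hz; elim: m => [|m IH]; first by rewrite /= hEF ez linear0 add0r hz mul1r subr0.
have hH := hw_H m.+1 hz; rewrite /= in hH IH *.
rewrite hEF IH linearZ /= hH; move: (F (iter m F z)) => w.
by apply/matrixP => a b; rewrite !mxE -[m.+2]addn2 -[m.+1]addn1 -muln2 natrM !natrD; ring.
Qed.

Lemma hw_F z j : E z = 0 -> H z = j%:R *: z -> iter j.+1 F z = 0.
Proof.
move=> ez hz; have [b hb] := nilF (iter j.+1 F z); rewrite -iterD addnC in hb.
elim: b hb => [|b IH]; first by rewrite addn0.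
rewrite addnS => h; apply: IH.
have := hw_E (j.+1 + b) ez hz; rewrite h linear0 => /esym/eqP.
have -> : j%:R - (j.+1 + b)%:R = - b.+1%:R :> K by rewrite -addn1 -[b.+1]addn1 !natrD; ring.
by rewrite scaler_eq0 mulf_eq0 oppr_eq0 !(negbTE (natr_neq0 K0 _)) => /eqP.
Qed.

Lemma hw_EF z j m : E z = 0 -> H z = j%:R *: z -> (m <= j)%N ->
  exists2 c : K, c != 0 & iter m E (iter m F z) = c *: z.
Proof.
move=> ez hz; elim: m => [|m IH] mj; first by exists 1; rewrite ?oner_eq0 // scale1r.
have [c c0 hc] := IH (ltnW mj).
exists (m.+1%:R * (j%:R - m%:R) * c).
  rewrite !mulf_neq0 ?natr_neq0 // -natrB ?(ltnW mj) //.
  by rewrite -(prednK (_ : 0 < j - m)%N) ?natr_neq0 // subn_gt0.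
rewrite iterSr (hw_E m ez hz).
have -> : forall k v a, iter k E (a *: v) = a *: iter k E v.
  by elim=> // k IHk v a; rewrite !iterS IHk linearZ.
by rewrite hc scalerA.
Qed.

Lemma EFE y j : E (F y) = 0 ->
  E (F (iter j E y)) = j%:R *: (j.+1%:R *: iter j E y - H (iter j E y)).
Proof.
move=> h; elim: j => [|j IH]; first by rewrite h scale0r.
rewrite iterS; move: (iter j E y) IH => w IH.
have -> : F (E w) = E (F w) - H w by rewrite hEF addrK.
have -> : H (E w) = E (H w) + 2%:R *: E w := hHE w.
rewrite linearB IH linearZ linearB linearZ /=.
move: (E w) (E (H w)) => x z.
by apply/matrixP => a b; rewrite !mxE -[j.+2]addn2 -[j.+1]addn1 !natrD; ring.
Qed.

(** An induction on the order at which [E] kills [y] replaces complete reducibility. The top power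
    [z = iter j.+1 E y] has weight [j.+1]; subtracting from [y] a multiple of the last vector of its
    [F]-string, which [F] kills, lowers the order and leaves [F y] unchanged. *)
Lemma sl2_disjoint y : E (F y) = 0 -> F y = 0.
Proof.
have [a ha] := nilE y; case: a ha => [/= ->|j]; first by rewrite linear0.
elim: j y => [|j IH] y hj h.
  have hy : H y = 0 by have := hEF y; rewrite h /= in hj *; rewrite hj linear0 add0r.
  by apply: (hw_F (j := 0) hj); rewrite scale0r.
set z := iter j.+1 E y.
have ez : E z = 0 := hj.
have hz : H z = j.+1%:R *: z.
  have := EFE j.+1 h; rewrite -/z hEF ez linear0 add0r => h1.
  have /eqP : j.+2%:R *: (H z - j.+1%:R *: z) = 0.
    have -> : j.+2%:R *: (H z - j.+1%:R *: z) = H z - j.+1%:R *: (j.+2%:R *: z - H z).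
      move: (H z) => w; apply/matrixP => c b; rewrite !mxE -[j.+2]addn2 -[j.+1]addn1 !natrD; ring.
    by rewrite -h1 subrr.
  by rewrite scaler_eq0 (negbTE (natr_neq0 K0 _)) subr_eq0 => /eqP.
have [c c0 hc] := hw_EF ez hz (leqnn _).
pose y' := y - c^-1 *: iter j.+1 F z.
have Fy' : F y' = F y by have hf := hw_F ez hz; rewrite /= in hf; rewrite /y' linearB linearZ /= hf scaler0 subr0.
rewrite -Fy'; apply: IH; last by rewrite Fy'.
have iterB k u v b : iter k E (u - b *: v) = iter k E u - b *: iter k E v.
  by elim: k => // k IHk; rewrite !iterS IHk linearB linearZ.
by rewrite /y' iterB hc scalerA mulVf // scale1r subrr.
Qed.

End SL2.

Section Ad.
Variables (K : fieldType) (N : nat).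
Local Notation M := 'M[K]_N.
Hypothesis K0 : [pchar K] =i pred0.

Definition ad (x y : M) : M := x *m y - y *m x.

Lemma ad_linear x : linear (ad x).
Proof.
move=> a u v; rewrite /ad mulmxDr mulmxDl -scalemxAr -scalemxAl scalerBr.
by rewrite opprD addrACA.
Qed.
HB.instance Definition _ x := GRing.isLinear.Build K M M _ (ad x) (ad_linear x).

Lemma ad_nil (x : M) a v : x ^+ a = 0 -> iter a.*2 (ad x) v = 0.
Proof.
move=> xa.
pose Q m w := forall p q, (a.*2 <= p + q + m)%N -> x ^+ p *m w *m x ^+ q = 0.
have xb b : (a <= b)%N -> x ^+ b = 0 by move=> /subnKC<-; rewrite exprD xa mul0r.
have h m : Q m (iter m (ad x) v).
  elim: m => [|m IH] p q h.
    have : (a <= p)%N || (a <= q)%N by lia.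
    by case/orP => /xb->; rewrite ?mul0mx ?mulmx0.
  rewrite iterS /ad mulmxBr mulmxBl !mulmxA -[x ^+ p *m x]/(x ^+ p * x) -exprSr.
  rewrite -(mulmxA _ x (x ^+ q)) -[x *m x ^+ q]/(x * x ^+ q) -exprS !IH ?subrr //; lia.
by have := h a.*2 0%N 0%N (leqnn _); rewrite !expr0 -[1]/(1%:M) mul1mx mulmx1.
Qed.

(** The powers [f ^+ m] satisfy the eigenvector equation of [ad h] for the eigenvalues [m%:R * c];
    [N * N + 1] distinct ones are too many, so some power is zero. Nilpotency of [f] thus follows
    from the relations of the triple. *)
Lemma ad_eigen_nil (h f : M) (c : K) : c != 0 -> ad h f = c *: f -> exists m, f ^+ m = 0.
Proof.
move=> c0 hf.
have hk m : ad h (f ^+ m) = (m%:R * c) *: f ^+ m.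
  elim: m => [|m IH]; first by rewrite mul0r scale0r /ad expr0 -[1]/(1%:M) mulmx1 mul1mx subrr.
  have -> : ad h (f ^+ m.+1) = ad h f *m f ^+ m + f *m ad h (f ^+ m).
    by rewrite /ad exprS -[f * _]/(f *m f ^+ m) mulmxBl mulmxBr !mulmxA addrA subrK.
  rewrite hf IH -scalemxAl -scalemxAr -scalerDl exprS; congr (_ *: _).
  by rewrite -add1n natrD mulrDl mul1r.
case: (boolP [exists m : 'I_(N * N).+1, f ^+ m == 0]) => [/existsP[m /eqP hm]|]; first by exists m.
rewrite negb_exists => /forallP hn; exfalso.
have hr : all (root (char_poly (lin_mx (ad h)))) [seq m%:R * c | m <- iota 0 (N * N).+1].
  apply/allP => r /mapP[m]; rewrite mem_iota /= => hm ->.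
  rewrite -eigenvalue_root_char; apply/eigenvalueP; exists (mxvec (f ^+ m)).
    transitivity (mxvec (ad h (f ^+ m))); first exact: mul_vec_lin.
    by rewrite hk linearZ.
  by rewrite mxvec_eq0; apply: (hn (Ordinal hm)).
have hu : uniq [seq m%:R * c | m <- iota 0 (N * N).+1].
  by rewrite map_inj_uniq ?iota_uniq // => a b /(mulIf c0)/(natr_inj K0).
have p0 : char_poly (lin_mx (ad h)) != 0 by rewrite monic_neq0 // char_poly_monic.
by have := max_poly_roots p0 hr hu; rewrite size_char_poly size_map size_iota ltnn.
Qed.

Definition adl (x : M) := linfun (ad x).

Lemma adlE x y : adl x y = ad x y.
Proof. by rewrite /adl linfunE //; apply: ad_linear. Qed.

Lemma mem_cent (s : {vspace M}) x y : (y \in cent s x) = (y \in s) && (ad x y == 0).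
Proof. by rewrite memv_cap memv_ker adlE. Qed.

Lemma ad_sl2 (h e f v : M) : ad e f = h -> ad e (ad f v) = ad f (ad e v) + ad h v.
Proof.
move=> <-; rewrite /ad ?mulmxBl ?mulmxBr ?mulmxBl ?mulmxBr !mulmxA.
move: (e *m f *m v) (f *m v *m e) (v *m f *m e) (f *m e *m v) (e *m v *m f) (v *m e *m f) => a1 a2 a3 a4 a5 a6.
by apply/matrixP => i j; rewrite !mxE; ring.
Qed.

Lemma ad_comm_eigen (h e v : M) (c : K) : ad h e = c *: e -> ad h (ad e v) = ad e (ad h v) + c *: ad e v.
Proof.
move=> he; have -> : ad h (ad e v) = ad (ad h e) v + ad e (ad h v).
  rewrite /ad ?mulmxBl ?mulmxBr ?mulmxBl ?mulmxBr !mulmxA.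
  move: (h *m e *m v) (h *m v *m e) (e *m v *m h) (v *m e *m h) (e *m h *m v) (v *m h *m e) => a1 a2 a3 a4 a5 a6.
  by apply/matrixP => i j; rewrite !mxE; ring.
by rewrite he addrC; congr (_ + _); rewrite /ad -scalemxAl -scalemxAr -scalerBr.
Qed.

Section Triple.
Variables (e h f : M) (s : {vspace M}).
Hypothesis nile : exists a, e ^+ a = 0.
Hypothesis hef : ad e f = h.
Hypothesis hhe : ad h e = 2%:R *: e.
Hypothesis hhf : ad h f = - (2%:R *: f).
Hypothesis se : forall x, x \in s -> ad e x \in s.
Hypothesis sf : forall x, x \in s -> ad f x \in s.

Lemma nilf : exists a, f ^+ a = 0.
Proof.
apply: (@ad_eigen_nil h f (- 2%:R)); first by rewrite oppr_eq0 (natr_neq0 K0 1).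
by rewrite hhf scaleNr.
Qed.

Lemma ad_disjoint_ef y : ad e (ad f y) = 0 -> ad f y = 0.
Proof.
apply: (@sl2_disjoint K N K0 (ad e) (ad f) (ad h)).
- by move=> v; apply: ad_sl2.
- by move=> v; apply: ad_comm_eigen.
- by move=> v; rewrite -scaleNr; apply: ad_comm_eigen; rewrite hhf scaleNr.
- by move=> v; have [a ha] := nile; exists a.*2; apply: ad_nil.
by move=> v; have [a ha] := nilf; exists a.*2; apply: ad_nil.
Qed.

Lemma ad_disjoint_fe y : ad f (ad e y) = 0 -> ad e y = 0.
Proof.
have adN x v : ad (- x) v = - ad x v by rewrite /ad mulNmx mulmxN opprB opprK addrC.
apply: (@sl2_disjoint K N K0 (ad f) (ad e) (ad (- h))).
- by move=> v; apply: ad_sl2; rewrite -hef /ad opprB.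
- by move=> v; apply: ad_comm_eigen; rewrite adN hhf opprK.
- by move=> v; rewrite -scaleNr; apply: ad_comm_eigen; rewrite adN hhe scaleNr.
- by move=> v; have [a ha] := nilf; exists a.*2; apply: ad_nil.
by move=> v; have [a ha] := nile; exists a.*2; apply: ad_nil.
Qed.

Lemma img_sub x : (forall y, y \in s -> ad x y \in s) -> (adl x @: s <= s)%VS.
Proof. by move=> h1; apply/subvP => _ /memv_imgP[y ys ->]; rewrite adlE h1. Qed.

(** A subspace that meets the image of [ad y] trivially is no larger than the kernel of [ad y]. Used
    in both orders of [e] and [f], this makes the two centralisers equidimensional, so that
    [cent s f] complements the image of [ad e]. *)
Lemma cent_dim_aux x y : (forall z, z \in s -> ad y z \in s) ->
  (forall z, ad x (ad y z) = 0 -> ad y z = 0) ->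
  (cent s x :&: (adl y @: s) = 0)%VS /\ (\dim (cent s x) <= \dim (cent s y))%N.
Proof.
move=> sy hxy.
have h0 : (cent s x :&: (adl y @: s) = 0)%VS.
  apply/eqP; rewrite -subv0; apply/subvP => z /memv_capP[].
  rewrite mem_cent => /andP[_ /eqP hz] /memv_imgP[w _ hw].
  by rewrite memv0 hw adlE hxy // -(adlE y) -hw.
split=> //; rewrite -(leq_add2r (\dim (adl y @: s))) -dimv_disjoint_sum // limg_ker_dim.
by apply: dimvS; rewrite subv_add capvSl img_sub.
Qed.

Lemma cent_complement : (cent s f :&: (adl e @: s) = 0)%VS /\ (s <= cent s f + adl e @: s)%VS.
Proof.
have [h1 h2] := cent_dim_aux se ad_disjoint_fe.
have [_ h4] := cent_dim_aux sf ad_disjoint_ef.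
split=> //.
have hs : (cent s f + adl e @: s <= s)%VS by rewrite subv_add capvSl img_sub.
have : (cent s f + adl e @: s == s)%VS.
  by rewrite eqEdim hs dimv_disjoint_sum // -(limg_ker_dim (adl e) s) leq_add2r.
by move/eqP->.
Qed.

End Triple.
End Ad.

(** * The trace pairing and functions on the dual of a centraliser *)

Section Pairing.
Variables (K : fieldType) (N : nat).
Local Notation M := 'M[K]_N.
Hypothesis K0 : [pchar K] =i pred0.
Variable c : K.
Hypothesis c0 : c != 0.
Variables (A s : {vspace M}).
Hypothesis As : (A <= s)%VS.
Hypothesis nondeg : forall a, a \in s -> (forall x, x \in s -> \tr (a *m x) = 0) -> a = 0.

(** The functional [(., x)] on [A] in coordinates, that is, the point of the dual of [A] at which
    elements of [S(A)] are evaluated. *)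
Definition tv (x : M) : 'I_(\dim A) -> K := fun i => trform c (bas A i) x.

Lemma bas_mem (U : {vspace M}) i : bas U i \in U.
Proof. by apply: vbasis_mem; apply: mem_tnth. Qed.

Lemma tv_lin a x y i : tv (a *: x + y) i = a * tv x i + tv y i.
Proof. by rewrite /tv /trform mulmxDr -scalemxAr mxtraceD mxtraceZ mulrDr mulrCA. Qed.

Lemma tvZ a x i : tv (a *: x) i = a * tv x i.
Proof. by rewrite /tv /trform -scalemxAr mxtraceZ mulrCA. Qed.

Lemma tvD x y i : tv (x + y) i = tv x i + tv y i.
Proof. by rewrite /tv /trform mulmxDr mxtraceD mulrDr. Qed.

Lemma tv_sum (I : finType) (a : I -> K) (x : I -> M) i : tv (\sum_j a j *: x j) i = \sum_j a j * tv (x j) i.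
Proof.
rewrite /tv /trform mulmx_sumr linear_sum mulr_sumr; apply: eq_bigr => j _.
by rewrite -scalemxAr linearZ mulrCA.
Qed.

Lemma dual_basis : exists b : 'I_(\dim A) -> M,
  (forall l, b l \in s) /\ (forall i l, tv (b l) i = (i == l)%:R).
Proof.
pose P := \matrix_(i < \dim A, l < \dim s) trform c (bas A i) (bas s l).
have rP : row_free P.
  apply/inj_row_free => v hv.
  pose a := \sum_i v 0 i *: bas A i.
  have aA : a \in A by apply: rpred_sum => i _; apply: rpredZ; apply: bas_mem.
  have a0 : a = 0.
    apply: nondeg => [|x xs]; first exact: (subvP As).
    apply: (mulfI c0); rewrite mulr0 (coord_vbasis xs) mulmx_sumr linear_sum mulr_sumr big1 // => l _.
    rewrite /= -scalemxAr mxtraceZ mulrCA.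
    have := congr1 (fun w : 'rV_ _ => w 0 l) hv; rewrite !mxE => h.
    suff -> : c * \tr (a *m (vbasis s)`_l) = 0 by rewrite mulr0.
    rewrite -[RHS]h /a mulmx_suml linear_sum mulr_sumr; apply: eq_bigr => i _.
    by rewrite mxE /trform /bas -(tnth_nth 0) -scalemxAl /= mxtraceZ mulrCA.
  apply/rowP => i; rewrite mxE.
  have : free (vbasis A) by apply: basis_free (vbasisP A).
  move/freeP => /(_ (fun i => v 0 i)); apply.
  by rewrite -[RHS]a0; apply: eq_bigr => l _; rewrite /bas -tnth_nth.
have [Q hQ] := row_freeP rP.
exists (fun l => \sum_i Q i l *: bas s i); split=> [l|i l].
  by apply: rpred_sum => i _; apply: rpredZ; apply: bas_mem.
rewrite tv_sum; have := congr1 (fun w : 'M_ _ => w i l) hQ; rewrite !mxE => <-.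
by apply: eq_bigr => j _; rewrite mxE mulrC.
Qed.

(** The orthogonal of [s_e] in [s] contains [[e, s]] by invariance of the trace form, and both have
    dimension [\dim s - \dim A]. *)
Lemma tv_ker (e x : M) : A = cent s e -> (forall y, y \in s -> ad e y \in s) ->
  x \in s -> (forall i, tv x i = 0) -> exists2 y, y \in s & x = ad e y.
Proof.
move=> hA se xs hx.
have [b [bs hb]] := dual_basis.
pose W := (s :&: lker (linfun (fun y : M => \row_i tv y i)))%VS.
have tvl : linear (fun y : M => \row_i tv y i).
  by move=> a u v; apply/rowP => i; rewrite !mxE tv_lin.
have memW y : (y \in W) = (y \in s) && [forall i, tv y i == 0].
  rewrite memv_cap memv_ker linfunE //; congr (_ && _); apply/eqP/forallP => [h i|h].
    by have := congr1 (fun w : 'rV_ _ => w 0 i) h; rewrite !mxE => ->.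
  by apply/rowP => i; rewrite !mxE; apply/eqP.
have dW : (\dim W + \dim A <= \dim s)%N.
  rewrite -(limg_ker_dim (linfun (fun y : M => \row_i tv y i)) s) -/W leq_add2l.
  have -> : (linfun (fun y : M => \row_i tv y i) @: s)%VS = fullv.
    apply/vspaceP => w; rewrite memvf; apply/memv_imgP.
    exists (\sum_l w 0 l *: b l); first by apply: rpred_sum => l _; apply: rpredZ.
    rewrite linfunE //; apply/rowP => i; rewrite mxE tv_sum (bigD1 i) //= hb eqxx mulr1 big1 ?addr0 // => l li.
    by rewrite hb eq_sym (negbTE li) mulr0.
  by rewrite dimvf /dim /= mul1n.
have EW : (adl e @: s <= W)%VS.
  apply/subvP => _ /memv_imgP[y ys ->]; rewrite memW adlE se //=; apply/forallP => i.
  have := bas_mem i; rewrite {2}hA mem_cent => /andP[_ /eqP hi].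
  rewrite /tv /trform /ad mulmxBr linearB /= !mulmxA [X in _ - X]mxtrace_mulC mulmxA.
  have hi' : e *m bas A i = bas A i *m e by apply/eqP; rewrite -subr_eq0; apply/eqP; apply: hi.
  by rewrite hi' subrr mulr0.
have dA : (\dim A + \dim (adl e @: s) = \dim s)%N by rewrite hA limg_ker_dim.
have : (adl e @: s == W)%VS.
  by rewrite eqEdim EW -(leq_add2r (\dim A)) (leq_trans dW) // -dA addnC.
move/eqP => hW.
have : x \in W by rewrite memW xs; apply/forallP => i; rewrite hx.
by rewrite -hW => /memv_imgP[y ys ->]; exists y; rewrite ?adlE.
Qed.

Lemma poly_on_dual (b : 'I_(\dim A) -> M) (g : {mpoly K[N * N]}) :
  exists P : {mpoly K[\dim A]}, forall w, P.@[w] = g.@[vx (\sum_l w l *: b l)].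
Proof.
exists (comp_mpoly [tuple \sum_l (vx (b l) i) *: 'X_l | i < N * N] g) => w.
rewrite comp_mpoly_meval; apply: meval_eq => i; rewrite tnth_mktuple raddf_sum /= /vx linear_sum summxE.
by apply: eq_bigr => l _; rewrite mevalZ mevalXU linearZ mxE mulrC.
Qed.

End Pairing.

(** * Lowest components *)

Section Lowest.
Variables (K : fieldType) (m : nat).

Lemma bigmin_eq (I : eqType) (r : seq I) (f : I -> nat) x0 d : (d <= x0)%N ->
  (forall i, i \in r -> (d <= f i)%N) -> (exists2 i, i \in r & f i = d) ->
  \big[minn/x0]_(i <- r) f i = d.
Proof.
move=> d0 hr [i ir fi].
have h : (d <= \big[minn/x0]_(i <- r) f i)%N.
  rewrite big_seq; elim/big_ind: _ => // a b ha hb; by rewrite leq_min ha.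
apply/eqP; rewrite eqn_leq h andbT -fi; move: ir; clear; elim: r => // j r IH.
rewrite inE big_cons geq_min => /orP[/eqP->|/IH->]; by rewrite ?leqnn ?orbT.
Qed.

Lemma hcomp_coef (p : {mpoly K[m]}) mu : (hcomp (mdeg mu) p)@_mu = p@_mu.
Proof.
rewrite /hcomp raddf_sum /=.
transitivity (\sum_(nu <- msupp p | nu == mu) p@_nu).
  rewrite [LHS]big_mkcond [RHS]big_mkcond; apply: eq_bigr => nu _.
  case: (eqVneq nu mu) => [->|ne]; first by rewrite eqxx mcoeffZ mcoeffX eqxx mulr1.
  by case: ifP => // _; rewrite mcoeffZ mcoeffX (negbTE ne) mulr0.
case: (boolP (mu \in msupp p)) => h.
  rewrite -big_filter filter_pred1_uniq ?msupp_uniq // big_seq1 //.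
rewrite big_seq_cond big1 => [|nu /andP[h1 /eqP h2]]; first by rewrite memN_msupp_eq0.
by rewrite -h2 h1 in h.
Qed.

Lemma lowdeg_eq (p : {mpoly K[m]}) d : (forall d', (d' < d)%N -> hcomp d' p = 0) ->
  hcomp d p != 0 -> lowdeg p = d.
Proof.
move=> low nz.
have [mu mup md] : exists2 mu, mu \in msupp p & mdeg mu = d.
  case: (boolP (has (fun mu : 'X_{1..m} => mdeg mu == d) (msupp p))) => [/hasP[mu h /eqP]|]; first by exists mu.
  move/hasPn => h; case/eqP: nz; rewrite /hcomp big_seq_cond big1 // => mu /andP[/h /negbTE->].
  by [].
apply: bigmin_eq; last by exists mu.
  by rewrite -md ltnW // msize_mdeg_lt.
move=> nu nup; rewrite leqNgt; apply/negP => /low h0.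
by move: nup; rewrite mcoeff_msupp -hcomp_coef h0 mcoeff0 eqxx.
Qed.

End Lowest.

(** * The lowest components as elements of the symmetric algebra of a centraliser *)

Section EF.
Variables (K : closedFieldType) (N : nat) (Om e : 'M[K]_N).
Hypothesis K0 : [pchar K] =i pred0.
Hypothesis uOm : Om \in unitmx.
Hypothesis hnil : e ^+ N = 0.
Local Notation G := (invmx Om).
Variables (k : nat) (lam inv : nat -> nat) (eps : nat -> K) (ell : nat -> 'rV[K]_N).
Hypothesis jf : jordan_form G e k lam inv eps ell.
Local Notation dg := (dg k lam).
Variables (c : K) (s : {vspace 'M[K]_N}) (h f : 'M[K]_N).
Hypothesis c0 : c != 0.
Hypothesis nondeg : forall a, a \in s -> (forall x, x \in s -> \tr (a *m x) = 0) -> a = 0.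

(** [kinv] is an [epsilon], so its specification requires a witness: [Gen] at the zero matrix,
    pulled back along a basis of [s] dual for the trace form. *)
Lemma kinv_Delta j y : y \in s -> kappa c s (kinv c s s (Delta j)) y = Delta j y.
Proof.
move=> ys; apply: (epsilon_spec (inhabits 0) (fun P : {mpoly K[\dim s]} => forall y, (y \in s)%VS -> kappa c s P y = Delta j y)) => //.
have [b [bs hb]] := dual_basis c0 (subvv s) nondeg.
have [P hP] := poly_on_dual b (Gen (0 : 'M[K]_N) j).
exists P => x xs; rewrite /kappa hP Gen_meval add0r -DeltaE; congr (Delta j _).
apply/eqP; rewrite -subr_eq0; apply/eqP; set w := (X in X - _).
have ws : w - x \in s by apply: rpredB => //; apply: rpred_sum => l _; apply: rpredZ.
apply: nondeg => // a as'; rewrite mxtrace_mulC (coord_vbasis as') mulmx_suml linear_sum big1 // => i _.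
rewrite /= -scalemxAl mxtraceZ.
have hi : tv c (A := s) (w - x) i = 0.
  rewrite -scaleN1r addrC tv_lin /w tv_sum (bigD1 i) //= big1 ?addr0 => [|l li].
    by rewrite hb eqxx mulr1 mulN1r addNr.
  by rewrite hb eq_sym (negbTE li) mulr0.
move/eqP: hi; rewrite /tv /trform mulf_eq0 (negbTE c0) /bas (tnth_nth 0) => /eqP->.
by rewrite mulr0.
Qed.

Hypothesis es : e \in s.
Hypothesis hef : ad e f = h.
Hypothesis hhe : ad h e = 2%:R *: e.
Hypothesis hhf : ad h f = - (2%:R *: f).
Hypothesis se : forall x, x \in s -> ad e x \in s.
Hypothesis sf : forall x, x \in s -> ad f x \in s.

Variable j : nat.
Hypothesis hj : (0 < j <= N)%N.
Hypothesis nz : exists2 x, x \in s & F e j (dg j) x != 0.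

Lemma split_s x : x \in s -> exists2 y, y \in cent s f & exists2 z, z \in s & x = y + ad e z.
Proof.
move=> xs; have [_ h2] := cent_complement K0 (ex_intro _ N hnil) hef hhe hhf se sf.
have /memv_addP[y ys [w ws ->]] := subvP h2 _ xs.
by exists y => //; case/memv_imgP: ws => z zs ->; exists z; rewrite ?adlE.
Qed.

Lemma F_ad x z : F e j (dg j) (x + ad e z) = F e j (dg j) x.
Proof.
have -> : ad e z = (- z) *m e - e *m (- z) by rewrite /ad mulNmx mulmxN opprK addrC.
apply: (F_transl K0); first by case/andP: hj.
by move=> d x' dd; apply: (F_low K0 uOm hnil jf).
Qed.

Lemma tv_ad z i : tv c (A := cent s e) (ad e z) i = 0.
Proof.
have := bas_mem i; rewrite mem_cent => /andP[_ /eqP hi].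
rewrite /tv /trform /ad mulmxBr linearB /= !mulmxA [X in _ - X]mxtrace_mulC mulmxA.
have hi' : e *m bas (cent s e) i = bas (cent s e) i *m e by apply/eqP; rewrite -subr_eq0; apply/eqP; apply: hi.
by rewrite hi' subrr mulr0.
Qed.

Local Notation psi := (psi_poly c s e f (kinv c s s (Delta j))).

Lemma psi_meval t : psi.@[t] = DeltaR j (e + \sum_l t l *: bas (cent s f) l).
Proof.
have cs : (cent s f <= s)%VS := capvSl _ _.
rewrite -DeltaE -kinv_Delta; last first.
  by apply: rpredD => //; apply: rpred_sum => l _; apply: rpredZ; apply: (subvP cs); apply: bas_mem.
rewrite /psi_poly comp_mpoly_meval; apply: meval_eq => i; rewrite tnth_mktuple.
transitivity (tv c (A := s) e i + \sum_l t l * tv c (A := s) (bas (cent s f) l) i); last by rewrite -tv_sum -tvD.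
rewrite mevalD mevalC raddf_sum /=; congr (_ + _); apply: eq_bigr => l _.
by rewrite mevalZ mevalXU mulrC.
Qed.

Lemma hcomp_psi d t : (hcomp d psi).@[t] = F e j d (\sum_l t l *: bas (cent s f) l).
Proof.
rewrite hcompE -(line_pihomog K0); apply/esym/(Fpoly_uniq K0) => a _.
rewrite line_horner psi_meval; congr (DeltaR j (e + _)); rewrite scaler_sumr; apply: eq_bigr => l _.
by rewrite add0r scalerA.
Qed.

(** A point of [s] at which the component is nonzero is moved into [s_f] by a translation along
    [[e, s]], which preserves the value. *)
Lemma lowdeg_psi : lowdeg psi = dg j.
Proof.
apply: lowdeg_eq => [d dd|].
  apply: (meval_eq0 K0) => t; rewrite hcomp_psi; exact: (F_low K0 uOm hnil jf).
case: nz => x xs; apply: contraNneq => hz.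
have [y yf [z zs ->]] := split_s xs.
rewrite F_ad (coord_vbasis yf).
have := hcomp_psi (dg j) (fun l => coord (vbasis (cent s f)) l y); rewrite hz meval0 => ->.
by apply/eqP; congr F; apply: eq_bigr => l _; rewrite /bas (tnth_nth 0).
Qed.

Lemma inpsi_F y : y \in cent s f -> inpsi c s e f (kinv c s s (Delta j)) y = F e j (dg j) y.
Proof.
move=> yf; rewrite /inpsi /inlow lowdeg_psi hcomp_psi [in RHS](coord_vbasis yf).
by congr F; apply: eq_bigr => l _; rewrite /bas (tnth_nth 0).
Qed.

(** The component is constant along [[e, s]], the kernel of [tv], so it is a polynomial in [tv x];
    this is the witness for the [epsilon] inside [eF]. As [s = s_f + [e, s]], agreement on [s_f]
    suffices. *)
Lemma eF_F x : x \in s ->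
  (eF c s e f (kinv c s s (Delta j))).@[tv c (A := cent s e) x] = F e j (dg j) x.
Proof.
have [b [bs hb]] := dual_basis c0 (capvSl s _ : (cent s e <= s)%VS) nondeg.
have [P hP] := poly_on_dual b (Gd e j (dg j)).
have hPF y : y \in s -> P.@[tv c (A := cent s e) y] = F e j (dg j) y.
  move=> ys; rewrite hP (Gd_meval K0); set w := (X in F _ _ _ X).
  have ws : w - y \in s by apply: rpredB => //; apply: rpred_sum => l _; apply: rpredZ.
  have hw i : tv c (A := cent s e) (w - y) i = 0.
    rewrite -scaleN1r addrC tv_lin /w tv_sum (bigD1 i) //= big1 ?addr0 => [|l li].
      by rewrite hb eqxx mulr1 mulN1r addNr.
    by rewrite hb eq_sym (negbTE li) mulr0.
  have [z zs hz] := tv_ker c0 (capvSl s _ : (cent s e <= s)%VS) nondeg erefl se ws hw.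
  by rewrite -(subrK y w) hz addrC F_ad.
have hE y : y \in cent s f -> kappa c (cent s e) (eF c s e f (kinv c s s (Delta j))) y = F e j (dg j) y.
  move=> yf; rewrite -inpsi_F //.
  apply: (epsilon_spec (inhabits 0) (fun P : {mpoly K[\dim (cent s e)]} => forall y, (y \in cent s f)%VS ->
    kappa c (cent s e) P y = inpsi c s e f (kinv c s s (Delta j)) y)) => //.
  exists P => z zf; rewrite inpsi_F // -hPF //; exact: (subvP (capvSl _ _)) zf.
move=> xs; have [y yf [z zs ->]] := split_s xs.
rewrite F_ad -hE // /kappa; apply: meval_eq => i.
by rewrite tvD tv_ad addr0.
Qed.

Lemma eF_homog : eF c s e f (kinv c s s (Delta j)) \is (dg j).-homog.
Proof.
have [b [bs hb]] := dual_basis c0 (capvSl s _ : (cent s e <= s)%VS) nondeg.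
apply: (homog_of_scale K0) => t a.
pose x := \sum_l a l *: b l.
have xs : x \in s by apply: rpred_sum => l _; apply: rpredZ.
have ha i : tv c (A := cent s e) x i = a i.
  rewrite /x tv_sum (bigD1 i) //= hb eqxx mulr1 big1 ?addr0 // => l li.
  by rewrite hb eq_sym (negbTE li) mulr0.
rewrite -(meval_eq _ ha) eF_F // -F_homog // -eF_F; last exact: rpredZ.
by apply: meval_eq => i; rewrite tvZ ha.
Qed.

Lemma deg_eF : deg (eF c s e f (kinv c s s (Delta j))) = dg j.
Proof.
have [x xs hx] := nz.
have h0 : eF c s e f (kinv c s s (Delta j)) != 0.
  by apply: contraNneq hx => h0; rewrite -eF_F // h0 meval0.
apply: (dhomog_uniq h0 _ eF_homog).
exact: (dhomog_msize eF_homog).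
Qed.

End EF.

Lemma quad_horner (K : fieldType) (a b d u t : K) :
  (a%:P + u *: (b *: 'X) - d *: 'X^2).[t] = a + (u * t * b + (- t ^+ 2) * d).
Proof.
rewrite hornerD hornerN hornerZ hornerXn hornerD hornerZ hornerZ hornerX hornerC.
by rewrite mulNr [t ^+ 2 * d]mulrC mulrA mulrAC addrA.
Qed.

Lemma quad_coef1 (K : fieldType) (a b d u : K) :
  (a%:P + u *: (b *: 'X) - d *: 'X^2)`_1 = u * b.
Proof. by rewrite !coefE /= mulr1 mulr0 add0r subr0. Qed.

(** * Invariants *)

Section Cofinite.
Variables (K : fieldType) (N : nat).
Hypothesis K0 : [pchar K] =i pred0.

Lemma poly_eq_generic (d p q : {poly K}) : d != 0 ->
  (forall t, d.[t] != 0 -> p.[t] = q.[t]) -> p = q.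
Proof.
move=> d0 h; apply: (mulfI d0); apply: (poly_fun_inj K0) => t _.
rewrite !hornerM; case: (eqVneq d.[t] 0) => [->|/h->//].
by rewrite !mul0r.
Qed.

Lemma conj_mulr (u z : 'M[K]_N) : u \in unitmx -> u *m (z *m u) *m invmx u = u *m z.
Proof. by move=> uu; rewrite mulmxA mulmxK. Qed.

(** Being nonzero, it confines the [t] for which [1 + t x] is singular to the roots of a polynomial,
    so [poly_eq_generic] may ignore them. *)
Definition unip (x : 'M[K]_N) : {poly K} := \det (1%:M + 'X *: map_mx polyC x).

Lemma unip_horner x t : (unip x).[t] = \det (1%:M + t *: x).
Proof.
rewrite -[LHS]/(horner_eval t _) -det_map_mx; congr (\det _).
apply/matrixP => a b; rewrite !mxE /= /horner_eval hornerD hornerM hornerX !hornerC.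
by rewrite hornerMn hornerC.
Qed.

Lemma unip_neq0 x : unip x != 0.
Proof.
apply: contraTneq isT => h; have := unip_horner x 0; rewrite h horner0 scale0r addr0 det1.
by move/eqP; rewrite eq_sym oner_eq0.
Qed.

End Cofinite.

Lemma trform_nondeg (K : fieldType) N (a : 'M[K]_N) : (forall x, \tr (a *m x) = 0) -> a = 0.
Proof.
move=> h1; apply/matrixP => i j; rewrite mxE -[RHS](h1 (delta_mx j i)) mxtrace_mulC.
rewrite /mxtrace (bigD1 j) //= big1 ?addr0 => [|l lj].
  by rewrite mxE (bigD1 i) //= big1 ?addr0 => [|r ri]; rewrite !mxE ?eqxx ?mul1r // (negbTE ri) andbF mul0r.
by rewrite mxE big1 // => r _; rewrite mxE (negbTE lj) mul0r.
Qed.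

Section EvenIndex.
Variable n : nat.
Local Notation N := n.*2.

Definition jr (r : 'I_n) := (2 * r.+1)%N.

Lemma cr_proof (r : 'I_n) : (r.*2.+1 < N)%N.
Proof. by have := ltn_ord r; lia. Qed.

Definition cr r : 'I_N := Ordinal (cr_proof r).

Lemma jrE r : jr r = (cr r).+1.
Proof. by rewrite /jr /=; lia. Qed.

Lemma jr_le r : (0 < jr r <= N)%N.
Proof. by rewrite jrE ltn_ord. Qed.

Lemma jr_even r : ~~ odd (jr r).
Proof. by rewrite /jr mul2n odd_double. Qed.

End EvenIndex.

Section Core.
Variables (K : closedFieldType) (n : nat).
Local Notation N := n.*2.
Variables (Om e : 'M[K]_N).
Hypothesis K0 : [pchar K] =i pred0.
Hypothesis uOm : Om \in unitmx.
Hypothesis hOm : Om^T = - Om.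
Hypothesis he : sig Om e = e.
Hypothesis hnil : e ^+ N = 0.
Local Notation G := (invmx Om).
Variables (k : nat) (lam inv : nat -> nat) (eps : nat -> K) (ell : nat -> 'rV[K]_N).
Hypothesis jf : jordan_form G e k lam inv eps ell.
Local Notation dg := (dg k lam).
Local Notation al := (al Om k inv eps ell).
Local Notation be := (be Om k inv eps ell).
Local Notation dF := (dF e k lam).

Lemma spP x : reflect (sig Om x = x) (x \in sp Om).
Proof. by rewrite spE //; apply: eqP. Qed.

Lemma sp_nondeg a : a \in sp Om -> (forall x, x \in sp Om -> \tr (a *m x) = 0) -> a = 0.
Proof.
move=> /spP sa h; have n2 := natr_neq0 K0 1.
have h1 x : \tr (a *m x) = 0.
  have hs : \tr (a *m sig Om x) = \tr (a *m x).
    have -> : a *m sig Om x = - sig Om (x *m a) by rewrite sigM // sa opprK.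
    by rewrite linearN /= mxtrace_sig // opprK mxtrace_mulC.
  have := h (spproj Om x) (spproj_sp uOm hOm x).
  rewrite /spproj -scalemxAr mxtraceZ mulmxDr mxtraceD hs => /eqP.
  rewrite mulf_eq0 invr_eq0 (negbTE n2) /= -mulr2n -mulr_natl mulf_eq0 (negbTE n2).
  by move/eqP.
exact: trform_nondeg.
Qed.

Definition cst (r : 'I_n) : K := (-1) ^+ (cr r) * \prod_(i < bk k lam (cr r)) sub_be k inv eps i.

Lemma cst_neq0 (r : 'I_n) : cst r != 0.
Proof.
rewrite mulf_neq0 ?signr_eq0 //; apply/prodf_neq0 => i _; apply: (sub_be_neq0 K0 uOm jf).
have [b1 _ _ _] := bkP uOm jf (cr r); have := ltn_ord i; lia.
Qed.

Local Notation vdir := (vdir Om e k lam inv eps ell).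
Local Notation wdir := (wdir Om e k lam inv eps ell).

Let sb : sig Om be = be := sig_be uOm hOm k inv eps ell.
Let sa : sig Om al = al := sig_al uOm hOm he jf.

Lemma dF_jr (r : 'I_n) x v : sig Om x = x -> dF (jr r) x (spproj Om v) = dF (jr r) x v.
Proof. by move=> sx; rewrite dF_spproj ?jr_even //; case/andP: (jr_le r). Qed.

Lemma dF_cr s t (r r' : 'I_n) : (r <= r')%N -> dF (jr r) (s *: al + t *: be) (vdir (cr r')) =
  if r == r' then cst r * t ^+ (dg (jr r)).-1 else 0.
Proof.
move=> rr; rewrite jrE (dF_vdir K0 uOm hnil jf) /=; last by lia.
by rewrite -val_eqE /= eqSS (inj_eq double_inj) val_eqE.
Qed.

(** If the component vanished on [sp], so would its derivative at [be] along directions of [sp];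
    along the projection of [vdir (cr r)] this derivative is the nonzero constant [cst r]. *)
Lemma F_nz (r : 'I_n) : exists2 x, x \in sp Om & F e (jr r) (dg (jr r)) x != 0.
Proof.
apply: Classical_Prop.NNPP => h.
have hF x : sig Om x = x -> F e (jr r) (dg (jr r)) x = 0.
  move=> sx; apply/eqP/negPn/negP => hx; apply: h; exists x => //; exact/spP.
have h1 : dF (jr r) be (spproj Om (vdir (cr r))) = 0.
  apply: (dF_uniq K0 (c0 := 0)) => t _; rewrite mulr0 addr0 hF //.
  by rewrite sigD sigZ sb sig_spproj.
have := dF_cr 0 1 (leqnn r); rewrite scale0r add0r scale1r -dF_jr // h1 eqxx expr1n mulr1.
by move/esym/eqP; rewrite (negbTE (cst_neq0 r)).
Qed.

Variable c : K.
Hypothesis c0 : c != 0.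
Variable A : {vspace 'M[K]_N}.
Hypothesis memA : forall x, (x \in A) = (x \in sp Om) && (ad e x == 0).
Local Notation m := (\dim A).
Local Notation tv := (tv c (A := A)).
Variable H : 'I_n -> {mpoly K[m]}.
Hypothesis hH : forall r x, x \in sp Om -> (H r).@[tv x] = F e (jr r) (dg (jr r)) x.

Lemma A_sp : (A <= sp Om)%VS.
Proof. by apply/subvP => x; rewrite memA => /andP[]. Qed.

Lemma A_sig x : x \in A -> sig Om x = x.
Proof. by rewrite memA => /andP[/spP]. Qed.

Lemma A_comm x : x \in A -> e *m x = x *m e.
Proof. by rewrite memA => /andP[_]; rewrite /ad subr_eq0 => /eqP. Qed.

Lemma mem_A x : sig Om x = x -> e *m x = x *m e -> x \in A.
Proof. by move=> sx ex; rewrite memA /ad ex subrr eqxx andbT; apply/spP. Qed.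

Lemma sig_ad x y : sig Om x = x -> sig Om y = y -> sig Om (ad x y) = ad x y.
Proof.
move=> sx sy; have hN z : sig Om (- z) = - sig Om z by rewrite -scaleN1r sigZ scaleN1r.
by rewrite /ad sigD hN !sigM // sx sy opprK addrC.
Qed.

Lemma ad_A x y : x \in A -> y \in A -> ad x y \in A.
Proof.
move=> xA yA; apply: mem_A; first by rewrite sig_ad ?A_sig.
have ex := A_comm xA; have ey := A_comm yA.
rewrite /ad mulmxBl mulmxBr !mulmxA ex ey -!mulmxA ex ey.
by [].
Qed.

Lemma tv_surj a : exists2 x, sig Om x = x & forall i, tv x i = a i.
Proof.
have [b [bs hb]] := dual_basis c0 A_sp sp_nondeg.
exists (\sum_l a l *: b l) => [|i].
  by apply/spP; apply: rpred_sum => l _; apply: rpredZ.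
rewrite tv_sum (bigD1 i) //= hb eqxx mulr1 big1 ?addr0 // => l li.
by rewrite hb eq_sym (negbTE li) mulr0.
Qed.

Lemma tv_ext (p q : {mpoly K[m]}) : (forall x, sig Om x = x -> p.@[tv x] = q.@[tv x]) -> p = q.
Proof.
move=> h; apply: (meval_inj K0) => t; have [x sx hx] := tv_surj t.
by rewrite -(meval_eq _ hx) -[RHS](meval_eq _ hx) h.
Qed.

Lemma H_homog r : H r \is (dg (jr r)).-homog.
Proof.
apply: (homog_of_scale K0) => t a; have [x sx hx] := tv_surj a.
rewrite -(meval_eq _ hx) hH -?(F_homog K0) -?hH; try exact/spP; last first.
  by apply/spP; rewrite sigZ sx.
by apply: meval_eq => i; rewrite tvZ hx.
Qed.

Lemma dg_gt0 (r : 'I_n) : (0 < dg (jr r))%N.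
Proof. by have [] := dgP jf (jr_le r). Qed.

Lemma der_tv r x v : sig Om x = x -> sig Om v = v -> der (H r) (tv x) (tv v) = dF (jr r) x v.
Proof.
move=> sx sv; rewrite /dF -!line1.
suff -> : line (tv x) (tv v) (H r) = line (vx x) (vx v) (Gd e (jr r) (dg (jr r))) by [].
apply: (poly_fun_inj K0) => t _.
rewrite !line_horner.
transitivity ((H r).@[tv (x + t *: v)]).
  by apply: meval_eq => i; rewrite tvD tvZ.
rewrite hH -?(Gd_meval K0); last by apply/spP; rewrite sigD sigZ sx sv.
by apply: meval_eq => i; rewrite vx_lin.
Qed.

(** For [g = 1 + t y] the matrices [x g] and [g x] are conjugate under [g], which commutes with [e].
    So the component agrees along the lines in directions [x *m y] and [y *m x], and no expansion of
    the inverse of [g] is needed. *)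
Lemma dF_ad (r : 'I_n) x y : e *m y = y *m e -> dF (jr r) x (ad x y) = 0.
Proof.
move=> ey; have jN : (jr r <= N)%N by case/andP: (jr_le r).
have h : dF (jr r) x (x *m y) = dF (jr r) x (y *m x).
  rewrite /dF -!line1; set l := line _ _ _; set l' := line _ _ _.
  suff -> : l = l' by []; apply: (poly_eq_generic K0 (unip_neq0 y)) => t; rewrite /l /l'.
  rewrite unip_horner => ut; rewrite !line_horner.
  have hl w : (Gd e (jr r) (dg (jr r))).@[fun i => vx x i + t * vx w i] = F e (jr r) (dg (jr r)) (x + t *: w).
    by rewrite -(Gd_meval K0); apply: meval_eq => i; rewrite vx_lin.
  have ug : 1%:M + t *: y \in unitmx by rewrite unitmxE unitfE.
  have ge : (1%:M + t *: y) *m e = e *m (1%:M + t *: y).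
    by rewrite mulmxDl mulmxDr mul1mx mulmx1 -scalemxAl -scalemxAr ey.
  have E1 : x + t *: (x *m y) = x *m (1%:M + t *: y) by rewrite mulmxDr mulmx1 scalemxAr.
  have E2 : x + t *: (y *m x) = (1%:M + t *: y) *m x by rewrite mulmxDl mul1mx scalemxAl.
  rewrite !hl E1 E2 -[LHS](F_conj K0 _ _ jN ug ge).
  exact: (congr1 (F e (jr r) (dg (jr r))) (conj_mulr x ug)).
have -> : ad x y = \sum_(i < 2) (if i == 0 then 1 else -1) *: (if i == 0 then x *m y else y *m x).
  by rewrite big_ord_recl big_ord1 /= scale1r scaleN1r.
by rewrite dF_sum big_ord_recl big_ord1 /= h mul1r mulN1r subrr.
Qed.

Definition V1 : 'M[K]_(m, n) := \matrix_(i, r) tv (spproj Om (vdir (cr r))) i.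

Lemma jac_meval (V : 'M[K]_(m, n)) x (v : 'I_n -> 'M[K]_N) : sig Om x = x ->
  (forall i r, V i r = tv (spproj Om (v r)) i) ->
  (jdet H V).@[tv x] = \det (\matrix_(r, r') dF (jr r) x (v r')).
Proof.
move=> sx hV; rewrite /jdet -det_map_mx; congr (\det _); apply/matrixP => r r'.
rewrite [LHS]mxE [RHS]mxE -dF_jr // -der_tv ?sig_spproj // mxE raddf_sum.
by apply: eq_bigr => i _; rewrite !mxE /= mevalM mevalC hV.
Qed.

Lemma V1_det s t : (jdet H V1).@[fun i => s * tv al i + t * tv be i] =
  (\prod_r cst r) * t ^+ wt (fun r : 'I_n => dg (jr r)).
Proof.
transitivity ((jdet H V1).@[tv (s *: al + t *: be)]).
  by apply: meval_eq => i; rewrite tvD !tvZ.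
rewrite (@jac_meval _ _ (fun r => vdir (cr r))); first last.
- by move=> i r; rewrite mxE.
- by rewrite sigD !sigZ sa sb.
rewrite det_trig; last first.
  by apply/is_trig_mxP => r r' rr; rewrite mxE dF_cr ?(ltnW rr) // -val_eqE /= (ltn_eqF rr).
rewrite /wt -prodrXr -big_split; apply: eq_bigr => r _.
by rewrite mxE dF_cr // eqxx.
Qed.

(** By [dF_wdir_inj] the derivatives at [al] of all [N] lowest components along the [wdir] form an
    invertible matrix. Its inverse provides directions for which the block of even indices is the
    identity. *)
Lemma V2_exists : exists V2 : 'M[K]_(m, n), (jdet H V2).@[tv al] != 0.
Proof.
pose Dal : 'M[K]_N := \matrix_(c', c) dF c'.+1 al (wdir c).
have uD : Dal^T \in unitmx.
  rewrite -row_free_unit; apply/inj_row_free => v hv; apply/rowP => i; rewrite mxE.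
  apply: (dF_wdir_inj K0 uOm hnil jf (v := fun i => v 0 i)) => c'.
  have hv' : (v *m Dal^T) 0 c' = 0 by rewrite hv mxE.
  by rewrite -[RHS]hv' [RHS]mxE; apply: eq_bigr => l _; rewrite !mxE.
rewrite unitmx_tr in uD.
pose Q := invmx Dal *m \matrix_(c', r) (c' == cr r)%:R : 'M[K]_(N, n).
exists (\matrix_(i, r) tv (spproj Om (\sum_l Q l r *: wdir l)) i).
rewrite (@jac_meval _ _ (fun r => \sum_l Q l r *: wdir l)) //; last by move=> i r; rewrite mxE.
have -> : \matrix_(r, r') dF (jr r) al (\sum_l Q l r' *: wdir l) = 1%:M.
  apply/matrixP => r r'; rewrite mxE dF_sum.
  have : (Dal *m Q) (cr r) r' = (r == r')%:R.
    rewrite /Q mulKVmx // mxE -[in LHS]val_eqE /= eqSS (inj_eq double_inj) val_eqE.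
    by [].
  move=> hQ; rewrite [RHS]mxE -hQ [RHS]mxE; apply: eq_bigr => l _.
  by rewrite [Dal _ _]mxE -jrE mulrC.
by rewrite det1 oner_neq0.
Qed.

Theorem core_codim2 : codim_ge2 (dep_locus H).
Proof.
have [V2 hV2] := V2_exists.
apply: (dep_locus_codim2 K0 H_homog _ V1_det hV2).
by apply/prodf_neq0 => r _; apply: cst_neq0.
Qed.

(* [grad P *m Mst = 0] expresses the invariance of [P] under [A]. *)
Definition Mst : 'M[{mpoly K[m]}]_m := \matrix_(i, l) lin A (@ad K N (bas A l) (bas A i)).

Lemma lin_meval v x : v \in A -> (lin A v).@[tv x] = trform c v x.
Proof.
move=> vA; rewrite /lin raddf_sum /= {2}(coord_vbasis vA) /trform mulmx_suml linear_sum mulr_sumr.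
apply: eq_bigr => i _; rewrite mevalZ mevalXU -scalemxAl /= mxtraceZ.
by rewrite /tv /trform /bas (tnth_nth 0) mulrCA.
Qed.

Lemma trform_ad (a b x : 'M[K]_N) : trform c (ad a b) x = trform c b (ad x a).
Proof.
rewrite /trform /ad mulmxBl mulmxBr !raddfB /=; congr (_ * (_ - _)).
  by rewrite -mulmxA mxtrace_mulC -mulmxA.
by rewrite mulmxA.
Qed.

Lemma Mst_homog i l : Mst i l \is 1.-homog.
Proof.
rewrite mxE /lin; apply: rpred_sum => a _; apply: rpredZ.
have h : ('X_a : {mpoly K[m]}) \is 1.-homog by rewrite dhomogX /= mdeg1.
exact: h.
Qed.

Lemma grad_Mst (P : {mpoly K[m]}) x l : sig Om x = x ->
  ((grad P *m Mst) 0 l).@[tv x] = der P (tv x) (tv (ad x (bas A l))).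
Proof.
move=> sx; rewrite mxE raddf_sum; apply: eq_bigr => i _.
rewrite !mxE /= mevalM lin_meval ?ad_A ?bas_mem // trform_ad.
by [].
Qed.

Lemma jac_Mst : jac H *m Mst = 0.
Proof.
apply/matrixP => r l; rewrite [RHS]mxE; apply: tv_ext => x sx.
have -> : (jac H *m Mst) r l = (grad (H r) *m Mst) 0 l.
  by rewrite !mxE; apply: eq_bigr => i _; rewrite !mxE.
have bA := bas_mem l.
rewrite grad_Mst // der_tv ?sig_ad ?(A_sig bA) // meval0 dF_ad //.
exact: A_comm.
Qed.

Local Notation stab := (stab Om e k inv eps ell).

Lemma stab_ker (w : 'rV[K]_m) : w *m map_mx (meval (tv al)) Mst = 0 ->
  stab (\sum_i w 0 i *: bas A i).
Proof.
move=> hw; set x := \sum_i _.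
have xA : x \in A by apply: rpred_sum => i _; apply: rpredZ; apply: bas_mem.
split; [exact: A_sig|exact: A_comm|] => y sy ey.
have yA := mem_A sy ey.
apply: (mulfI c0); rewrite mulr0 (coord_vbasis yA) mulmx_sumr mulmx_suml -sumrB mulmx_sumr linear_sum mulr_sumr big1 // => l _.
rewrite /= -scalemxAr -scalemxAl -scalerBr -scalemxAr mxtraceZ mulrCA.
have h1 := congr1 (fun z : 'rV_ _ => z 0 l) hw; rewrite [RHS]mxE in h1.
suff -> : c * \tr (al *m (x *m (vbasis A)`_l - (vbasis A)`_l *m x)) = 0 by rewrite mulr0.
have -> : (vbasis A)`_l = bas A l by rewrite /bas (tnth_nth 0).
have -> : x *m bas A l - bas A l *m x = - ad (bas A l) x by rewrite /ad opprB.
rewrite mulmxN linearN /= mxtrace_mulC mulrN -/(trform c (ad (bas A l) x) al).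
apply/eqP; rewrite oppr_eq0 -[X in _ == X]h1 mxE trform_ad /x /trform mulmx_suml linear_sum mulr_sumr.
apply/eqP; apply: eq_bigr => i _.
rewrite !mxE lin_meval ?ad_A ?bas_mem // trform_ad /trform -scalemxAl /= mxtraceZ mulrCA.
by [].
Qed.

Lemma bas_indep (w : 'rV[K]_m) : \sum_i w 0 i *: bas A i = 0 -> w = 0.
Proof.
move=> h; apply/rowP => i; rewrite mxE.
have : free (vbasis A) by apply: basis_free (vbasisP A).
move/freeP => /(_ (fun i => w 0 i)); apply.
by rewrite -[RHS]h; apply: eq_bigr => l _; rewrite /bas -tnth_nth.
Qed.

(* The gradients of the [H i] at [al] already fill the [n]-dimensional stabiliser of [al]. *)
Lemma index_al (V2 : 'M[K]_(m, n)) (w : 'rV[K]_m) : (jdet H V2).@[tv al] != 0 ->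
  w *m map_mx (meval (tv al)) Mst = 0 -> w *m V2 = 0 -> w = 0.
Proof.
move=> hV hM hw; apply/eqP/negPn/negP => w0.
pose J := map_mx (meval (tv al)) (jac H).
have hJV : J *m V2 \in unitmx.
  move: hV; rewrite /jdet -det_map_mx map_mxM unitmxE unitfE.
  by have -> : map_mx (meval (tv al)) (map_mx (@mpolyC m K) V2) = V2 by apply/matrixP => i j; rewrite !mxE mevalC.
have hJM : J *m map_mx (meval (tv al)) Mst = 0.
  by rewrite /J -map_mxM jac_Mst map_mx0.
(* As [J *m V2] is invertible and [w *m V2 = 0], a nonzero [w] is independent of the rows of [J].
   This would give [n + 1] independent elements of the stabiliser, against [stab_dim]. *)
pose B := col_mx w J.
have rB : forall v : 'rV[K]_(1 + n), v *m B = 0 -> v = 0.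
  move=> v; rewrite -[v]hsubmxK /B mul_row_col => hv.
  have h1 : rsubmx v = 0.
    have := congr1 (fun z => z *m V2) hv; rewrite /= mulmxDl -!mulmxA hw mulmx0 add0r mul0mx.
    by move/(congr1 (fun z => z *m invmx (J *m V2))); rewrite mulmxK // mul0mx.
  rewrite h1 mul0mx addr0 in hv *.
  have : lsubmx v = 0; last by move->; rewrite row_mx0.
  move: hv; rewrite [lsubmx v]mx11_scalar mul_scalar_mx => /eqP.
  by rewrite scaler_eq0 (negbTE w0) orbF => /eqP ->; apply/matrixP => i j; rewrite !mxE mul0rn.
have := @stab_dim K N Om e K0 uOm hOm he k lam inv eps ell jf (1 + n) (fun a => \sum_i B a i *: bas A i).
have -> : ((1 + n).*2 <= N)%N = false by lia.
move=> h; suff: false by []; apply: h.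
  move=> a.
  have -> : \sum_i B a i *: bas A i = \sum_i (row a B) 0 i *: bas A i.
    by apply: eq_bigr => i _; rewrite [row _ _ _ _]mxE.
  apply: stab_ker; rewrite -row_mul /B mul_col_mx hM hJM col_mx0.
  by rewrite row0.
move=> v hv a.
have : (\row_a v a) *m B = 0.
  apply: bas_indep; rewrite -[RHS]hv.
  under [RHS]eq_bigr do rewrite scaler_sumr.
  rewrite exchange_big /=; apply: eq_bigr => i _; rewrite mxE scaler_suml; apply: eq_bigr => b _.
  by rewrite mxE scalerA.
move/rB/(congr1 (fun z : 'rV_ _ => z 0 a)); rewrite !mxE.
by [].
Qed.

Lemma lie_inv_grad P : lie_inv A P -> grad P *m Mst = 0.
Proof.
move=> hP; apply/rowP => l; rewrite [RHS]mxE -[RHS](hP (bas A l) (bas_mem l)) mxE.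
by apply: eq_bigr => i _; rewrite !mxE.
Qed.

Theorem core_lie_in P : lie_inv A P -> in_subalg H P.
Proof.
move=> /lie_inv_grad hP; have [V2 hV2] := V2_exists.
apply: (inv_in_subalg K0 H_homog dg_gt0 _ V1_det hV2 Mst_homog jac_Mst _ hP).
  by apply/prodf_neq0 => r _; apply: cst_neq0.
by move=> w; apply: index_al.
Qed.

Lemma conj_sp g x : Ge Om e g -> sig Om x = x -> g \in unitmx /\ sig Om (invmx g *m x *m g) = invmx g *m x *m g.
Proof.
case=> hg hge sx.
have ug : g \in unitmx.
  have : \det (g^T *m Om *m g) != 0 by rewrite hg -unitfE -unitmxE.
  by rewrite !det_mulmx mulf_eq0 negb_or => /andP[_]; rewrite unitmxE unitfE.
split=> //.
have sg : sig Om g = - invmx g.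
  rewrite /sig; congr (- _).
  have E1 : g^T *m Om = Om *m invmx g by rewrite -[in RHS]hg mulmxK.
  by rewrite -mulmxA E1 mulKmx.
have sgi : sig Om (invmx g) = - g.
  by rewrite -[invmx g]opprK -scaleN1r sigZ -sg sig_sig // scaleN1r.
by rewrite !sigM // sx sg sgi !(mulmxN, mulNmx, opprK) mulmxA.
Qed.

Lemma comp_conj P g x : Ge Om e g -> sig Om x = x ->
  (comp_mpoly [tuple lin A (g *m bas A i *m invmx g) | i < m] P).@[tv x] = P.@[tv (invmx g *m x *m g)].
Proof.
move=> hg sx; have [ug _] := conj_sp hg sx; case: (hg) => hgO hge.
rewrite comp_mpoly_meval; apply: meval_eq => i; rewrite tnth_mktuple lin_meval.
  rewrite /trform /tv /trform -!mulmxA mxtrace_mulC -!mulmxA; congr (_ * \tr _).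
have bA := bas_mem i.
apply: mem_A.
  have hgi : Ge Om e (invmx g).
    split; last first.
      by rewrite -{1}(mulmxK ug e) -hge -mulmxA mulKmx.
    rewrite trmx_inv -{1}hgO !mulmxA mulVmx ?unitmx_tr // mul1mx -mulmxA mulmxV // mulmx1.
    by [].
  have [ugi] := conj_sp hgi (A_sig bA); rewrite invmxK => h; exact: h.
have eb := A_comm bA.
have hgi : invmx g *m e = e *m invmx g.
  by rewrite -{1}(mulmxK ug e) -hge -mulmxA mulKmx.
transitivity (g *m (e *m bas A i) *m invmx g); first by rewrite !mulmxA hge.
by rewrite eb -!mulmxA hgi.
Qed.

Theorem core_in_grp P : in_subalg H P -> grp_inv A (Ge Om e) P.
Proof.
case=> R -> g hg; apply: tv_ext => x sx; rewrite comp_conj // !comp_mpoly_meval.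
have [ug hs] := conj_sp hg sx; case: (hg) => hgO hge.
apply: meval_eq => r; rewrite !tnth_mktuple !hH; try exact/spP.
have jN : (jr r <= N)%N by case/andP: (jr_le r).
rewrite -[RHS](F_conj K0 _ _ jN (g := invmx g)) ?invmxK ?unitmx_inv //.
by rewrite -{1}(mulmxK ug e) -hge -mulmxA mulKmx.
Qed.

Lemma cayley_expand (x y : 'M[K]_N) t : (1%:M + t *: x) *m y *m (1%:M - t *: x) =
  y + (t *: ad x y + (- t ^+ 2) *: (x *m y *m x)).
Proof.
rewrite mulmxBr mulmx1 mulmxDl mul1mx -scalemxAr mulmxDl -!scalemxAl /ad.
move: (x *m y *m x) (x *m y) (y *m x) => a1 a2 a3.
by apply/matrixP => i j; rewrite !mxE; ring.
Qed.

(** Conjugating [a *m y *m b] instead of [y] keeps both sides polynomial in [t]: conjugation by the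
    Cayley transform turns it into [b *m y *m a], the same expression with [- t] for [t]. *)
Lemma cayley_Ge x y t (a := 1%:M + t *: x) (b := 1%:M - t *: x) :
  sig Om x = x -> e *m x = x *m e -> sig Om y = y -> a \in unitmx -> b \in unitmx ->
  [/\ Ge Om e (a *m invmx b), sig Om (a *m y *m b) = a *m y *m b &
      invmx (a *m invmx b) *m (a *m y *m b) *m (a *m invmx b) = b *m y *m a].
Proof.
move=> sx ex sy ua ub.
have ab : a *m b = b *m a.
  rewrite /a /b !mulmxDl !mulmxDr !mulmx1 !mul1mx !mulmxN !mulNmx.
  move: (t *: x *m (t *: x)) (t *: x) => a1 a2.
  by apply/matrixP => i j; rewrite !mxE; ring.
have xO : x^T *m Om = - (Om *m x).
  by rewrite -{2}sx /sig mulmxN opprK -mulmxA mulKVmx.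
have aO : a^T *m Om = Om *m b.
  by rewrite /a /b linearD /= trmx1 linearZ /= mulmxDl mul1mx -scalemxAl xO mulmxDr mulmx1 mulmxN -scalemxAr scalerN.
have bO : b^T *m Om = Om *m a.
  by rewrite /a /b linearB /= trmx1 linearZ /= mulmxBl mul1mx -scalemxAl xO mulmxDr mulmx1 -scalemxAr scalerN opprK.
have ea : e *m a = a *m e.
  by rewrite /a mulmxDl mulmxDr mul1mx mulmx1 -scalemxAl -scalemxAr ex.
have eb : e *m b = b *m e.
  by rewrite /b mulmxBl mulmxBr mul1mx mulmx1 -scalemxAl -scalemxAr ex.
have ebi : invmx b *m e = e *m invmx b.
  by rewrite -{1}(mulmxK ub e) eb -mulmxA mulKmx.
split.
- split; last by rewrite -mulmxA ebi mulmxA -ea mulmxA.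
  rewrite trmx_mul trmx_inv -!mulmxA (mulmxA _ Om) aO -!mulmxA (mulmxA b) -ab (mulmxK ub).
  by rewrite -bO mulKmx // unitmx_tr.
- have sa' : sig Om a = - b by rewrite /sig -mulmxA aO mulKmx.
  have sb' : sig Om b = - a by rewrite /sig -mulmxA bO mulKmx.
  by rewrite !sigM // sy sa' sb' !(mulmxN, mulNmx, opprK) mulmxA.
have -> : invmx (a *m invmx b) = b *m invmx a.
  apply: (can_inj (mulKmx (_ : a *m invmx b \in unitmx))); first by rewrite unitmx_mul ua unitmx_inv.
  rewrite mulmxV ?unitmx_mul ?ua ?unitmx_inv //.
  by rewrite -mulmxA (mulmxA _ b) mulVmx // mul1mx mulmxV.
rewrite -!mulmxA (mulmxA (invmx a)) mulVmx // mul1mx (mulmxA b a) -ab (mulmxK ub).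
by rewrite !mulmxA.
Qed.

Theorem core_grp_lie P : grp_inv A (Ge Om e) P -> lie_inv A P.
Proof.
move=> hP xi xiA.
have sx := A_sig xiA; have ex := A_comm xiA.
have n2 := natr_neq0 K0 1.
apply: tv_ext => y sy; rewrite meval0 raddf_sum /=.
have adA i : ad xi (bas A i) \in A by apply: ad_A => //; apply: bas_mem.
transitivity (der P (tv y) (tv (ad y xi))).
  apply: eq_bigr => i _; rewrite mevalM lin_meval; last exact: adA.
  by rewrite trform_ad.
(* Invariance under the Cayley transform (1 + t xi) (1 - t xi)^-1 makes
   P ((1 + t xi) y (1 - t xi)) even in t; its linear term is the derivative along [xi, y]. *)
pose q (u : K) i : {poly K} := (tv y i)%:P + u *: ((tv (ad xi y) i) *: 'X) - (tv (xi *m y *m xi) i) *: 'X^2.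
have hq u t i : u * u = 1 -> (q u i).[t] = tv ((1%:M + (u * t) *: xi) *m y *m (1%:M - (u * t) *: xi)) i.
  move=> uu.
  rewrite cayley_expand tvD tvD !tvZ /q quad_horner.
  by have -> : (u * t) ^+ 2 = t ^+ 2 by rewrite exprMn expr2 uu mul1r.
have hc : curve (q 1) P = curve (q (-1)) P.
  apply: (poly_eq_generic K0 (d := unip xi * unip (- xi))) => [|t]; first by rewrite mulf_neq0 // unip_neq0.
  rewrite hornerM mulf_eq0 negb_or !unip_horner scalerN => /andP[u1 u2].
  have ua : 1%:M + t *: xi \in unitmx by rewrite unitmxE unitfE.
  have ub : 1%:M - t *: xi \in unitmx by rewrite unitmxE unitfE.
  have [ge sab hconj] := cayley_Ge sx ex sy ua ub.
  rewrite !curve_horner.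
  transitivity (P.@[tv ((1%:M + t *: xi) *m y *m (1%:M - t *: xi))]).
    by apply: meval_eq => i; rewrite hq ?mulr1 // mul1r.
  transitivity (P.@[tv ((1%:M - t *: xi) *m y *m (1%:M + t *: xi))]); last first.
    by apply: meval_eq => i; rewrite hq ?mulrNN ?mulr1 // mulN1r !scaleNr opprK.
  by rewrite -[in LHS](hP _ ge) comp_conj // hconj.
have h1 := congr1 (fun p : {poly K} => p`_1) hc; rewrite /= !curve1 in h1.
have hd u : der P (fun i => (q u i).[0]) (fun i => (q u i)`_1) = u * der P (tv y) (tv (ad xi y)).
  rewrite /der mulr_sumr; apply: eq_bigr => i _.
  have -> : (q u i)`_1 = u * tv (ad xi y) i by rewrite quad_coef1.
  have -> : (mderiv i P).@[fun i => (q u i).[0]] = (mderiv i P).@[tv y].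
    apply: meval_eq => l; rewrite /q quad_horner mulr0 mul0r expr0n /= oppr0 mul0r.
    by rewrite !addr0.
  by rewrite mulrCA.
rewrite !hd mul1r mulN1r in h1.
have h2 : der P (tv y) (tv (ad xi y)) = 0.
  apply: (mulfI n2); rewrite mulr0 mulr_natl mulr2n {1}h1 addNr.
  by [].
have -> : der P (tv y) (tv (ad y xi)) = - der P (tv y) (tv (ad xi y)).
  rewrite /der -sumrN; apply: eq_bigr => i _; rewrite -mulrN; congr (_ * _).
  have -> : ad y xi = -1 *: ad xi y by rewrite scaleN1r /ad opprB.
  by rewrite tvZ mulN1r.
by rewrite h2 oppr0.
Qed.

End Core.

Lemma F_origin (K : fieldType) N (K0 : [pchar K] =i pred0) j d (x : 'M[K]_N) :
  F 0 j d x = DeltaR j x *+ (d == j).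
Proof.
rewrite (Fpoly_uniq K0 (p := DeltaR j x *: 'X^j)) => [|t _].
  by rewrite coefZ coefXn; case: eqP => _; rewrite ?mulr1 ?mulr0.
by rewrite add0r DeltaRZ hornerZ hornerXn mulrC.
Qed.

(** * The case [e = 0] and the final statement *)

Section Main.
Variables (K : closedFieldType) (n : nat) (Om : 'M[K]_(n.*2)).
Hypothesis K0 : [pchar K] =i pred0.
Hypothesis hOm : Om^T = - Om.
Hypothesis uOm : Om \in unitmx.
Variable c : K.
Hypothesis c0 : c != 0.
Local Notation Fbar := (fun i : 'I_n => kinv c (sp Om) (sp Om) (Delta (2 * i.+1))).

Lemma sp_jordan (e : 'M[K]_(n.*2)) : sig Om e = e -> e ^+ n.*2 = 0 ->
  exists k lam inv eps ell, jordan_form (invmx Om) e k lam inv eps ell.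
Proof.
move=> he hn; apply: (jordan_form_exists K0).
- exact: G_skew.
- by rewrite unitmx_inv.
- exact: e_adj.
by exists n.*2.
Qed.

(** The results on centralisers are applied at [e = 0], with [sp Om] itself as the abstract subspace
    [A]. Group invariance is the bridge from membership in the subalgebra back to Lie invariance. *)
Lemma sp_gen_system (n0 : (0 < n)%N) : gen_system (sp Om) n Fbar.
Proof.
have nd := sp_nondeg K0 uOm hOm.
have s0 : sig Om 0 = 0 by rewrite /sig trmx0 mulmx0 mul0mx oppr0.
split=> [i|P].
  exists (jr i).
  have [b [bs hb]] := dual_basis c0 (subvv (sp Om)) nd.
  apply: (homog_of_scale K0) => t a.
  pose x := \sum_l a l *: b l.
  have xs : x \in sp Om by apply: rpred_sum => l _; apply: rpredZ.
  have ha l : tv c (A := sp Om) x l = a l.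
    rewrite /x tv_sum (bigD1 l) //= hb eqxx mulr1 big1 ?addr0 // => l' li.
    by rewrite hb eq_sym (negbTE li) mulr0.
  have h1 := kinv_Delta c0 nd (jr i) xs.
  have h2 := kinv_Delta c0 nd (jr i) (rpredZ t xs : t *: x \in sp Om).
  rewrite -(meval_eq _ ha); rewrite DeltaE in h1; rewrite DeltaE DeltaRZ -h1 in h2.
  rewrite -[RHS]h2; apply: meval_eq => l.
  by rewrite -[RHS]/(tv c (A := sp Om) (t *: x) l) tvZ ha.
have he : sig Om 0 = 0 := s0.
have hn : (0 : 'M[K]_(n.*2)) ^+ n.*2 = 0 by rewrite expr0n -leqn0 leqNgt double_gt0 n0.
have [k [lam [inv [eps [ell jf]]]]] := sp_jordan he hn.
have memA x : (x \in sp Om) = (x \in sp Om) && (ad 0 x == 0).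
  by rewrite /ad mul0mx mulmx0 subrr eqxx andbT.
(* At the origin the only component of [Delta j] that can be nonzero has degree [j], so nonvanishing
   of the lowest one determines [dg]. *)
have hdg (r : 'I_n) : dg k lam (jr r) = jr r.
  have [x _] := F_nz K0 uOm hOm he hn jf r.
  by rewrite (F_origin K0); case: (eqVneq (dg k lam (jr r)) (jr r)) => // _; rewrite mulr0n eqxx.
have hH (r : 'I_n) x : x \in sp Om -> (Fbar r).@[tv c (A := sp Om) x] = F 0 (jr r) (dg k lam (jr r)) x.
  by move=> xs; rewrite hdg (F_origin K0) eqxx mulr1n -DeltaE -(kinv_Delta c0 nd).
split; first exact: (core_lie_in K0 uOm hOm he hn jf c0 memA hH).
move=> h; apply: (core_grp_lie K0 uOm hOm c0 memA).
exact: (core_in_grp K0 uOm hOm c0 memA hH).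
Qed.

End Main.

Theorem theorem4p7 (K : closedFieldType) (n : nat) (Om : 'M[K]_(n.*2))
  (c : K) (e h f : 'M[K]_(n.*2)) :
  [pchar K] =i pred0 ->
  (2 <= n)%N ->
  Om^T = - Om -> Om \in unitmx ->
  c != 0 ->
  (e \in sp Om)%VS -> e ^+ (n.*2) = 0 ->
  (e = 0 -> f = 0) ->
  (e != 0 -> [/\ (h \in sp Om)%VS, (f \in sp Om)%VS,
                 [/\ h *m e - e *m h = 2%:R *: e, h *m f - f *m h = - (2%:R *: f)
                   & e *m f - f *m e = h] & trform c e f = 1]) ->
  let g := sp Om in
  let Fbar := fun i : 'I_n => kinv c g g (Delta (2 * i.+1)) in
  let Fgl := fun i : 'I_n => kinv c fullv fullv (Delta (2 * i.+1)) in
  let ge := cent g e in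
  [/\ very_good c g e f n Fbar,
      (forall P, lie_inv ge P <-> grp_inv ge (Ge Om e) P),
      (forall P, lie_inv ge P <-> in_subalg (fun i => eF c g e f (Fbar i)) P) &
      (forall i : 'I_n,
         deg (eF c g e f (Fbar i)) = deg (eF c fullv e f (Fgl i)))].
Proof.
move=> K0 n2 hOm uOm c0 es hn ef0 triple g Fbar Fgl ge.
have he : sig Om e = e by move: es; rewrite spE // => /eqP.
have [k [lam [inv [eps [ell jf]]]]] := sp_jordan K0 hOm uOm he hn.
have nd := sp_nondeg K0 uOm hOm.
have ndf (a : 'M[K]_(n.*2)) : a \in fullv -> (forall x, x \in fullv -> \tr (a *m x) = 0) -> a = 0.
  by move=> _ h1; apply: trform_nondeg => x; apply: h1; rewrite memvf.
(* With [ad e f] in place of [h] the relations of a triple hold for [e = 0] as well, where [f = 0]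
   and nothing is assumed about [h]. *)
have [sf hhe hhf] : [/\ sig Om f = f, ad (ad e f) e = 2%:R *: e & ad (ad e f) f = - (2%:R *: f)].
  case: (eqVneq e 0) => [e0|/triple[hs fs [h1 h2 h3] _]].
    rewrite e0 (ef0 e0) /ad !(mul0mx, mulmx0, subrr, scaler0, oppr0); split=> //.
    by rewrite /sig trmx0 mulmx0 mul0mx oppr0.
  by split; rewrite /ad ?h3 //; move: fs; rewrite spE // => /eqP.
have spP x : reflect (sig Om x = x) (x \in sp Om) by rewrite spE //; apply: eqP.
have ade x : x \in sp Om -> ad e x \in sp Om.
  by move=> /spP sx; apply/spP; rewrite (sig_ad uOm).
have adf x : x \in sp Om -> ad f x \in sp Om.
  by move=> /spP sx; apply/spP; rewrite (sig_ad uOm).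
have nz := F_nz K0 uOm hOm he hn jf.
have hj := @jr_le n.
have memA x : (x \in ge) = (x \in sp Om) && (ad e x == 0) by rewrite mem_cent.
have hH (r : 'I_n) x : x \in sp Om -> (eF c g e f (Fbar r)).@[tv c (A := ge) x] = F e (jr r) (dg k lam (jr r)) x.
  by move=> xs; apply: (eF_F K0 uOm hn jf c0 nd es erefl hhe hhf ade adf (hj r) (nz r) xs).
have lie_in P : lie_inv ge P -> in_subalg (fun i => eF c g e f (Fbar i)) P.
  exact: (core_lie_in K0 uOm hOm he hn jf c0 memA hH).
have in_grp P : in_subalg (fun i => eF c g e f (Fbar i)) P -> grp_inv ge (Ge Om e) P.
  exact: (core_in_grp K0 uOm hOm c0 memA hH).
have grp_lie P : grp_inv ge (Ge Om e) P -> lie_inv ge P.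
  exact: (core_grp_lie K0 uOm hOm c0 memA).
split.
- split; first by apply: sp_gen_system => //; apply: ltnW.
  exact: (core_codim2 K0 uOm hOm he hn jf c0 memA hH).
- by move=> P; split=> [/lie_in/in_grp|/grp_lie].
- by move=> P; split=> [/lie_in|/in_grp/grp_lie].
move=> i.
rewrite (deg_eF K0 uOm hn jf c0 nd es erefl hhe hhf ade adf (hj i) (nz i)).
apply/esym.
(* The component is the same function in [sp] and in [gl], and nonvanishing on [sp] carries over, so
   both degrees equal [dg k lam (jr i)]. *)
have nz' : exists2 x, x \in fullv & F e (jr i) (dg k lam (jr i)) x != 0.
  by have [x _ hx] := nz i; exists x; rewrite ?memvf.
by apply: (deg_eF K0 uOm hn jf c0 ndf (memvf e) erefl hhe hhf _ _ (hj i) nz') => x _; apply: memvf.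
Qed.
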